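(* Let $u,d$ be positive integers with $u<d/2$ and $\gcd(u,d)=1$, and let $\mathbb K$ be a field. With the notation of the context, the map $\Phi_2$ in the minimal bigraded free resolution $0\to F_3\xrightarrow{\Phi_3}F_2\xrightarrow{\Phi_2}F_1\xrightarrow{\Phi_1}S\xrightarrow{\Phi_0}\mathrm{Rees}(\mathcal I)\to0$ of the $S$-module $\mathrm{Rees}(\mathcal I)$ (with $F_1=\bigoplus_{n=1}^{q+2}S(-(b_n,|\sigma_n-\tau_n|))$ and $\Phi_1(\mathbf e_n)=F_{n,b_n}$) can be made explicit as $$\Phi_2:\ \bigoplus_{n=1}^{q}S\big(-(b_n,|\sigma_{\rho(n)}-\tau_{\rho(n)}|)\big)^2\to\bigoplus_{n=1}^{q+2}S\big(-(b_n,|\sigma_n-\tau_n|)\big),\qquad \mathbf e_{n,k}\mapsto\mathbf s_{n,k},$$ where the canonical basis of the source is $\{\mathbf e_{n,\rho(n)},\mathbf e_{n,m_{\ell(n)}}\}_{n=1,\dots,q-1}\cup\{\mathbf e_{q,q+1},\mathbf e_{q+1,q+2}\}$, with $\mathrm{bideg}(\mathbf e_{n,\rho(n)})=\mathrm{bideg}(\mathbf e_{n,m_{\ell(n)}})=(b_n,|\sigma_{\rho(n)}-\tau_{\rho(n)}|)$ and $\mathrm{bideg}(\mathbf e_{q,q+1})=\mathrm{bideg}(\mathbf e_{q+1,q+2})=(1,d)$. Moreover, the set $$\mathcal F_1=\{\mathbf s_{q,q+1},\mathbf s_{q+1,q+2}\}\cup\{\mathbf s_{n,m_{\ell(n)}},\mathbf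 s_{n,\rho(n)}\}_{n=1,\dots,q-1}$$ is a reduced Gröbner basis of $\ker(\Phi_1)\subset S^{q+2}$ with respect to $\prec_{l,\mathcal F_0}$, and a minimal set of generators of this module.
   Context: Setting: $R=\mathbb K[T_0,T_1]$, $S=\mathbb K[T_0,T_1,X_0,X_1,X_2]$, $\mathcal I=\langle T_0^d,\,T_0^{d-u}T_1^u,\,T_1^d\rangle\subset R$, $\mathrm{Rees}(\mathcal I)=\bigoplus_{n\ge0}\mathcal I^nZ^n\subset R[Z]$. $\Phi_0:S\to\mathrm{Rees}(\mathcal I)$ is the surjective $\mathbb K$-algebra morphism with $T_i\mapsto T_i$, $X_0\mapsto ZT_0^d$, $X_1\mapsto ZT_0^{d-u}T_1^u$, $X_2\mapsto ZT_1^d$; $\mathrm{Rees}(\mathcal I)$ is an $S$-module through $\Phi_0$. Bigrading: $\mathrm{bideg}(T_i)=(1,0)$, $\mathrm{bideg}(X_j)=(0,1)$, $\mathrm{bideg}(Z)=(-d,1)$; $S(a,b)_{(k,l)}=S_{(a+k,b+l)}$. Euclidean data: $a_0=d-u$, $a_1=u$, and for $1\le i\le p-1$, $a_{i-1}=q_ia_i+a_{i+1}$ with $0\le a_{i+1}<a_i$, where $p$ is such that $a_p=0$. Put $q=\sum_{i=1}^{p-1}q_i$, $m_\ell=1+\sum_{j=1}^{\ell}q_j$ for $0\le\ell\le p-1$, $m_p=q+2$. For $1\le n\le q$, $\ell(n)$ is the unique $\ell$ with $m_{\ell-1}\le n<m_\ell$, and $\rho(n)=n+1$ if $n+1<m_{\ell(n)}$,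 $\rho(n)=m_{\ell(n)+1}$ if $n+1=m_{\ell(n)}$. Slow Euclidean Remainder Sequence: $(b_1,c_1)=(d-u,u)$, $(\sigma_1,\tau_1,\alpha_1,\beta_1)=(0,1,1,0)$, and for $1\le n\le q$: if $b_n-c_n\ge c_n$, then $(b_{n+1},c_{n+1})=(b_n-c_n,c_n)$ and $(\sigma_{n+1},\tau_{n+1},\alpha_{n+1},\beta_{n+1})=(\sigma_n-\alpha_n,\tau_n-\beta_n,\alpha_n,\beta_n)$; if $b_n-c_n<c_n$, then $(b_{n+1},c_{n+1})=(c_n,b_n-c_n)$ and $(\sigma_{n+1},\tau_{n+1},\alpha_{n+1},\beta_{n+1})=(\alpha_n,\beta_n,\sigma_n-\alpha_n,\tau_n-\beta_n)$. Moreover $b_{q+2}=0$ and, by convention, $(\sigma_{q+2},\tau_{q+2})=(d-u,-u)$, so $|\sigma_{q+2}-\tau_{q+2}|=d$. Polynomials: for $1\le n\le q+1$, $F_{n,b_n}=T_0^{b_n}X_0^{-\sigma_n}X_2^{\tau_n}-T_1^{b_n}X_1^{\tau_n-\sigma_n}$ if $\sigma_n\le0$, and $F_{n,b_n}=T_0^{b_n}X_1^{\sigma_n-\tau_n}-T_1^{b_n}X_0^{\sigma_n}X_2^{-\tau_n}$ if $\sigma_n>0$; $F_{q+2,0}=X_0^{d-u}X_2^u-X_1^d$ if $\sigma_q>0$, $F_{q+2,0}=X_1^d-X_0^{d-u}X_2^u$ if $\sigma_q<0$ (always $\sigma_q\ne0$). $\mathcal F_0=(F_{n,b_n})_{n=1,\dots,q+2}$.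 Syzygies in $S^{q+2}$ (canonical basis $\mathbf e_1,\dots,\mathbf e_{q+2}$). For $1\le n\le q-1$, write $m=m_{\ell(n)}$, $\rho=\rho(n)$: - if $\sigma_n\le0$: $\mathbf s_{n,\rho}=X_0^{\sigma_m}X_2^{-\tau_m}\mathbf e_n-T_0^{b_m}\mathbf e_\rho-T_1^{b_\rho}X_1^{\tau_n-\sigma_n}\mathbf e_m$ and $\mathbf s_{n,m}=X_1^{\sigma_m-\tau_m}\mathbf e_n-T_0^{b_\rho}X_0^{-\sigma_n}X_2^{\tau_n}\mathbf e_m-T_1^{b_m}\mathbf e_\rho$; - if $\sigma_n>0$: $\mathbf s_{n,\rho}=X_1^{\tau_m-\sigma_m}\mathbf e_n-T_0^{b_m}\mathbf e_\rho-T_1^{b_\rho}X_0^{\sigma_n}X_2^{-\tau_n}\mathbf e_m$ and $\mathbf s_{n,m}=X_0^{-\sigma_m}X_2^{\tau_m}\mathbf e_n-T_0^{b_\rho}X_1^{\sigma_n-\tau_n}\mathbf e_m-T_1^{b_m}\mathbf e_\rho$. For $n=q$ (where $m_{\ell(q)}=q+1$, $\rho(q)=q+2$): - if $\sigma_q<0$: $\mathbf s_{q,q+1}=X_1^{\sigma_{q+1}-\tau_{q+1}}\mathbf e_q-X_0^{-\sigma_q}X_2^{\tau_q}\mathbf e_{q+1}+T_1\mathbf e_{q+2}$; - if $\sigma_q>0$: $\mathbf s_{q,q+1}=X_0^{-\sigma_{q+1}}X_2^{\tau_{q+1}}\mathbf e_q-X_1^{\sigma_q-\tau_q}\mathbf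 e_{q+1}+T_1\mathbf e_{q+2}$. Finally - if $\sigma_{q+1}\le0$: $\mathbf s_{q+1,q+2}=X_0^{\sigma_q}X_2^{-\tau_q}\mathbf e_{q+1}-T_0\mathbf e_{q+2}-X_1^{\tau_{q+1}-\sigma_{q+1}}\mathbf e_q$; - if $\sigma_{q+1}>0$: $\mathbf s_{q+1,q+2}=X_1^{\tau_q-\sigma_q}\mathbf e_{q+1}-T_0\mathbf e_{q+2}-X_0^{\sigma_{q+1}}X_2^{-\tau_{q+1}}\mathbf e_q$. Orders: $\prec_l$ is the lexicographic order on the monomials of $S$ with $X_2\prec_lX_1\prec_lX_0\prec_lT_1\prec_lT_0$ if $\sigma_q>0$, and $X_2\prec_lX_0\prec_lX_1\prec_lT_1\prec_lT_0$ if $\sigma_q\le0$. The induced order $\prec_{l,\mathcal F_0}$ on monomials of $S^{q+2}$ is: for monomials $M,M'$ of $S$, $M\mathbf e_i\prec_{l,\mathcal F_0}M'\mathbf e_j$ iff $\mathrm{lm}(MF_{i,b_i})\prec_l\mathrm{lm}(M'F_{j,b_j})$, or these leading monomials are equal and $j<i$. A Gröbner basis of a submodule is reduced if its elements have leading coefficient $1$ and no term of one element is divisible by the leading monomial of another element. *)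

(* Defs.v *)
From mathcomp Require Import all_boot all_order all_algebra.
From mathcomp Require Import mpoly.

Set Implicit Arguments.
Unset Strict Implicit.
Unset Printing Implicit Defensive.

Import Order.TTheory GRing.Theory Num.Theory.
Local Open Scope ring_scope.

(* Subsets of a ring or of a module are Prop-valued predicates. *)

Definition submod_gen (R : nzRingType) (V : lmodType R) (A : V -> Prop) :
    V -> Prop :=
  fun v => exists (k : nat) (c : 'I_k -> R) (a : 'I_k -> V),
    (forall i, A (a i)) /\ v = \sum_(i < k) c i *: a i.

Definition ideal_gen (R : comNzRingType) (A : R -> Prop) : R -> Prop :=
  @submod_gen R R^o A.

Fixpoint ideal_pow (R : comNzRingType) (I : R -> Prop) (n : nat) : R -> Prop :=
  if n is n'.+1 then
    ideal_gen (fun x => exists y z, [/\ ideal_pow I n' y, I z & x = y * z])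
  else fun=> True.

Definition minimal_generators (R : nzRingType) (V : lmodType R)
    (N G : V -> Prop) : Prop :=
  (forall v, N v <-> submod_gen G v) /\
  (forall H : V -> Prop, (forall v, H v -> G v) ->
     (forall v, N v <-> submod_gen H v) -> forall v, G v -> H v).

(* The variables of S = K[T_0, T_1, X_0, X_1, X_2], in this order. *)
Definition iT0 : 'I_5 := @Ordinal 5 0 isT.
Definition iT1 : 'I_5 := @Ordinal 5 1 isT.
Definition iX0 : 'I_5 := @Ordinal 5 2 isT.
Definition iX1 : 'I_5 := @Ordinal 5 3 isT.
Definition iX2 : 'I_5 := @Ordinal 5 4 isT.

Definition bideg_mon (m : 'X_{1..5}) : int * int :=
  ((m iT0 + m iT1)%N%:Z, (m iX0 + m iX1 + m iX2)%N%:Z).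

Section EuclideanData.

Variables d u : nat.

Definition euclid_a (i : nat) : nat :=
  (iter i (fun x : nat * nat => (x.2, x.1 %% x.2)) (d - u, u)).1%N.

Definition euclid_quo (i : nat) : nat := (euclid_a i.-1 %/ euclid_a i)%N.

(* First index of a zero remainder: (euclid_a) decreases strictly down to 0
   from d - u <= d when 0 < u < d - u. *)
Definition euclid_p : nat := find (fun i => euclid_a i == 0%N) (iota 0 d.+1).

Definition qsum : nat := (\sum_(1 <= j < euclid_p) euclid_quo j)%N.

Definition mstep (l : nat) : nat :=
  if l == euclid_p then qsum.+2
  else (1 + \sum_(1 <= j < l.+1) euclid_quo j)%N.

Definition ell (n : nat) : nat :=
  (find (fun i => mstep i <= n < mstep i.+1)%N (iota 0 euclid_p)).+1.

Definition mell (n : nat) : nat := mstep (ell n).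

Definition rho (n : nat) : nat :=
  if (n.+1 < mell n)%N then n.+1 else mstep (ell n).+1.

(* b_n >= c_n at every step, so the truncated subtraction is the usual one. *)
Record sers_state := SersState {
  st_b : nat; st_c : nat; st_sigma : int; st_tau : int;
  st_alpha : int; st_beta : int
}.

Definition sers_step (s : sers_state) : sers_state :=
  let: SersState b c si ta al be := s in
  if (c <= b - c)%N then SersState (b - c) c (si - al) (ta - be) al be
  else SersState c (b - c) al be (si - al) (ta - be).

Definition sers (n : nat) : sers_state :=
  iter n.-1 sers_step (SersState (d - u) u 0 1 1 0).

Definition b_ (n : nat) : nat := if n == qsum.+2 then 0 else st_b (sers n).

Definition sigma (n : nat) : int :=
  if n == qsum.+2 then (d - u)%N%:Z else st_sigma (sers n).

Definition tau (n : nat) : int :=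
  if n == qsum.+2 then - u%:Z else st_tau (sers n).

(* Bidegree of F_{n, b_n}, i.e. of the basis element e_n of F_1. *)
Definition bidegF (n : nat) : int * int :=
  ((b_ n)%:Z, `|sigma n - tau n|).

(* Labels (n, k) of the basis elements e_{n,k} of F_2. *)
Definition F2_basis : seq (nat * nat) :=
  flatten [seq [:: (n, rho n); (n, mell n)] | n <- iota 1 qsum.-1]
  ++ [:: (qsum, qsum.+1); (qsum.+1, qsum.+2)].

Definition bideg_e2 (nk : nat * nat) : int * int :=
  if (nk.1 < qsum)%N then
    ((b_ nk.1)%:Z, `|sigma (rho nk.1) - tau (rho nk.1)|)
  else (1, d%:Z).

(* The twists of the direct sum over n = 1, ..., q of
   S(-(b_n, |sigma_rho(n) - tau_rho(n)|))^2. *)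
Definition F2_twists : seq (int * int) :=
  flatten [seq nseq 2 ((b_ n)%:Z, `|sigma (rho n) - tau (rho n)|)
          | n <- iota 1 qsum].

Definition shift1 (i : 'I_qsum.+2) : int * int := bidegF i.+1.

Definition shift2 (i : 'I_(size F2_basis)) : int * int :=
  bideg_e2 (nth (0, 0)%N F2_basis i).

(* Exponents of a monomial, from the largest variable to the smallest. *)
Definition lex_exponents (m : 'X_{1..5}) : seq nat :=
  if 0 < sigma qsum then [:: m iT0; m iT1; m iX0; m iX1; m iX2]
  else [:: m iT0; m iT1; m iX1; m iX0; m iX2].

Definition prec_l (m m' : 'X_{1..5}) : bool :=
  ((lex_exponents m : seqlexi nat) < lex_exponents m')%O.

End EuclideanData.

Definition is_max (T : eqType) (lt : T -> T -> Prop) (A : pred T) (t : T) :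
    Prop :=
  A t /\ forall s, A s -> s != t -> lt s t.

Section Polynomials.

Variables (K : fieldType) (d u : nat).

Local Notation S := {mpoly K[5]}.
Local Notation R := {mpoly K[2]}.
Local Notation T0 := ('X_iT0 : S).
Local Notation T1 := ('X_iT1 : S).
Local Notation X0 := ('X_iX0 : S).
Local Notation X1 := ('X_iX1 : S).
Local Notation X2 := ('X_iX2 : S).
Local Notation q := (qsum d u).
Local Notation b_ := (b_ d u).
Local Notation sg := (sigma d u).
Local Notation ta := (tau d u).
Local Notation rho := (rho d u).
Local Notation mell := (mell d u).

(* R = K[T_0, T_1], and R[Z] is {poly R}, with Z written 'X. *)
Definition rT0 : R := 'X_(@Ordinal 2 0 isT).
Definition rT1 : R := 'X_(@Ordinal 2 1 isT).

Definition idealI : R -> Prop :=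
  ideal_gen (fun f => [\/ f = rT0 ^+ d, f = rT0 ^+ (d - u) * rT1 ^+ u
                        | f = rT1 ^+ d]).

Definition in_rees (f : {poly R}) : Prop :=
  forall n : nat, ideal_pow idealI n f`_n.

Definition Phi0_var (i : 'I_5) : {poly R} :=
  tnth [tuple rT0%:P; rT1%:P; 'X * (rT0 ^+ d)%:P;
        'X * (rT0 ^+ (d - u) * rT1 ^+ u)%:P; 'X * (rT1 ^+ d)%:P] i.

Definition Phi0 : S -> {poly R} := mmap (polyC \o @mpolyC 2 K) Phi0_var.

(* Wherever they are used below, the exponents sigma, tau, ... have the sign
   that makes the exponent in front of them a natural number; absz only casts
   them from int to nat. *)
Definition Fpol (n : nat) : S :=
  if n == q.+2 then
    if 0 < sg q then X0 ^+ (d - u) * X2 ^+ u - X1 ^+ d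
    else X1 ^+ d - X0 ^+ (d - u) * X2 ^+ u
  else if sg n <= 0 then
    T0 ^+ b_ n * X0 ^+ `|- sg n|%N * X2 ^+ `|ta n|%N
    - T1 ^+ b_ n * X1 ^+ `|ta n - sg n|%N
  else
    T0 ^+ b_ n * X1 ^+ `|sg n - ta n|%N
    - T1 ^+ b_ n * X0 ^+ `|sg n|%N * X2 ^+ `|- ta n|%N.

(* The canonical basis e_1, ..., e_{q+2} of S^{q+2}. *)
Definition e_ (n : nat) : 'rV[S]_(q.+2) := \row_(j < q.+2) (j.+1 == n)%:R.

Definition syz_rho (n : nat) : 'rV[S]_(q.+2) :=
  let m := mell n in let r := rho n in
  if sg n <= 0 then
    (X0 ^+ `|sg m|%N * X2 ^+ `|- ta m|%N) *: e_ n - T0 ^+ b_ m *: e_ r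
    - (T1 ^+ b_ r * X1 ^+ `|ta n - sg n|%N) *: e_ m
  else
    X1 ^+ `|ta m - sg m|%N *: e_ n - T0 ^+ b_ m *: e_ r
    - (T1 ^+ b_ r * X0 ^+ `|sg n|%N * X2 ^+ `|- ta n|%N) *: e_ m.

Definition syz_m (n : nat) : 'rV[S]_(q.+2) :=
  let m := mell n in let r := rho n in
  if sg n <= 0 then
    X1 ^+ `|sg m - ta m|%N *: e_ n
    - (T0 ^+ b_ r * X0 ^+ `|- sg n|%N * X2 ^+ `|ta n|%N) *: e_ m
    - T1 ^+ b_ m *: e_ r
  else
    (X0 ^+ `|- sg m|%N * X2 ^+ `|ta m|%N) *: e_ n
    - (T0 ^+ b_ r * X1 ^+ `|sg n - ta n|%N) *: e_ m
    - T1 ^+ b_ m *: e_ r.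

(* s_{q, q+1} *)
Definition syz_q : 'rV[S]_(q.+2) :=
  if sg q < 0 then
    X1 ^+ `|sg q.+1 - ta q.+1|%N *: e_ q
    - (X0 ^+ `|- sg q|%N * X2 ^+ `|ta q|%N) *: e_ q.+1 + T1 *: e_ q.+2
  else
    (X0 ^+ `|- sg q.+1|%N * X2 ^+ `|ta q.+1|%N) *: e_ q
    - X1 ^+ `|sg q - ta q|%N *: e_ q.+1 + T1 *: e_ q.+2.

(* s_{q+1, q+2} *)
Definition syz_q1 : 'rV[S]_(q.+2) :=
  if sg q.+1 <= 0 then
    (X0 ^+ `|sg q|%N * X2 ^+ `|- ta q|%N) *: e_ q.+1 - T0 *: e_ q.+2
    - X1 ^+ `|ta q.+1 - sg q.+1|%N *: e_ q
  else
    X1 ^+ `|ta q - sg q|%N *: e_ q.+1 - T0 *: e_ q.+2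
    - (X0 ^+ `|sg q.+1|%N * X2 ^+ `|- ta q.+1|%N) *: e_ q.

(* s_{n,k}, for a label (n, k) in F2_basis. *)
Definition syz (nk : nat * nat) : 'rV[S]_(q.+2) :=
  if nk.1 == q.+1 then syz_q1
  else if nk.1 == q then syz_q
  else if nk.2 == rho nk.1 then syz_rho nk.1
  else syz_m nk.1.

(* Maps between free modules act on row vectors by right multiplication: the
   i-th row is the image of the i-th basis element. *)
Definition Phi1_mx : 'M[S]_(q.+2, 1) := \col_(i < q.+2) Fpol i.+1.

Definition Phi2_mx : 'M[S]_(size (F2_basis d u), q.+2) :=
  \matrix_(i < size (F2_basis d u)) syz (nth (0, 0)%N (F2_basis d u) i).

Definition kerPhi1 (v : 'rV[S]_(q.+2)) : Prop := v *m Phi1_mx = 0.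

Definition calF1 : seq 'rV[S]_(q.+2) := [seq syz nk | nk <- F2_basis d u].

(* S_D, for D in Z^2. *)
Definition bihomog (D : int * int) (f : S) : Prop :=
  forall m, m \in msupp f -> bideg_mon m = D.

(* The degree D part of the direct sum of the S(-delta i). *)
Definition bihomog_vec (n : nat) (delta : 'I_n -> int * int) (D : int * int)
    (v : 'rV[S]_n) : Prop :=
  forall i, bihomog (D - delta i) (v 0 i).

Definition bigraded_mx (m n : nat) (delta : 'I_m -> int * int)
    (epsilon : 'I_n -> int * int) (A : 'M[S]_(m, n)) : Prop :=
  forall D v, bihomog_vec delta D v -> bihomog_vec epsilon D (v *m A).

(* The degree D part of R[Z], where bideg T_i = (1, 0), bideg Z = (-d, 1). *)
Definition bihomog_RZ (D : int * int) (f : {poly R}) : Prop :=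
  forall n m, m \in msupp f`_n -> ((mdeg m)%:Z - (d * n)%N%:Z, n%:Z) = D.

(* The image of the map is contained in <T_0, T_1, X_0, X_1, X_2> S^n. *)
Definition minimal_mx (m n : nat) (A : 'M[S]_(m, n)) : Prop :=
  forall i j, (A i j)@_0%MM = 0.

(* 0 -> S^r3 -> S^r2 -> S^r1 -> S -> Rees(I) -> 0 is a minimal bigraded free
   resolution, where the basis elements of S^ri have bidegrees deltai. *)
Record min_bigraded_resolution (r1 r2 r3 : nat)
    (delta1 : 'I_r1 -> int * int) (delta2 : 'I_r2 -> int * int)
    (delta3 : 'I_r3 -> int * int)
    (A1 : 'M[S]_(r1, 1)) (A2 : 'M[S]_(r2, r1)) (A3 : 'M[S]_(r3, r2)) :
    Prop := {
  res_surj0 : forall f, in_rees f <-> exists p, f = Phi0 p;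
  res_exact0 : forall p : S,
    Phi0 p = 0 <-> exists v : 'rV[S]_r1, p = (v *m A1) 0 0;
  res_exact1 : forall v : 'rV[S]_r1,
    v *m A1 = 0 <-> exists w : 'rV[S]_r2, v = w *m A2;
  res_exact2 : forall v : 'rV[S]_r2,
    v *m A2 = 0 <-> exists w : 'rV[S]_r3, v = w *m A3;
  res_inj3 : forall v : 'rV[S]_r3, v *m A3 = 0 -> v = 0;
  res_bigraded0 : forall D p, bihomog D p -> bihomog_RZ D (Phi0 p);
  res_bigraded1 : bigraded_mx delta1 (fun=> (0, 0)) A1;
  res_bigraded2 : bigraded_mx delta2 delta1 A2;
  res_bigraded3 : bigraded_mx delta3 delta2 A3;
  res_minimal1 : minimal_mx A1;
  res_minimal2 : minimal_mx A2;
  res_minimal3 : minimal_mx A3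
}.

(* The monomial M e_i of S^r is the pair (M, i), with i counted from 0. *)

Definition is_lm (f : S) (m : 'X_{1..5}) : Prop :=
  is_max (prec_l d u) (fun m' => m' \in msupp f) m.

Definition prec_F0 (t t' : 'X_{1..5} * 'I_q.+2) : Prop :=
  exists a a', [/\ is_lm ('X_[t.1] * Fpol t.2.+1) a,
                   is_lm ('X_[t'.1] * Fpol t'.2.+1) a' &
    prec_l d u a a' \/ a = a' /\ (t'.2 < t.2)%N].

Definition coef_vec (r : nat) (v : 'rV[S]_r) (t : 'X_{1..5} * 'I_r) : K :=
  (v 0 t.2)@_(t.1).

Definition mon_vec (r : nat) (t : 'X_{1..5} * 'I_r) : 'rV[S]_r :=
  'X_[t.1] *: delta_mx 0 t.2.

Definition mon_dvd (r : nat) (t t' : 'X_{1..5} * 'I_r) : Prop :=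
  t.2 = t'.2 /\ (t.1 <= t'.1)%MM.

Section Groebner.

Variables (r : nat).
Variable lt : 'X_{1..5} * 'I_r -> 'X_{1..5} * 'I_r -> Prop.

Definition is_lm_vec (v : 'rV[S]_r) (t : 'X_{1..5} * 'I_r) : Prop :=
  is_max lt (fun s => coef_vec v s != 0) t.

Definition lead_monomials (A : 'rV[S]_r -> Prop) : 'rV[S]_r -> Prop :=
  fun w => exists v t, [/\ A v, is_lm_vec v t & w = mon_vec t].

Definition groebner_basis (N : 'rV[S]_r -> Prop) (G : seq 'rV[S]_r) : Prop :=
  (forall g, g \in G -> N g) /\
  (forall v, submod_gen (lead_monomials N) v <->
             submod_gen (lead_monomials (fun g => g \in G)) v).

Definition reduced_groebner_basis (N : 'rV[S]_r -> Prop) (G : seq 'rV[S]_r) :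
    Prop :=
  [/\ groebner_basis N G,
      (forall g, g \in G -> exists2 t, is_lm_vec g t & coef_vec g t = 1) &
      (forall g h s t, g \in G -> h \in G -> g != h ->
         coef_vec g s != 0 -> is_lm_vec h t -> ~ mon_dvd t s)].

End Groebner.

End Polynomials.

(* Main.v *)
Require Import Defs.
From mathcomp Require Import all_boot all_order all_algebra.
From mathcomp Require Import mpoly zify ring.

Set Implicit Arguments.
Unset Strict Implicit.
Unset Printing Implicit Defensive.

Import Order.TTheory GRing.Theory Num.Theory.
Local Open Scope ring_scope.

(* Write F_n = L_n - U_n with L_n = T_0^(b_n) P_n and U_n = T_1^(b_n) Q_n, where
   P_n and Q_n are the monomials in X_0, X_2 and in X_1, or conversely, that are
   read off (sigma_n, tau_n); the last binomial is Q_q P_{q+1} - P_q Q_{q+1}.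
   Every step n gives a triangle n, m(n), rho(n) with b_n = b_m + b_rho,
   P_rho = P_n Q_m and Q_rho = Q_n P_m, so that the syzygies become
     s_{n,rho} = Q_m e_n - T_0^(b_m) e_rho - T_1^(b_rho) Q_n e_m,
     s_{n,m} = P_m e_n - T_0^(b_rho) P_n e_m - T_1^(b_m) e_rho,
   without distinguishing the sign of sigma_n.

   A kernel element of Phi_0 has two monomials with the same image; their
   difference is a vector (s, t) with u s + (d - u) t >= 0, and a descent along
   the slow Euclidean sequence finds an L_n dividing the larger one.  A kernel
   element of Phi_1 has leading monomial M e_i with M L_i = M' L_j for some
   j > i, and then M is a multiple of Q_{m(i)} or P_{m(i)}, because P_j is a
   multiple of P_i Q_{m(i)} or of P_{m(i)}, according to whether sigma_i and
   sigma_j lie on the same side or not.  In both cases division by leading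
   monomials gives generators.
   Finally P_m s_{n,rho} - Q_m s_{n,m} is the Koszul syzygy of F_m and F_rho,
   and so is, up to sign, a combination of the pair of syzygies of index n + 1:
   this yields Phi_3, and exactness of the left half of the resolution follows
   by eliminating the pairs of coordinates in increasing order of n, since P_m
   and Q_m are coprime. *)

(** * The slow Euclidean remainder sequence *)

(** The signs stay out of the argument because (sigma_n, tau_n) and (alpha_n, beta_n) always lie in
    opposite quadrants, and (alpha_n, beta_n) is the vector of index m(n): P_m shares its variables
    with Q_n, and Q_m with P_n, so exponents add in every triangle. The vectors are Bezout cofactors
    of determinant 1 or -1; at n = q both remainders are 1, so the difference of the two vectors is,
    up to sign, the primitive relation (d - u, -u), the origin of F_{q+2}. As T_0 is the largest
    variable, L_n leads F_n for n <= q + 1; F_{q+2} involves no T, which is why the order depends on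
    the sign of sigma_q. No S-polynomial is reduced: in the image of a kernel element the leading
    monomial has to cancel, and this already names a second index. Nor is a general acyclicity
    criterion used: Phi_2 and Phi_3 have a staircase shape, and the q-th pair is settled by a 2 by 2
    system of determinant F_{q+1}. Minimality of the generators is read off from Phi_3, whose
    entries have no constant term. *)

Section EuclideanCombinatorics.

Variables d u : nat.
Hypotheses (u_gt0 : (0 < u)%N) (u_lt : (2 * u < d)%N) (ud_coprime : coprime u d).

Local Notation a := (euclid_a d u).
Local Notation quo := (euclid_quo d u).
Local Notation p := (euclid_p d u).
Local Notation q := (qsum d u).
Local Notation mstep := (mstep d u).
Local Notation ell := (ell d u).
Local Notation mell := (mell d u).
Local Notation rho := (rho d u).
Local Notation sers := (sers d u).

Local Open Scope nat_scope.

Lemma euclid_a0 : a 0 = d - u. Proof. by []. Qed.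

Lemma euclid_a1 : a 1 = u. Proof. by []. Qed.

Lemma euclid_aSS i : a i.+2 = a i %% a i.+1.
Proof. by []. Qed.

Lemma euclid_a_lt i : 0 < a i.+1 -> a i.+2 < a i.+1.
Proof. by move=> h; rewrite euclid_aSS ltn_mod. Qed.

Lemma euclid_a_decr i : (forall j, j <= i -> 0 < a j) -> a i.+1 + i < d - u.
Proof.
elim: i => [|i IH] h; first by rewrite euclid_a1; lia.
have := IH (fun j hj => h j (leqW hj)).
have := @euclid_a_lt i (h i.+1 (leqnn _)); lia.
Qed.

(** Without a zero the remainders would drop at each of [d] steps, starting below [d - u]. So the
    search in [euclid_p] succeeds and [find] does not return its default, the length of the list. *)
Lemma euclid_has0 : has (fun i => a i == 0) (iota 0 d.+1).
Proof.
apply/negPn/negP => /hasPn h.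
have h1 j : j <= d -> 0 < a j.
  by move=> hj; rewrite lt0n; apply: h; rewrite mem_iota.
have := @euclid_a_decr d h1; lia.
Qed.

Lemma euclid_ap : a p = 0.
Proof.
have h := nth_find 0 euclid_has0; have h1 := euclid_has0.
rewrite has_find size_iota in h1.
by rewrite nth_iota // in h; apply/eqP.
Qed.

Lemma euclid_a_gt0 i : i < p -> 0 < a i.
Proof.
move=> h; have := before_find 0 h; rewrite nth_iota ?add0n ?lt0n; first by move->.
have h1 := find_size (fun i => a i == 0) (iota 0 d.+1).
by rewrite size_iota in h1; apply: leq_trans h1.
Qed.

Lemma euclid_p_gt1 : 1 < p.
Proof.
rewrite ltnNge; apply/negP => h; have := euclid_ap.
have : p = 0 \/ p = 1 by lia.
by case=> ->; rewrite ?euclid_a0 ?euclid_a1; lia.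
Qed.

Lemma euclid_div i : a i = quo i.+1 * a i.+1 + a i.+2.
Proof. by rewrite euclid_aSS /euclid_quo /= -divn_eq. Qed.

Lemma euclid_quo_gt0 i : i.+1 < p -> 0 < quo i.+1.
Proof.
move=> h; rewrite /euclid_quo /= divn_gt0; last exact: euclid_a_gt0.
case: i h => [|i] h; first by rewrite euclid_a0 euclid_a1; lia.
by apply: ltnW; apply: euclid_a_lt; apply: euclid_a_gt0; lia.
Qed.

Lemma euclid_gcd i : gcdn (a i) (a i.+1) = 1.
Proof.
elim: i => [|i IH].
  rewrite euclid_a0 euclid_a1; have := ud_coprime.
  have {1}-> : d = (d - u) + u by lia.
  by rewrite /coprime gcdnDr gcdnC => /eqP.
by rewrite euclid_aSS gcdn_modr gcdnC.
Qed.

Lemma euclid_ap1 : a p.-1 = 1.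
Proof.
have := euclid_gcd p.-1; rewrite prednK; last by have := euclid_p_gt1; lia.
by rewrite euclid_ap gcdn0.
Qed.

(** [mstep] without its exceptional value q + 2 at [p], so that the recursion [msumS] holds at all
    indices; the two agree below [p]. *)
Definition msum l := 1 + \sum_(1 <= j < l.+1) quo j.

Lemma msum0 : msum 0 = 1.
Proof. by rewrite /msum big_geq. Qed.

Lemma msumS l : msum l.+1 = msum l + quo l.+1.
Proof. by rewrite /msum big_nat_recr //= addnA. Qed.

Lemma msum_last : msum p.-1 = q.+1.
Proof.
by rewrite /msum prednK ?add1n //; have := euclid_p_gt1; lia.
Qed.

Lemma mstepE l : l < p -> mstep l = msum l.
Proof. by move=> h; rewrite /Defs.mstep ifF //; apply/eqP; lia. Qed.

Lemma mstep_last : mstep p = q.+2.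
Proof. by rewrite /Defs.mstep eqxx. Qed.

Lemma msum_lt l l' : l < l' -> l' < p -> msum l < msum l'.
Proof.
elim: l' => // l' IH; rewrite ltnS leq_eqVlt => /orP[/eqP <-|h] hp.
  by rewrite msumS; have := euclid_quo_gt0 hp; lia.
by rewrite msumS; have := IH h (ltnW hp); lia.
Qed.

Lemma mstep_lt l l' : l < l' -> l' <= p -> mstep l < mstep l'.
Proof.
move=> h hp; rewrite mstepE; last by lia.
case: (ltngtP l' p) hp h => // [h1 _ h|-> _ h]; first by rewrite mstepE // msum_lt.
rewrite mstep_last; case: (ltngtP l p.-1) => [h1|h1|->]; last by rewrite msum_last.
  by apply: (leq_trans (msum_lt h1 _)); rewrite ?msum_last; have := euclid_p_gt1; lia.
by have := euclid_p_gt1; lia.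
Qed.

Lemma mstep_le l l' : l <= l' -> l' <= p -> mstep l <= mstep l'.
Proof.
rewrite leq_eqVlt => /orP[/eqP-> //|h hp]; apply: ltnW; exact: mstep_lt.
Qed.

Lemma ell_uniq n l : l < p -> mstep l <= n < mstep l.+1 -> ell n = l.+1.
Proof.
move=> hl hn; rewrite /Defs.ell; congr _.+1.
set P := (fun i => _); have hP : P l by [].
have hhas : has P (iota 0 p) by apply/hasP; exists l => //; rewrite mem_iota.
have h1 := nth_find 0 hhas; have h2 := hhas; rewrite has_find size_iota in h2.
rewrite nth_iota // add0n in h1.
case/andP: hn => hn1 hn2; case/andP: h1 => h3 h4.
case: (ltngtP (find P (iota 0 p)) l) => // h5.
- by have := leq_trans h4 (mstep_le h5 (ltnW hl)); rewrite ltnNge hn1.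
- by have := leq_trans hn2 (mstep_le h5 (ltnW h2)); rewrite ltnNge h3.
Qed.

(** Locates n inside the Euclidean algorithm: the n-th slow step is subtraction number k + 1 in the
    division of [a l] by [a l.+1]. Facts on [mell], [rho], b_n and c_n are read off from (l, k). *)
Lemma phase_exists n : 0 < n -> n <= q ->
  exists l k, [/\ l.+1 < p, k < quo l.+1 & n = msum l + k].
Proof.
move=> n0 nq.
have h1 : exists l, n < msum l by exists p.-1; rewrite msum_last.
case: (ex_minnP h1) => -[|l] hl hmin; first by move: hl; rewrite msum0; lia.
have hl1 : msum l <= n by rewrite leqNgt; apply/negP => /hmin; lia.
exists l, (n - msum l); split; rewrite ?subnKC //.
  have := hmin p.-1; rewrite msum_last => /(_ nq).
  by have := euclid_p_gt1; lia.
by move: hl; rewrite msumS; lia.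
Qed.

Lemma sersS n : 0 < n -> sers n.+1 = sers_step (sers n).
Proof. by case: n. Qed.

(** Each division is performed by repeated subtraction. The inner induction runs through one
    division; the outer one uses that the last subtraction leaves [a l.+2], which is below [a l.+1]
    and triggers the exchange. *)
Lemma sers_phase l k : l.+1 < p -> k < quo l.+1 ->
  st_b (sers (msum l + k)) = a l - k * a l.+1 /\
  st_c (sers (msum l + k)) = a l.+1.
Proof.
have step n b c : 0 < n -> st_b (sers n) = b -> st_c (sers n) = c ->
   if c <= b - c then st_b (sers n.+1) = b - c /\ st_c (sers n.+1) = c
   else st_b (sers n.+1) = c /\ st_c (sers n.+1) = b - c.
  move=> n0; rewrite sersS //; case: (sers n) => ? ? ? ? ? ? /= -> ->.
  by case: (c <= b - c).
have m0 l' : 0 < msum l' by [].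
have phase l' k' : l'.+1 < p -> st_b (sers (msum l')) = a l' -> st_c (sers (msum l')) = a l'.+1 ->
  k' < quo l'.+1 ->
  st_b (sers (msum l' + k')) = a l' - k' * a l'.+1 /\
  st_c (sers (msum l' + k')) = a l'.+1.
  move=> hp h1 h2; elim: k' => [|k' IH] hk; first by rewrite addn0 mul0n subn0.
  have [h3 h4] := IH (ltnW hk).
  have := step _ _ _ _ h3 h4; rewrite addn_gt0 m0 addnS => /(_ isT).
  (* At least two copies of [a l'.+1] are still to be subtracted, so b - c >= c and no exchange
     occurs. *)
  have := euclid_div l'; have := leq_mul2r (a l'.+1) k'.+2 (quo l'.+1).
  rewrite hk orbT => h5 h6; rewrite ifT; last by rewrite h6; lia.
  by case=> -> ->; split=> //; lia.
elim: l k => [|l IH] k hl hk.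
  by apply: phase => //; rewrite msum0.
have hl1 : l.+1 < p by lia.
have qk := euclid_quo_gt0 hl1.
have hk1 : (quo l.+1).-1 < quo l.+1 by rewrite prednK.
have [h1 h2] := IH (quo l.+1).-1 hl1 hk1.
have h3 : (msum l + (quo l.+1).-1).+1 = msum l.+1 by rewrite msumS -addnS prednK.
have := step _ _ _ _ h1 h2; rewrite addn_gt0 m0 h3 => /(_ isT).
have h4 := euclid_div l; have h5 := euclid_a_lt (euclid_a_gt0 hl1).
have h6 : a l - (quo l.+1).-1 * a l.+1 - a l.+1 = a l.+2.
  by rewrite h4; case: (quo l.+1) qk => // r _; rewrite mulSn; lia.
rewrite h6 ifF; last by lia.
by case=> h7 h8; apply: phase.
Qed.

Definition sers_swaps n := st_b (sers n) - st_c (sers n) < st_c (sers n).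

(** An exchange marks the last subtraction of a division, and [mstep] counts subtractions; so it
    happens exactly one step before m(n). *)
Lemma swap_mell n : 0 < n -> n <= q ->
  [/\ n < mell n, mell n <= q.+1, sers_swaps n = (n.+1 == mell n) &
   st_c (sers n) <= st_b (sers n)].
Proof.
move=> n0 nq; have [l [k [hl hk hn]]] := phase_exists n0 nq.
have e1 : ell n = l.+1.
  by apply: ell_uniq; first (by lia); rewrite !mstepE ?msumS; lia.
rewrite /Defs.mell e1 mstepE // /sers_swaps hn.
have [-> ->] := sers_phase hl hk; have := euclid_div l; have h6 := euclid_a_lt (euclid_a_gt0 hl).
have h7 : msum l.+1 <= q.+1.
  rewrite -msum_last; case: (ltngtP l.+1 p.-1) => [h|h|->//]; last by lia.
  by apply: ltnW; apply: msum_lt => //; lia.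
rewrite msumS in h7 *.
case: (ltngtP k.+1 (quo l.+1)) => [h1|h1|h1] h2; last first.
- by rewrite h2 -h1; split; try lia; apply/idP/eqP; lia.
- by lia.
have := leq_mul2r (a l.+1) k.+2 (quo l.+1); rewrite h1 orbT => h3.
split; try lia; apply/idP/eqP; lia.
Qed.

Lemma mellSN n : 0 < n -> n <= q -> ~~ sers_swaps n -> mell n.+1 = mell n.
Proof.
move=> n0 nq; have [h1 h2 -> _] := swap_mell n0 nq; rewrite neq_ltn.
have [l [k [hl hk hn]]] := phase_exists n0 nq.
have e1 : ell n = l.+1.
  by apply: ell_uniq; first (by lia); rewrite !mstepE ?msumS; lia.
move: h1 h2; rewrite /Defs.mell e1 => h1 h2 /orP[] h3; last by lia.
congr mstep; apply: ell_uniq; first by lia.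
by rewrite h3 andbT mstepE ?hn; lia.
Qed.

(** If n ends a division, rho(n) is the end of the next one, and n + 1 lies in that next division.
    For n = q there is no next one, and [rho] takes the conventional value q + 2. *)
Lemma rhoE n : 0 < n -> n < q -> rho n = if sers_swaps n then mell n.+1 else n.+1.
Proof.
move=> n0 nq; have [h1 h2 -> _] := swap_mell n0 (ltnW nq).
rewrite /Defs.rho; have [l [k [hl hk hn]]] := phase_exists n0 (ltnW nq).
have e1 : ell n = l.+1.
  by apply: ell_uniq; first (by lia); rewrite !mstepE ?msumS; lia.
case: eqP => h3; last by rewrite ifT //; lia.
rewrite ifF; last by lia.
rewrite /Defs.mell e1 in h3 *; congr mstep; apply/esym/ell_uniq => //.
by rewrite h3 leqnn mstep_lt.
Qed.

Lemma sers_c_gt0 n : 0 < n -> n <= q -> 0 < st_c (sers n).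
Proof.
move=> n0 nq; have [l [k [hl hk ->]]] := phase_exists n0 nq.
by have [_ ->] := sers_phase hl hk; apply: euclid_a_gt0.
Qed.

(** Equality would make the last subtraction of a division leave zero; that division would be the
    final one and n = q. *)
Lemma sers_b_gt_c n : 0 < n -> n < q -> st_c (sers n) < st_b (sers n).
Proof.
move=> n0 nq; have [l [k [hl hk hn]]] := phase_exists n0 (ltnW nq).
rewrite {1 2}hn; have [-> ->] := sers_phase hl hk.
have h1 := euclid_div l; have h2 := euclid_a_gt0 hl.
case: (ltngtP k.+1 (quo l.+1)) => h3; last 1 first.
- have : 0 < a l.+2.
    apply: euclid_a_gt0; move: hl; rewrite leq_eqVlt => /orP[/eqP h4|//].
    by have := msum_last; rewrite -h4 /= msumS -h3; lia.
  by rewrite h1 -h3; lia.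
- have := leq_mul2r (a l.+1) k.+2 (quo l.+1); rewrite h3 orbT; lia.
- by lia.
Qed.

(** The last divisor is the gcd, 1, and divides exactly, so the last quotient is a_{p-2} > a_{p-1} =
    1. *)
Lemma qsum_gt1 : 1 < q.
Proof.
have hp := euclid_p_gt1; have := msum_last.
have -> : p.-1 = p.-2.+1 by lia.
have h0 : 1 < quo p.-2.+1.
  rewrite ltnNge; apply/negP => h2.
  have h1 := euclid_div p.-2.
  have h3 : a p.-2.+1 = 1 by rewrite -[RHS]euclid_ap1; congr a; lia.
  have h4 : a p.-2.+2 = 0 by rewrite -[RHS]euclid_ap; congr a; lia.
  rewrite h3 h4 in h1.
  have : a p.-2 <= 1 by lia.
  case e3: p.-2 h3 => [|k] h3; first by rewrite euclid_a0; lia.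
  by have := @euclid_a_lt k; rewrite h3 -e3; have := @euclid_a_gt0 p.-2; lia.
by rewrite msumS /msum; lia.
Qed.

Lemma rho_q : rho q = q.+2.
Proof.
have hq := qsum_gt1; have hp := euclid_p_gt1.
have e1 : ell q = p.-1.
  have -> : p.-1 = p.-2.+1 by lia.
  apply: ell_uniq; first by lia.
  rewrite !mstepE; try lia.
  have -> : p.-2.+1 = p.-1 by lia.
  have h1 : msum p.-2 < msum p.-1 by apply: msum_lt; lia.
  by rewrite msum_last in h1 *; rewrite ltnS leqnn andbT; lia.
rewrite /Defs.rho /Defs.mell e1 mstepE; last by lia.
rewrite msum_last ltnn; have -> : p.-1.+1 = p by lia.
exact: mstep_last.
Qed.

Lemma sers_q : [/\ mell q = q.+1, st_b (sers q) = 1 & st_c (sers q) = 1].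
Proof.
have hq := qsum_gt1; have hq0 : 0 < q by lia.
have hm : mell q = q.+1 by have [] := swap_mell hq0 (leqnn _); lia.
have [l [k [hl hk hn]]] := phase_exists hq0 (leqnn _).
have e1 : ell q = l.+1.
  by apply: ell_uniq; first (by lia); rewrite !mstepE ?msumS; lia.
move: hm; rewrite /Defs.mell e1 mstepE // -msum_last => hm.
have hp : l.+1 = p.-1.
  case: (ltngtP l.+1 p.-1) => // h; last by lia.
  by have := msum_lt h; rewrite hm; have := euclid_p_gt1; lia.
have [hb hc] := sers_phase hl hk.
have ec : a l.+1 = 1 by rewrite hp euclid_ap1.
have e2 : a l.+2 = 0 by rewrite -[RHS]euclid_ap; congr a; lia.
have h1 := euclid_div l; rewrite ec e2 in h1.
have hk1 : k.+1 = quo l.+1.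
  by have := msumS l; rewrite hm msum_last; lia.
split=> //.
  by rewrite hn hb ec h1 -hk1; lia.
by rewrite hn hc.
Qed.

End EuclideanCombinatorics.

(** * Signs, cofactors and determinants of the slow sequence *)

Section SlowRemainders.

Variables d u : nat.
Hypotheses (u_gt0 : (0 < u)%N) (u_lt : (2 * u < d)%N) (ud_coprime : coprime u d).

Local Notation q := (qsum d u).
Local Notation mell := (mell d u).
Local Notation rho := (rho d u).
Local Notation swap := (sers_swaps d u).
Local Notation b n := (st_b (sers d u n)).
Local Notation c n := (st_c (sers d u n)).
Local Notation sg n := (st_sigma (sers d u n)).
Local Notation ta n := (st_tau (sers d u n)).
Local Notation al n := (st_alpha (sers d u n)).
Local Notation be n := (st_beta (sers d u n)).

Lemma sers1 : sers d u 1 = SersState (d - u) u 0 1 1 0.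
Proof. by []. Qed.

Lemma sers_swap n : (0 < n)%N -> swap n ->
  [/\ (b n.+1 = c n)%N, (c n.+1 = b n - c n)%N, sg n.+1 = al n /\ ta n.+1 = be n,
   al n.+1 = sg n - al n & be n.+1 = ta n - be n].
Proof.
move=> n0; rewrite /sers_swaps sersS // ltnNge; case: (sers d u n) => b c s t x y /=.
by case: (c <= b - c)%N.
Qed.

Lemma sers_noswap n : (0 < n)%N -> ~~ swap n ->
  [/\ (b n.+1 = b n - c n)%N, (c n.+1 = c n)%N,
   sg n.+1 = sg n - al n /\ ta n.+1 = ta n - be n, al n.+1 = al n & be n.+1 = be n].
Proof.
move=> n0; rewrite /sers_swaps sersS // -leqNgt; case: (sers d u n) => b c s t x y /=.
by case: (c <= b - c)%N.
Qed.

(** Subtracting a vector of the opposite quadrant does not leave one's own, and an exchange swaps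
    the two quadrants. The case n = 1 is singled out because sigma_1 = 0. *)
Lemma sers_sign n : (0 < n)%N ->
  (sg n <= 0 /\ 0 < ta n /\ 0 < al n /\ be n <= 0 /\ (n = 1%N \/ sg n < 0)) \/
  (0 < sg n /\ ta n <= 0 /\ al n < 0 /\ 0 < be n).
Proof.
elim: n => // -[_ _|n IH _]; first by left; do !split=> //; left.
have [hs|hs] := boolP (swap n.+1).
  by have [_ _ [-> ->] -> ->] := @sers_swap n.+1 isT hs; have := IH isT; lia.
by have [_ _ [-> ->] -> ->] := @sers_noswap n.+1 isT hs; have := IH isT; lia.
Qed.

(** The vectors are the cofactors of the extended Euclidean algorithm for u and d - u. The form u s
    + (d - u) t is the exponent of T_0 in the toric binomial attached to (s, t). *)
Lemma sers_lin n : (0 < n)%N -> (n <= q.+1)%N ->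
  (b n)%:Z = u%:Z * sg n + (d%:Z - u%:Z) * ta n /\
  (c n)%:Z = u%:Z * al n + (d%:Z - u%:Z) * be n.
Proof.
elim: n => // -[_ _ _|n IH _ nq].
  by rewrite /sers /=; split; lia.
have [h1 h2] := IH isT (ltnW nq).
have [_ _ _ h3] := @swap_mell d u u_gt0 u_lt ud_coprime n.+1 isT nq.
have [hs|hs] := boolP (swap n.+1).
  have [-> -> [-> ->] -> ->] := @sers_swap n.+1 isT hs.
  by rewrite -subzn // h1 h2; split; ring.
have [-> -> [-> ->] -> ->] := @sers_noswap n.+1 isT hs.
by rewrite -subzn // h1 h2; split; ring.
Qed.

(** A subtraction keeps the determinant and an exchange negates it, in step with the change of side
    of sigma_n. *)
Lemma sers_det n : (0 < n)%N ->
  sg n * be n - ta n * al n = if sg n <= 0 then -1 else 1.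
Proof.
elim: n => // -[_ _|n IH _]; first by [].
have := IH isT; have := @sers_sign n.+1 isT; have := @sers_sign n.+2 isT.
have [hs|hs] := boolP (swap n.+1).
  have [_ _ [-> ->] -> ->] := @sers_swap n.+1 isT hs.
  move=> h1 h2 h4.
  have -> : al n.+1 * (ta n.+1 - be n.+1) - be n.+1 * (sg n.+1 - al n.+1) =
     - (sg n.+1 * be n.+1 - ta n.+1 * al n.+1) by ring.
  by rewrite h4; case: (leP (sg n.+1) 0) => h3; case: ifP; lia.
have [_ _ [-> ->] -> ->] := @sers_noswap n.+1 isT hs; move=> h1 h2 h4.
have -> : (sg n.+1 - al n.+1) * be n.+1 - (ta n.+1 - be n.+1) * al n.+1 =
     sg n.+1 * be n.+1 - ta n.+1 * al n.+1 by ring.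
by rewrite h4; case: (leP (sg n.+1) 0) => h3; case: ifP; lia.
Qed.

(** (c, alpha, beta) stays fixed through a division and becomes (b, sigma, tau) at the exchange that
    ends it. *)
Lemma sers_mell n : (0 < n)%N -> (n <= q)%N ->
  [/\ (b (mell n) = c n)%N, sg (mell n) = al n & ta (mell n) = be n].
Proof.
move: {2}(mell n - n)%N (leqnn (mell n - n)) => k.
elim: k n => [|k IH] n h n0 nq; have [h1 h2 h3 _] := swap_mell u_gt0 u_lt ud_coprime n0 nq.
  by lia.
have [hs|hs] := boolP (swap n).
  have [e1 _ [e2 e3] _ _] := sers_swap n0 hs.
  by move: hs; rewrite h3 => /eqP <-.
have [_ e1 _ e2 e3] := sers_noswap n0 hs; rewrite -e1 -e2 -e3.
have e4 := mellSN u_gt0 u_lt ud_coprime n0 nq hs.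
rewrite h3 in hs; rewrite -e4; apply: IH; rewrite ?e4; lia.
Qed.

(** The difference of the two vectors either is the next vector, or is stored by an exchange in
    (alpha, beta), from where [sers_mell] at n + 1 brings it to index m(n + 1). *)
Lemma sers_rho n : (0 < n)%N -> (n < q)%N ->
  [/\ (b (rho n) = b n - c n)%N, sg (rho n) = sg n - al n &
     ta (rho n) = ta n - be n].
Proof.
move=> n0 nq; rewrite rhoE //; case: ifPn => hs.
  have [_ e1 _ e2 e3] := sers_swap n0 hs; rewrite -e1 -e2 -e3.
  by apply: sers_mell.
by have [-> _ [-> ->]] := sers_noswap n0 hs.
Qed.

Lemma sers_q1 : b q.+1 = 1%N /\ c q.+1 = 0%N.
Proof.
have [hm hb hc] := sers_q u_gt0 u_lt ud_coprime.
have q0 : (0 < q)%N by have := qsum_gt1 u_gt0 u_lt ud_coprime; lia.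
have hs : swap q by rewrite /sers_swaps hb hc.
by have [-> -> _ _ _] := sers_swap q0 hs; rewrite hb hc.
Qed.

Lemma sers_last : sg q.+1 = al q /\ ta q.+1 = be q.
Proof.
have [hm hb hc] := sers_q u_gt0 u_lt ud_coprime.
have q0 : (0 < q)%N by have := qsum_gt1 u_gt0 u_lt ud_coprime; lia.
have hs : swap q by rewrite /sers_swaps hb hc.
by have [_ _ [-> ->]] := sers_swap q0 hs.
Qed.

(** At n = q both values of u s + (d - u) t are 1, so this form kills the difference of the vectors;
    Cramer's rule with determinant 1 or -1 identifies the difference. *)
Lemma sers_end :
  (sg q <= 0 /\ sg q - al q = - (d%:Z - u%:Z) /\ ta q - be q = u%:Z) \/
  (0 < sg q /\ sg q - al q = d%:Z - u%:Z /\ ta q - be q = - u%:Z).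
Proof.
have [hm hb hc] := sers_q u_gt0 u_lt ud_coprime.
have q0 : (0 < q)%N by have := qsum_gt1 u_gt0 u_lt ud_coprime; lia.
have [h1 h2] := sers_lin q0 (leqnSn q); rewrite hb in h1; rewrite hc in h2.
have h3 := sers_det q0.
have e1 : sg q - al q = (d%:Z - u%:Z) * (sg q * be q - ta q * al q).
  transitivity (sg q * (u%:Z * al q + (d%:Z - u%:Z) * be q)
    - (u%:Z * sg q + (d%:Z - u%:Z) * ta q) * al q); last by ring.
  by rewrite -h1 -h2; ring.
have e2 : ta q - be q = - u%:Z * (sg q * be q - ta q * al q).
  transitivity (ta q * (u%:Z * al q + (d%:Z - u%:Z) * be q)
    - (u%:Z * sg q + (d%:Z - u%:Z) * ta q) * be q); last by ring.
  by rewrite -h1 -h2; ring.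
by rewrite e1 e2 h3; case: (leP (sg q) 0) => h; [left|right]; rewrite ?mulr1 ?mulrN1 ?opprK.
Qed.

Lemma sers_q_sign : sg q != 0.
Proof.
have hq := qsum_gt1 u_gt0 u_lt ud_coprime.
have q0 : (0 < q)%N by lia.
by have := sers_sign q0; lia.
Qed.

(** Subtracting a vector of the opposite quadrant enlarges absolute values. So on each side the
    coordinates grow from the first vector met after n: the difference on the side of n, (alpha_n,
    beta_n) on the other. *)
Lemma sers_chain n j : (0 < n)%N -> (n < j)%N ->
  (sg n <= 0 -> sg j <= 0 -> sg j <= sg n - al n /\ ta n - be n <= ta j) /\
  (0 < sg n -> 0 < sg j -> sg n - al n <= sg j /\ ta j <= ta n - be n) /\
  (sg n <= 0 -> 0 < sg j -> al n <= sg j /\ ta j <= be n) /\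
  (0 < sg n -> sg j <= 0 -> sg j <= al n /\ be n <= ta j).
Proof.
move=> n0 h; have -> : j = (n + (j - n.+1).+1)%N by lia.
move: (j - n.+1)%N => k {h}; elim: k n n0 => [|k IH] n n0.
  rewrite addn1; have := sers_sign n0.
  have [hs|hs] := boolP (swap n).
    by have [_ _ [-> ->] _ _] := sers_swap n0 hs; lia.
  by have [_ _ [-> ->] _ _] := sers_noswap n0 hs; lia.
have := IH n.+1 isT; rewrite addSnnS; set m := (n + k.+2)%N.
have := sers_sign n0; have := @sers_sign m; rewrite {1}/m addnS => /(_ isT).
have [hs|hs] := boolP (swap n).
  by have [_ _ [-> ->] -> ->] := sers_swap n0 hs; lia.
by have [_ _ [-> ->] -> ->] := sers_noswap n0 hs; lia.
Qed.

(** The end of the descent: x >= 1 copies of v, minus copies of a vector of the opposite quadrant,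
    lie beyond v in the quadrant of v. *)
Lemma sers_cone x y n : (0 < n)%N -> 0 < x -> y <= 0 ->
  (sg n <= 0 /\ x * sg n + y * al n <= sg n /\ ta n <= x * ta n + y * be n) \/
  (0 < sg n /\ sg n <= x * sg n + y * al n /\ x * ta n + y * be n <= ta n).
Proof.
by move=> n0 x0 y0; have [[? [? [? [? _]]]]|[? [? [? ?]]]] := sers_sign n0; [left|right];
  do !split=> //; nia.
Qed.

(* The descent replaces x v + y w, where v and w are the vectors of the n-th
   step, by x (v - w) + (x + y) w. *)
Lemma sers_approx (x y : int) n : (0 < n)%N -> (n <= q.+1)%N ->
  0 < x * (b n)%:Z + y * (c n)%:Z ->
  (0 < x /\ y <= 0) \/ (x <= 0 /\ 0 < y) ->
  exists j, [/\ (0 < j)%N, (j <= q.+1)%N,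
    (b j)%:Z <= x * (b n)%:Z + y * (c n)%:Z &
    (sg j <= 0 /\ x * sg n + y * al n <= sg j /\ ta j <= x * ta n + y * be n) \/
    (0 < sg j /\ sg j <= x * sg n + y * al n /\ x * ta n + y * be n <= ta j)].
Proof.
move: {2}(q.+1 - n)%N (leqnn (q.+1 - n)%N) => k.
elim: k x y n => [|k IH] x y n hk n0 nq hpos hxy.
  have en : n = q.+1 by lia.
  subst n => {hk}.
  have [e1 e2] := sers_q1.
  have e3 : x * (b q.+1)%:Z + y * (c q.+1)%:Z = x by rewrite e1 e2; lia.
  rewrite e3 in hpos *; case: hxy => [[x0 y0]|[x0 y0]]; last by lia.
  by exists q.+1; rewrite e1; split=> //; exact: sers_cone.
have nq1 : n = q.+1 \/ (n <= q)%N by lia.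
case: nq1 => [e|nq1]; first by apply: IH => //; lia.
have [_ _ _ hcb] := swap_mell u_gt0 u_lt ud_coprime n0 nq1.
have hc := sers_c_gt0 u_gt0 u_lt ud_coprime n0 nq1.
(* The descent stops when x > 0 and the value reaches b_n. Otherwise (x, x + y) again has opposite
   signs: for x > 0 a value below b_n forces x + y <= 0, and for x <= 0 positivity of the value
   forces x + y > 0. *)
have [[x0 [y0 hb]]|hxy1] : (0 < x /\ y <= 0 /\ (b n)%:Z <= x * (b n)%:Z + y * (c n)%:Z) \/
    ((0 < x /\ x + y <= 0) \/ (x <= 0 /\ 0 < x + y)).
- have [hb|hb] := leP (b n)%:Z (x * (b n)%:Z + y * (c n)%:Z).
    by case: hxy => [[x0 y0]|[x0 y0]]; [left|right; right]; split=> //; nia.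
  by case: hxy => [[x0 y0]|[x0 y0]]; right; [left|right]; split=> //; nia.
- by exists n; split=> //; exact: sers_cone.
have e1 : x * (b n)%:Z + y * (c n)%:Z = x * (b n - c n)%:Z + (x + y) * (c n)%:Z.
  by rewrite -subzn //; ring.
have e2 (v w : int) : x * v + y * w = x * (v - w) + (x + y) * w by ring.
have [hs|hs] := boolP (swap n); rewrite e1 (e2 (sg n)) (e2 (ta n)); rewrite e1 in hpos.
  have [<- <- [<- <-] <- <-] := sers_swap n0 hs.
  have e3 (v w : int) : x * v + (x + y) * w = (x + y) * w + x * v by ring.
  rewrite !e3; apply: IH => //; [lia| |lia].
  by have [-> -> _ _ _] := sers_swap n0 hs; rewrite -e3.
have [h1 h2 [h3 h4] h5 h6] := sers_noswap n0 hs.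
rewrite -h1 -h2 -h3 -h4 -h5 -h6; apply: IH => //; [lia|].
by rewrite h1 h2.
Qed.

End SlowRemainders.

(** * Monomials, lexicographic order and division in free modules *)

Section Monomials.

Lemma forall_ord5 (P : 'I_5 -> Prop) :
  P iT0 -> P iT1 -> P iX0 -> P iX1 -> P iX2 -> forall i, P i.
Proof.
move=> h0 h1 h2 h3 h4 [[|[|[|[|[|i]]]]] hi] //.
- by rewrite (_ : Ordinal hi = iT0) //; apply/val_inj.
- by rewrite (_ : Ordinal hi = iT1) //; apply/val_inj.
- by rewrite (_ : Ordinal hi = iX0) //; apply/val_inj.
- by rewrite (_ : Ordinal hi = iX1) //; apply/val_inj.
- by rewrite (_ : Ordinal hi = iX2) //; apply/val_inj.
Qed.

Definition mon5 (a b x y z : nat) : 'X_{1..5} :=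
  [multinom tnth [tuple a; b; x; y; z] i | i < 5].

Lemma mon5E a b x y z : [/\ mon5 a b x y z iT0 = a, mon5 a b x y z iT1 = b,
  mon5 a b x y z iX0 = x, mon5 a b x y z iX1 = y & mon5 a b x y z iX2 = z].
Proof. by split; rewrite mnmE (tnth_nth 0%N). Qed.

Lemma mon5_eq (m m' : 'X_{1..5}) : m iT0 = m' iT0 -> m iT1 = m' iT1 ->
  m iX0 = m' iX0 -> m iX1 = m' iX1 -> m iX2 = m' iX2 -> m = m'.
Proof. by move=> *; apply/mnmP; apply: forall_ord5. Qed.

Lemma mon5D a b x y z a' b' x' y' z' :
  (mon5 a b x y z + mon5 a' b' x' y' z')%MM
  = mon5 (a + a') (b + b') (x + x') (y + y') (z + z').
Proof. by apply: mon5_eq; rewrite !mnmE !(tnth_nth 0%N). Qed.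

Lemma mon5_le (m m' : 'X_{1..5}) :
  (m <= m')%MM = [&& m iT0 <= m' iT0, m iT1 <= m' iT1, m iX0 <= m' iX0,
                  m iX1 <= m' iX1 & m iX2 <= m' iX2]%N.
Proof.
apply/idP/idP => [/mnm_lepP h|/and5P[? ? ? ? ?]]; first by rewrite !h.
by apply/mnm_lepP; apply: forall_ord5.
Qed.

Lemma mpolyX_mon5 (K : fieldType) a b x y z :
  'X_[mon5 a b x y z] = 'X_iT0 ^+ a * 'X_iT1 ^+ b * 'X_iX0 ^+ x * 'X_iX1 ^+ y
    * 'X_iX2 ^+ z :> {mpoly K[5]}.
Proof.
rewrite mpolyXE_id !big_ord_recl big_ord0 mulr1 !mulrA.
have [h0 h1 h2 h3 h4] := mon5E a b x y z.
have e0 : ord0 = iT0 by apply/val_inj.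
have e1 : lift ord0 ord0 = iT1 by apply/val_inj.
have e2 : lift ord0 (lift ord0 ord0) = iX0 by apply/val_inj.
have e3 : lift ord0 (lift ord0 (lift ord0 ord0)) = iX1 by apply/val_inj.
have e4 : lift ord0 (lift ord0 (lift ord0 (lift ord0 ord0))) = iX2 by apply/val_inj.
rewrite e4 e3 e2 e1 e0.
rewrite h0 h1 h2 h3 h4.
by [].
Qed.

End Monomials.

Section LexOrder.

Variables d u : nat.
Local Notation prec := (prec_l d u).

Definition lexlt (x y : seq nat) : bool := ((x : seqlexi nat) < y)%O.

Lemma lexlt_cons x y s t :
  lexlt (x :: s) (y :: t) = (x < y)%N || (x == y) && lexlt s t.
Proof.
by rewrite /lexlt ltxi_cons !leEnat; case: ltngtP => //=; rewrite ?andbT ?andbF.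
Qed.

Lemma prec_lE m m' : prec m m' =
  let p := (0 < sigma d u (qsum d u)) in
  let i := if p then iX0 else iX1 in let j := if p then iX1 else iX0 in
  (m iT0 < m' iT0)%N || (m iT0 == m' iT0) &&
  ((m iT1 < m' iT1)%N || (m iT1 == m' iT1) &&
   ((m i < m' i)%N || (m i == m' i) &&
    ((m j < m' j)%N || (m j == m' j) && (m iX2 < m' iX2)%N))).
Proof.
rewrite /prec_l -/(lexlt _ _) /lex_exponents; case: ifP => _ /=;
  by rewrite !lexlt_cons /lexlt ltxx andbF orbF.
Qed.

Lemma prec_irr m : prec m m = false.
Proof. by rewrite /prec_l ltxx. Qed.

Lemma prec_trans m2 m1 m3 : prec m1 m2 -> prec m2 m3 -> prec m1 m3.
Proof. exact: lt_trans. Qed.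

Lemma prec_total m m' : m != m' -> prec m m' || prec m' m.
Proof.
move=> h; rewrite /prec_l -neq_lt; apply: contra h => /eqP.
rewrite /lex_exponents; case: ifP => _ [h0 h1 h2 h3 h4]; apply/eqP;
  exact: mon5_eq.
Qed.

Lemma prec_add p m m' : prec (p + m)%MM (p + m')%MM = prec m m'.
Proof. by rewrite !prec_lE /= !mnmDE !ltn_add2l !eqn_add2l. Qed.

(** The length is fixed because the lexicographic order on all lists is not well-founded. Induction
    on the length, then on the head, then on accessibility of the tail. *)
Lemma lexlt_Acc n (s : seq nat) : size s = n ->
  Acc (fun x y => size x = size y /\ lexlt x y) s.
Proof.
elim: n s => [|n IH] s.
  by move/size0nil => ->; constructor=> t [/size0nil -> ]; rewrite /lexlt ltxx.
case: s => [|x s]; first by [].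
move=> hs0; have hs : size s = n by case: hs0.
elim/ltn_ind: x s hs {hs0} => x IHx s hs.
have acc := IH s hs; elim: acc hs => {}s _ IHs ht.
constructor=> -[|y t]; first by case.
case=> hty; rewrite lexlt_cons.
have {}hty : size t = size s by case: hty.
case/orP=> [h|/andP[/eqP-> h]]; last by apply: IHs => //; rewrite hty.
by apply: IHx => //; rewrite hty.
Qed.

Lemma prec_wf : well_founded (fun m m' => prec m m').
Proof.
have hs m : size (lex_exponents d u m) = 5 by rewrite /lex_exponents; case: ifP.
move=> m; move: {-1}(lex_exponents d u m) (erefl (lex_exponents d u m)) => s e.
have := lexlt_Acc (hs m); rewrite e => h; elim: h m e => {}s _ IH m e.
constructor=> m' h; apply: (IH _ _ m' erefl); split; first by rewrite -e !hs.
by rewrite -e.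
Qed.

End LexOrder.

Section Modules.

Variables (R : comNzRingType) (V : lmodType R).
Implicit Types (A B : V -> Prop).

Lemma submod_gen0 A : submod_gen A 0.
Proof.
by exists 0%N, (fun=> 0), (fun=> 0); split; [case|rewrite big_ord0].
Qed.

Lemma submod_genZ A r v : submod_gen A v -> submod_gen A (r *: v).
Proof.
case=> k [c [a [h ->]]]; exists k, (fun i => r * c i), a; split=> //.
by rewrite scaler_sumr; apply: eq_bigr => i _; rewrite scalerA.
Qed.

Lemma submod_genD A v w : submod_gen A v -> submod_gen A w ->
  submod_gen A (v + w).
Proof.
case=> k [c [a [h ->]]] [k' [c' [a' [h' ->]]]].
exists (k + k')%N,
  (fun i => match split i with inl j => c j | inr j => c' j end),
  (fun i => match split i with inl j => a j | inr j => a' j end).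
split; first by move=> i; case: split.
rewrite big_split_ord; congr (_ + _); apply: eq_bigr => i _.
  by rewrite (unsplitK (inl i)).
by rewrite (unsplitK (inr i)).
Qed.

Lemma submod_gen_id A v : A v -> submod_gen A v.
Proof.
move=> h; exists 1%N, (fun=> 1), (fun=> v).
by rewrite big_ord1 scale1r.
Qed.

Lemma submod_gen_min A (N : V -> Prop) : N 0 ->
  (forall v w, N v -> N w -> N (v + w)) -> (forall r v, N v -> N (r *: v)) ->
  (forall v, A v -> N v) -> forall v, submod_gen A v -> N v.
Proof.
move=> N0 ND NZ hA v [k [c [a [h ->]]]].
by apply: (big_ind N) => // i _; apply/NZ/hA.
Qed.

Lemma submod_gen_trans A B v : (forall v, A v -> submod_gen B v) ->
  submod_gen A v -> submod_gen B v.
Proof.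
move=> h; apply: submod_gen_min => //; first exact: submod_gen0.
  exact: submod_genD.
exact: submod_genZ.
Qed.

End Modules.

Lemma mcoeffMX_le (n : nat) (R : nzRingType) (p : {mpoly R[n]}) (m k : 'X_{1..n}) :
  (p * 'X_[m])@_k = if (m <= k)%MM then p@_(k - m) else 0.
Proof.
case: ifPn => h; first by rewrite -{1}(submK h) addmC mcoeffMX.
apply/eqP; rewrite mcoeff_eq0; apply: contra h.
rewrite (perm_mem (msuppMX p m)) => /mapP[k' _ ->]; exact: lem_addr.
Qed.

(** * Division by leading monomials *)

Section Division.

Variables (K : fieldType) (r : nat).
Local Notation S := {mpoly K[5]}.
Local Notation T := ('X_{1..5} * 'I_r)%type.
Implicit Types (v w : 'rV[S]_r) (t : T).

Variable lt : T -> T -> Prop.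
Hypothesis lt_irr : forall t, ~ lt t t.
Hypothesis lt_trans : forall t1 t2 t3, lt t1 t2 -> lt t2 t3 -> lt t1 t3.
Hypothesis lt_total : forall t t', t != t' -> lt t t' \/ lt t' t.
Hypothesis lt_mul : forall p t t', lt t t' ->
  lt ((p + t.1)%MM, t.2) ((p + t'.1)%MM, t'.2).
Hypothesis lt_wf : well_founded lt.

Lemma is_lm_vec_uniq v t t' : is_lm_vec lt v t -> is_lm_vec lt v t' -> t = t'.
Proof.
move=> [h1 h2] [h3 h4]; apply/eqP/negPn/negP => h.
have h5 := h4 _ h1 h; rewrite eq_sym in h.
exact: (@lt_irr t) (lt_trans h5 (h2 _ h3 h)).
Qed.

Lemma seq_max_exists (s : seq T) : s != [::] ->
  exists2 t, t \in s & forall t', t' \in s -> t' != t -> lt t' t.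
Proof.
elim: s => // t [|t0 s] IH _.
  by exists t; rewrite ?mem_head // => t'; rewrite inE => /eqP-> /eqP.
have [//|t1 h1 h2] := IH; case: (eqVneq t t1) => [e|ne].
  exists t; first by rewrite mem_head.
  move=> t'; rewrite inE => /orP[/eqP->|h]; first by rewrite eqxx.
  by rewrite e; apply: h2.
case: (lt_total ne) => hl.
  exists t1; first by rewrite inE h1 orbT.
  by move=> t'; rewrite inE => /orP[/eqP->//|h]; apply: h2.
exists t; first by rewrite mem_head.
move=> t'; rewrite inE => /orP[/eqP->|h]; first by rewrite eqxx.
move=> _; case: (eqVneq t' t1) => [->//|h3]; exact: lt_trans (h2 _ h h3) hl.
Qed.

Lemma lm_vec_exists v : v != 0 -> exists t, is_lm_vec lt v t.
Proof.
pose s := flatten [seq [seq (m, i) | m <- msupp (v 0 i)] | i <- enum 'I_r].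
have hs t : (t \in s) = (coef_vec v t != 0).
  apply/flatten_mapP/idP => [[i _ /mapP[m hm ->]]|].
    by rewrite /coef_vec /= -mcoeff_msupp.
  case: t => m i h; exists i; first by rewrite mem_enum.
  by apply/mapP; exists m; rewrite // mcoeff_msupp.
move=> v0; have : s != [::].
  apply: contra v0 => /eqP h; apply/eqP/rowP => i; rewrite mxE.
  apply/mpolyP => m; rewrite mcoeff0; apply/eqP/negPn.
  by have := hs (m, i); rewrite h in_nil /coef_vec /= => <-.
by move/seq_max_exists => [t]; rewrite hs => h1 h2; exists t; split=> // t'; rewrite -hs; apply: h2.
Qed.

Variables (N A : 'rV[S]_r -> Prop).
Hypothesis N_sub : forall v w, N v -> N w -> N (v - w).
Hypothesis N_scale : forall a v, N v -> N (a *: v).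
Hypothesis AN : forall v, A v -> N v.
Hypothesis lm_dvd : forall v t, N v -> is_lm_vec lt v t ->
  exists g t', [/\ A g, is_lm_vec lt g t' & mon_dvd t' t].

Lemma coef_vec_sub v w t : coef_vec (v - w) t = coef_vec v t - coef_vec w t.
Proof. by rewrite /coef_vec !mxE mcoeffB. Qed.

Lemma coef_vec_mul (a : K) (p : 'X_{1..5}) v t :
  coef_vec ((a *: 'X_[p]) *: v) t =
  if (p <= t.1)%MM then a * coef_vec v ((t.1 - p)%MM, t.2) else 0.
Proof.
rewrite /coef_vec mxE -scalerAl mcoeffZ mulrC -commr_mpolyX mcoeffMX_le /=.
by case: ifP; rewrite ?mul0r // mulrC.
Qed.

(** Well-founded induction on the leading monomial. It serves both ker Phi_1 and, in rank 1, ker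
    Phi_0. *)
Lemma division_generates v : N v -> submod_gen A v.
Proof.
have gen0 : submod_gen A 0 by exact: submod_gen0.
case: (eqVneq v 0) => [-> //|v0 Nv]; have [t ht] := lm_vec_exists v0.
elim: (lt_wf t) v Nv v0 ht => {}t _ IH v Nv v0 ht.
have [g [t' [Ag hg [e hd]]]] := lm_dvd Nv ht.
case: t t' e hd ht hg IH => [m i] [m' i'] /= e; rewrite {}e => hd ht hg IH.
pose a := coef_vec v (m, i) / coef_vec g (m', i).
pose w := (a *: 'X_[m - m']) *: g; have Nw : N w by apply/N_scale/AN.
have hw : submod_gen A w by apply/submod_genZ/submod_gen_id.
have -> : v = (v - w) + w by rewrite subrK.
apply: submod_genD => //; case: (eqVneq (v - w) 0) => [->//|vw0].
have [t1 ht1] := lm_vec_exists vw0; apply: (IH t1) => //; last exact: N_sub.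
have hmm : (m - (m - m') = m')%MM.
  apply/mnmP => j; rewrite !mnmBE; have := mnm_lepP hd j; lia.
have t1v : coef_vec (v - w) (m, i) = 0.
  rewrite coef_vec_sub coef_vec_mul /= lem_subr hmm /a divfK ?subrr //.
  by case: hg.
have t1ne : t1 != (m, i).
  by apply/eqP => e; case: ht1; rewrite e t1v eqxx.
case: (ht1); rewrite coef_vec_sub => h1 _.
(* A term of v - w absent from v comes from w, all of whose terms but the cancelled one are smaller;
   so the leading monomial drops. *)
have [h2|h2] := eqVneq (coef_vec v t1) 0; last by case: ht => _; apply.
move: h1; rewrite h2 sub0r oppr_eq0 coef_vec_mul.
case: ifP => [hle|]; last by rewrite eqxx.
rewrite mulf_eq0 => /norP[_ h3].
case: hg => _ /(_ _ h3) h4.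
have h5 : ((t1.1 - (m - m'))%MM, t1.2) != (m', i).
  apply: contra t1ne => /eqP[e1 e2]; apply/eqP.
  case: t1 {ht1 h2 h3 h4} hle e1 e2 => [n j] /= hle e1 ->; congr (_, _).
  by rewrite -(submK hle) e1 addmC submK.
have := lt_mul (m - m')%MM (h4 h5) => /=.
by rewrite submK // addmC submK //; case: (t1).
Qed.

End Division.

(** * The binomials and their syzygies *)

(* Otherwise unification unfolds these recursive functions. *)
Opaque mell rho sers qsum mpolyX.

Section Binomials.

Variables (d u : nat).

Local Notation q := (qsum d u).
Local Notation b n := (st_b (sers d u n)).
Local Notation sg n := (st_sigma (sers d u n)).
Local Notation ta n := (st_tau (sers d u n)).

Definition monoP n : 'X_{1..5} :=
  if sg n <= 0 then mon5 0 0 `|sg n| 0 `|ta n| else mon5 0 0 0 `|sg n - ta n| 0.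

Definition monoQ n : 'X_{1..5} :=
  if sg n <= 0 then mon5 0 0 0 `|sg n - ta n| 0 else mon5 0 0 `|sg n| 0 `|ta n|.

Definition T0m k := mon5 k 0 0 0 0.
Definition T1m k := mon5 0 k 0 0 0.

Definition leadF n := if n == q.+2 then (monoQ q + monoP q.+1)%MM else (T0m (b n) + monoP n)%MM.
Definition tailF n := if n == q.+2 then (monoP q + monoQ q.+1)%MM else (T1m (b n) + monoQ n)%MM.

Lemma sersE n : (n <= q.+1)%N ->
  [/\ b_ d u n = b n, sigma d u n = sg n & tau d u n = ta n].
Proof. by move=> h; rewrite /b_ /sigma /tau (_ : (n == q.+2) = false) //; apply/eqP; lia. Qed.

Hypotheses (u_gt0 : (0 < u)%N) (u_lt : (2 * u < d)%N) (ud_coprime : coprime u d).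

Lemma q_gt1 : (1 < q)%N. Proof. exact: qsum_gt1. Qed.

Lemma mell_bounds n : (0 < n)%N -> (n <= q)%N -> (n < mell d u n <= q.+1)%N.
Proof. by move=> h0 h1; have [-> -> _ _] := swap_mell u_gt0 u_lt ud_coprime h0 h1. Qed.

(* The two ways in which the triangles {n, m(n), rho(n)} and
   {n + 1, m(n + 1), rho(n + 1)} are glued. *)
Lemma mell_rho_next n : (0 < n)%N -> (n < q)%N ->
  (rho d u n = n.+1 /\ mell d u n.+1 = mell d u n /\ mell d u n <> n.+1) \/
  (mell d u n = n.+1 /\ mell d u n.+1 = rho d u n).
Proof.
move=> h0 h1; have [h2 h3 h4 _] := swap_mell u_gt0 u_lt ud_coprime h0 (ltnW h1).
rewrite rhoE //; case: ifPn => hs; first by right; move: hs; rewrite h4 => /eqP.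
left; split=> //; split; first exact: mellSN (ltnW h1) hs.
by move: hs; rewrite h4 => /eqP h; apply: nesym.
Qed.

Lemma rho_bounds n : (0 < n)%N -> (n < q)%N ->
  (n < rho d u n <= q.+1)%N /\ rho d u n <> mell d u n.
Proof.
move=> h0 h1; have := @mell_bounds n.+1 isT h1; have := mell_bounds h0 (ltnW h1).
by have := mell_rho_next h0 h1; lia.
Qed.

Lemma b_gt0 n : (0 < n)%N -> (n <= q.+1)%N -> (0 < b n)%N.
Proof.
move=> h0; rewrite leq_eqVlt => /orP[/eqP->|h1]; first by have [-> _] := sers_q1 u_gt0 u_lt ud_coprime.
have [_ _ _ h2] := swap_mell u_gt0 u_lt ud_coprime h0 h1.
by have := sers_c_gt0 u_gt0 u_lt ud_coprime h0 h1; lia.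
Qed.

Lemma b_rhombus n : (0 < n)%N -> (n < q)%N ->
  (b n = b (mell d u n) + b (rho d u n))%N.
Proof.
move=> h0 h1; have [-> _ _] := sers_rho u_gt0 u_lt ud_coprime h0 h1.
have [-> _ _] := sers_mell u_gt0 u_lt ud_coprime h0 (ltnW h1).
by have := sers_b_gt_c u_gt0 u_lt ud_coprime h0 h1; lia.
Qed.

(** m(n) lies on the side opposite to n, so Q_m has the variables of P_n and P_m those of Q_n; the
    subtraction in [sers_rho] then adds absolute values. *)
Lemma PQm_rhombus n : (0 < n)%N -> (n < q)%N ->
  monoP (rho d u n) = (monoP n + monoQ (mell d u n))%MM /\
  monoQ (rho d u n) = (monoQ n + monoP (mell d u n))%MM.
Proof.
move=> h0 h1; rewrite /monoP /monoQ.
have [_ -> ->] := sers_rho u_gt0 u_lt ud_coprime h0 h1.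
have [_ -> ->] := sers_mell u_gt0 u_lt ud_coprime h0 (ltnW h1).
have h := sers_sign u_gt0 u_lt ud_coprime h0.
case: (leP (sg n) 0) => h2; case: leP => h3; case: leP => h4; try lia;
  by rewrite !mon5D; split; congr mon5; lia.
Qed.

(** q and q + 1 lie on opposite sides, so the exponents of Q_q and P_{q+1} add up, with sums given
    by [sers_end]. The formula Q_q P_{q+1} - P_q Q_{q+1} thus absorbs the sign of sigma_q. *)
Lemma PQm_end : leadF q.+2 = (if 0 < sg q then mon5 0 0 (d - u) 0 u else mon5 0 0 0 d 0) /\
  tailF q.+2 = (if 0 < sg q then mon5 0 0 0 d 0 else mon5 0 0 (d - u) 0 u).
Proof.
have q0 : (0 < q)%N by have := q_gt1; lia.
have h5 := sers_end u_gt0 u_lt ud_coprime; have h6 := sers_sign u_gt0 u_lt ud_coprime q0.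
have h7 := @sers_sign d u u_gt0 u_lt ud_coprime q.+1 isT; have [h1 h2] := sers_last u_gt0 u_lt ud_coprime.
rewrite /leadF /tailF eqxx /monoP /monoQ h1 h2.
case: (leP (sg q) 0) => h3; case: leP => h4; try lia;
  by rewrite !mon5D; split; congr mon5; lia.
Qed.

End Binomials.

Section Syzygies.

Variables (K : fieldType) (d u : nat).

Local Notation q := (qsum d u).
Local Notation b n := (st_b (sers d u n)).
Local Notation sg n := (st_sigma (sers d u n)).
Local Notation ta n := (st_tau (sers d u n)).
Local Notation Pm := (monoP d u).
Local Notation Qm := (monoQ d u).
Local Notation e_ := (e_ K d u).
Local Notation mell := (mell d u).
Local Notation rho := (rho d u).

Hypotheses (u_gt0 : (0 < u)%N) (u_lt : (2 * u < d)%N) (ud_coprime : coprime u d).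

Lemma Fpol_binom n : (0 < n)%N -> (n <= q.+2)%N ->
  Fpol K d u n = 'X_[leadF d u n] - 'X_[tailF d u n].
Proof.
move=> n0 nq; rewrite /Fpol; case: eqP => [->|ne].
  have [-> ->] := PQm_end u_gt0 u_lt ud_coprime.
  have [_ -> _] := @sersE d u q (leqnSn q).
  by case: ifP => _; rewrite !mpolyX_mon5 !expr0 !(mulr1, mul1r).
have nq1 : (n <= q.+1)%N by lia.
have [-> -> ->] := sersE nq1; have h := sers_sign u_gt0 u_lt ud_coprime n0.
rewrite /leadF /tailF (_ : (n == q.+2) = false); last exact/eqP.
rewrite /monoP /monoQ.
case: leP => h1; rewrite !mon5D !mpolyX_mon5 !expr0 !(mulr1, mul1r) !(add0n, addn0);
  by rewrite ?mulrA ?abszN // distnC.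
Qed.

(** The sign of sigma_n also decides the side of m(n), so each case of [syz_rho] is one reading of
    Q_m and Q_n. *)
Lemma syz_rhoE n : (0 < n)%N -> (n < q)%N ->
  syz_rho K d u n = 'X_[Qm (mell n)] *: e_ n - 'X_[T0m (b (mell n))] *: e_ (rho n)
    - 'X_[T1m (b (rho n)) + Qm n] *: e_ (mell n).
Proof.
move=> n0 nq; rewrite /syz_rho.
have hm := mell_bounds u_gt0 u_lt ud_coprime n0 (ltnW nq).
have [hr _] := rho_bounds u_gt0 u_lt ud_coprime n0 nq.
have [-> -> ->] : [/\ b_ d u (mell n) = b (mell n), sigma d u (mell n) = sg (mell n)
  & tau d u (mell n) = ta (mell n)] by apply: sersE; lia.
have [-> _ _] : [/\ b_ d u (rho n) = b (rho n), sigma d u (rho n) = sg (rho n)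
  & tau d u (rho n) = ta (rho n)] by apply: sersE; lia.
have [_ -> ->] : [/\ b_ d u n = b n, sigma d u n = sg n & tau d u n = ta n]
  by apply: sersE; lia.
have [_ e1 e2] := sers_mell u_gt0 u_lt ud_coprime n0 (ltnW nq).
have := sers_sign u_gt0 u_lt ud_coprime n0; rewrite -e1 -e2 => h3; rewrite /monoP /monoQ /T0m /T1m.
case: (leP (sg n) 0) => h1; case: leP => h2; try lia;
  rewrite !mon5D !mpolyX_mon5 !expr0 !(mulr1, mul1r) !(add0n, addn0);
  rewrite ?mulrA ?abszN ?(distnC (ta n)) ?(distnC (ta (mell n))); exact: erefl.
Qed.

Lemma syz_mE n : (0 < n)%N -> (n < q)%N ->
  syz_m K d u n = 'X_[Pm (mell n)] *: e_ n - 'X_[T0m (b (rho n)) + Pm n] *: e_ (mell n)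
    - 'X_[T1m (b (mell n))] *: e_ (rho n).
Proof.
move=> n0 nq; rewrite /syz_m.
have hm := mell_bounds u_gt0 u_lt ud_coprime n0 (ltnW nq).
have [hr _] := rho_bounds u_gt0 u_lt ud_coprime n0 nq.
have [-> -> ->] : [/\ b_ d u (mell n) = b (mell n), sigma d u (mell n) = sg (mell n)
  & tau d u (mell n) = ta (mell n)] by apply: sersE; lia.
have [-> _ _] : [/\ b_ d u (rho n) = b (rho n), sigma d u (rho n) = sg (rho n)
  & tau d u (rho n) = ta (rho n)] by apply: sersE; lia.
have [_ -> ->] : [/\ b_ d u n = b n, sigma d u n = sg n & tau d u n = ta n]
  by apply: sersE; lia.
have [_ e1 e2] := sers_mell u_gt0 u_lt ud_coprime n0 (ltnW nq).
have := sers_sign u_gt0 u_lt ud_coprime n0; rewrite -e1 -e2 => h3; rewrite /monoP /monoQ /T0m /T1m.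
case: (leP (sg n) 0) => h1; case: leP => h2; try lia;
  rewrite !mon5D !mpolyX_mon5 !expr0 !(mulr1, mul1r) !(add0n, addn0);
  rewrite ?mulrA ?abszN ?(distnC (ta n)) ?(distnC (ta (mell n))); exact: erefl.
Qed.

Lemma syz_qE : syz_q K d u =
  'X_[Pm q.+1] *: e_ q - 'X_[Pm q] *: e_ q.+1 + 'X_[T1m 1] *: e_ q.+2.
Proof.
rewrite /syz_q; have q0 : (0 < q)%N by have := q_gt1 u_gt0 u_lt ud_coprime; lia.
have [_ -> ->] := @sersE d u q (leqnSn q).
have [_ -> ->] := @sersE d u q.+1 (leqnn _).
have h3 := sers_sign u_gt0 u_lt ud_coprime q0; have h8 := @sers_sign d u u_gt0 u_lt ud_coprime q.+1 isT; rewrite /monoP /T1m.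
have [h4 h5] := sers_last u_gt0 u_lt ud_coprime.
(* As sigma_q is not 0, the strict test in [syz_q] agrees with the weak one in [monoP]. *)
have h6 := sers_q_sign u_gt0 u_lt ud_coprime.
case: (ltP (sg q) 0) => h1; case: leP => h2; case: leP => h7; try lia;
  rewrite !mpolyX_mon5 !expr0 !(mulr1, mul1r) expr1;
  rewrite ?abszN; exact: erefl.
Qed.

Lemma syz_q1E : syz_q1 K d u =
  'X_[Qm q] *: e_ q.+1 - 'X_[T0m 1] *: e_ q.+2 - 'X_[Qm q.+1] *: e_ q.
Proof.
rewrite /syz_q1; have q0 : (0 < q)%N by have := q_gt1 u_gt0 u_lt ud_coprime; lia.
have [_ -> ->] := @sersE d u q (leqnSn q).
have [_ -> ->] := @sersE d u q.+1 (leqnn _).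
have h3 := sers_sign u_gt0 u_lt ud_coprime q0; have h8 := @sers_sign d u u_gt0 u_lt ud_coprime q.+1 isT; rewrite /monoQ /T0m.
have [h4 h5] := sers_last u_gt0 u_lt ud_coprime.
case: (leP (sg q.+1) 0) => h1; case: leP => h7; try lia;
  rewrite !mpolyX_mon5 !expr0 !(mulr1, mul1r) expr1;
  rewrite ?abszN ?(distnC (ta q)) ?(distnC (ta q.+1)); exact: erefl.
Qed.

End Syzygies.

Lemma mon5c a b x y z :
  (mon5 a b x y z iT0 = a) * (mon5 a b x y z iT1 = b) *
  (mon5 a b x y z iX0 = x) * (mon5 a b x y z iX1 = y) *
  (mon5 a b x y z iX2 = z).
Proof. by have [] := mon5E a b x y z. Qed.

(** * Leading monomials and the induced order *)

Section LeadingMonomials.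

Variables (d u : nat).

Local Notation q := (qsum d u).
Local Notation b n := (st_b (sers d u n)).
Local Notation sg n := (st_sigma (sers d u n)).
Local Notation ta n := (st_tau (sers d u n)).
Local Notation Pm := (monoP d u).
Local Notation Qm := (monoQ d u).
Local Notation Lm := (leadF d u).
Local Notation Um := (tailF d u).
Local Notation mell := (mell d u).
Local Notation rho := (rho d u).
Local Notation prec := (prec_l d u).

Lemma PQm_T n : [/\ Pm n iT0 = 0%N, Pm n iT1 = 0%N, Qm n iT0 = 0%N & Qm n iT1 = 0%N].
Proof. by rewrite /monoP /monoQ; case: ifP => _; rewrite !mon5c. Qed.

Lemma Lm_lt n : (n < q.+2)%N -> Lm n = (T0m (b n) + Pm n)%MM.
Proof. by rewrite /leadF; case: eqP => // ->; rewrite ltnn. Qed.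

Lemma Um_lt n : (n < q.+2)%N -> Um n = (T1m (b n) + Qm n)%MM.
Proof. by rewrite /tailF; case: eqP => // ->; rewrite ltnn. Qed.

Lemma Lm_last : Lm q.+2 = (Qm q + Pm q.+1)%MM.
Proof. by rewrite /leadF eqxx. Qed.

Lemma Um_last : Um q.+2 = (Pm q + Qm q.+1)%MM.
Proof. by rewrite /tailF eqxx. Qed.

Hypotheses (u_gt0 : (0 < u)%N) (u_lt : (2 * u < d)%N) (ud_coprime : coprime u d).

(** For n <= q + 1 the power of T_0 decides. For F_{q+2} the order of X_0 and X_1, which changes
    with the sign of sigma_q, makes Q_q P_{q+1} the larger term. *)
Lemma Um_prec_Lm n : (0 < n)%N -> (n <= q.+2)%N -> prec (Um n) (Lm n).
Proof.
move=> n0; rewrite leq_eqVlt => /orP[/eqP->|nq].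
  rewrite prec_lE; have [-> ->] := PQm_end u_gt0 u_lt ud_coprime.
  have [_ -> _] := @sersE d u q (leqnSn q).
  by case: ifP => /= _; rewrite !mon5c /=; lia.
rewrite Lm_lt // Um_lt // prec_lE /= !mnmDE /T0m /T1m !mon5c.
have [-> -> -> ->] := PQm_T n.
by have := b_gt0 u_gt0 u_lt ud_coprime n0 nq; lia.
Qed.

(** P_j carries no T, so the factor T_0^{b_i} of L_i is of no help. On the same side P_i cancels
    from P_i Q_m; on opposite sides P_j is coprime to P_i, so its divisor P_m must come from M. *)
Lemma colon_core i j (M : 'X_{1..5}) : (0 < i)%N -> (i <= q)%N -> (i < j)%N ->
  (Pm j <= M + Lm i)%MM ->
  if (0 < sg i) == (0 < sg j) then (Qm (mell i) <= M)%MM else (Pm (mell i) <= M)%MM.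
Proof.
move=> i0 iq ij; rewrite Lm_lt; last by lia.
have [_ h1 h2] := sers_mell u_gt0 u_lt ud_coprime i0 iq.
rewrite !mon5_le !mnmDE /T0m !mon5c /monoP /monoQ h1 h2.
have h6 := sers_chain u_gt0 u_lt ud_coprime i0 ij; have h7 := sers_sign u_gt0 u_lt ud_coprime i0.
have h8 := @sers_sign d u u_gt0 u_lt ud_coprime j (leq_trans i0 (ltnW ij)).
by case: (leP (sg i) 0) => h3; case: (leP (sg j) 0) => h4 /=; case: leP => h5;
  rewrite !mon5c; lia.
Qed.

Lemma colon i j (M M' : 'X_{1..5}) : (0 < i)%N -> (i < j)%N -> (j <= q.+2)%N ->
  (M + Lm i = M' + Lm j)%MM ->
  [\/ (i < q)%N /\ ((Qm (mell i) <= M)%MM \/ (Pm (mell i) <= M)%MM),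
      i = q /\ (Pm q.+1 <= M)%MM | i = q.+1 /\ (Qm q <= M)%MM].
Proof.
move=> i0 ij jq e; have [hi|hi] : i = q.+1 \/ (i <= q)%N by lia.
  apply: Or33; split=> //; move: e; have -> : j = q.+2 by lia.
  rewrite Lm_last hi Lm_lt // => /mnmP e.
  have e0 := e iX0; have e1 := e iX1; have e2 := e iX2.
  rewrite !mnmDE /T0m !mon5c in e0 e1 e2; rewrite mon5_le.
  have [_ _ -> ->] := PQm_T q; lia.
(* L_{q+2} is a multiple of P_{q+1}, so j = q + 2 is replaced by q + 1, which is still above i <=
   q. *)
have [k [hk1 hk2 hk3]] : exists k, [/\ (i < k)%N, (k <= q.+1)%N & (Pm k <= M + Lm i)%MM].
  have [hj|hj] : j = q.+2 \/ (j <= q.+1)%N by lia.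
    exists q.+1; split=> //; rewrite e hj Lm_last addmA; exact: lem_addl.
  exists j; split=> //; rewrite e Lm_lt // addmA; exact: lem_addl.
have h := colon_core i0 hi hk1 hk3.
have [iq|iq] : (i < q)%N \/ i = q by lia.
  by apply: Or31; split=> //; move: h; case: ifP; [left|right].
apply: Or32; split=> //; have [hm _ _] := sers_q u_gt0 u_lt ud_coprime.
move: h; have -> : k = q.+1 by lia.
rewrite iq hm ifF //; have q0 : (0 < q)%N by lia.
by have := sers_sign u_gt0 u_lt ud_coprime q0; have [-> _] := sers_last u_gt0 u_lt ud_coprime; lia.
Qed.

Section Field.

Variable K : fieldType.
Local Notation T := ('X_{1..5} * 'I_q.+2)%type.
Local Notation e_ := (e_ K d u).

Lemma is_lmE M n a : (0 < n)%N -> (n <= q.+2)%N ->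
  is_lm d u ('X_[M] * Fpol K d u n) a <-> a = (M + Lm n)%MM.
Proof.
move=> n0 nq; rewrite Fpol_binom // mulrBr -!mpolyXD.
have h := Um_prec_Lm n0 nq.
have ne : (M + Um n != M + Lm n)%MM.
  by rewrite eqm_add2l; apply: contraTneq h => ->; rewrite prec_irr.
have supp m : (m \in msupp ('X_[K, M + Lm n] - 'X_[M + Um n])) =
    (m == M + Lm n)%MM || (m == M + Um n)%MM.
  rewrite mcoeff_msupp mcoeffB !mcoeffX ![_ == m]eq_sym.
  case: (eqVneq m (M + Lm n)%MM) => [->|h1] /=.
    by rewrite [(_ == (M + Um n)%MM)]eq_sym (negPf ne) subr0 oner_eq0.
  by case: (m == (M + Um n)%MM); rewrite sub0r ?oppr0 ?eqxx ?oppr_eq0 ?oner_eq0.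
split=> [[]|->].
  rewrite supp => /orP[/eqP->//|/eqP->] /(_ (M + Lm n)%MM).
  rewrite supp eqxx eq_sym => /(_ isT ne).
  by rewrite prec_add => h1; have := prec_trans h h1; rewrite prec_irr.
split; first by rewrite supp eqxx.
by move=> m; rewrite supp => /orP[/eqP->|/eqP->]; [rewrite eqxx|rewrite prec_add].
Qed.

(** The induced order with M L_i in place of the leading monomial of M F_i, on indices counted from
    1. *)
Definition lt_label (t t' : 'X_{1..5} * nat) : Prop :=
  prec (t.1 + Lm t.2)%MM (t'.1 + Lm t'.2)%MM \/
  (t.1 + Lm t.2 = t'.1 + Lm t'.2)%MM /\ (t'.2 < t.2)%N.

Lemma prec_F0E (t t' : T) :
  prec_F0 K t t' <-> lt_label (t.1, t.2.+1) (t'.1, t'.2.+1).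
Proof.
split=> [[a [a' []]]|h].
  by rewrite !is_lmE // => -> ->.
exists (t.1 + Lm t.2.+1)%MM, (t'.1 + Lm t'.2.+1)%MM.
by split=> //; apply/is_lmE.
Qed.

Lemma prec_F0_irr (t : T) : ~ prec_F0 K t t.
Proof. by rewrite prec_F0E => -[|[_]]; rewrite ?prec_irr ?ltnn. Qed.

Lemma prec_F0_trans (t1 t2 t3 : T) :
  prec_F0 K t1 t2 -> prec_F0 K t2 t3 -> prec_F0 K t1 t3.
Proof.
rewrite !prec_F0E /lt_label /= => -[h1|[-> h1]] [h2|[<- h2]]; [|by left..|].
  by left; apply: prec_trans h1 h2.
by right; split=> //; apply: ltn_trans h2 h1.
Qed.

Lemma prec_F0_total (t t' : T) : t != t' -> prec_F0 K t t' \/ prec_F0 K t' t.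
Proof.
rewrite !prec_F0E /lt_label /= => h.
have [e|ne] := eqVneq (t.1 + Lm t.2.+1)%MM (t'.1 + Lm t'.2.+1)%MM; last first.
  by case/orP: (prec_total d u ne); [left|right]; left.
case: (ltngtP t.2 t'.2) => h1; [by right; right|by left; right|].
have h2 : t.2 = t'.2 by apply/val_inj.
case/eqP: h; rewrite h2 in e; move/addIm: e h2.
by case: (t) (t') => [? ?] [? ?] /= -> ->.
Qed.

Lemma prec_F0_mul p (t t' : T) : prec_F0 K t t' ->
  prec_F0 K ((p + t.1)%MM, t.2) ((p + t'.1)%MM, t'.2).
Proof.
rewrite !prec_F0E /lt_label /= -!addmA prec_add => -[h|[-> h]]; by [left|right].
Qed.

(** Descent in M L_i is well-founded, and among module monomials with equal M L_i a smaller one has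
    a larger index, which is bounded. *)
Lemma prec_F0_wf : well_founded (@prec_F0 K d u).
Proof.
move=> t; move: {-1}(t.1 + Lm t.2.+1)%MM (erefl (t.1 + Lm t.2.+1)%MM) => a.
elim: (prec_wf d u a) t => {}a _ IH t.
move: {2}(q.+2 - t.2)%N (leqnn (q.+2 - t.2)) => k.
elim: k t => [|k IHk] t hk ea; first by have := ltn_ord t.2; lia.
constructor=> t'; rewrite prec_F0E /lt_label /= => -[h|[e h]].
  by apply: (IH _ _ t' erefl); rewrite -ea.
apply: IHk; last by rewrite e.
by have := ltn_ord t'.2; lia.
Qed.

End Field.
End LeadingMonomials.

Lemma nth_flatten_pairs (A B : Type) (x0 : B) (y0 : A) (f g : A -> B) (s : seq A) k :
  (k < (size s).*2)%N ->
  nth x0 (flatten [seq [:: f n; g n] | n <- s]) k =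
  if odd k then g (nth y0 s k./2) else f (nth y0 s k./2).
Proof.
elim: s k => // a s IH [|[|k]] //= h; rewrite IH ?negbK //.
Qed.

Lemma size_flatten_pairs (A B : Type) (f g : A -> B) (s : seq A) :
  size (flatten [seq [:: f n; g n] | n <- s]) = (size s).*2.
Proof. by elim: s => //= a s ->. Qed.

Section SyzygyPairs.

Variables (d u : nat).

Local Notation q := (qsum d u).
Local Notation b n := (st_b (sers d u n)).
Local Notation Pm := (monoP d u).
Local Notation Qm := (monoQ d u).
Local Notation Lm := (leadF d u).
Local Notation Um := (tailF d u).
Local Notation mell := (mell d u).
Local Notation rho := (rho d u).
Local Notation prec := (prec_l d u).
Local Notation lt_label := (lt_label d u).

(* The n-th pair of syzygies, n = 1, ..., q, consists of s_{n,rho(n)} (false)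
   and s_{n,m(n)} (true) when n < q, and of s_{q,q+1} (false) and
   s_{q+1,q+2} (true) when n = q.  Each of them has three terms, supported at
   the module monomials syzA (the leading one), syzB and syzC. *)
Definition syzA n (x : bool) : 'X_{1..5} * nat :=
  if (n < q)%N then ((if x then Pm (mell n) else Qm (mell n)), n)
  else if x then (Qm q, q.+1) else (Pm q.+1, q).

Definition syzB n (x : bool) : 'X_{1..5} * nat :=
  if (n < q)%N then
    if x then ((T0m (b (rho n)) + Pm n)%MM, mell n) else (T0m (b (mell n)), rho n)
  else if x then (T0m 1, q.+2) else (Pm q, q.+1).

Definition syzC n (x : bool) : 'X_{1..5} * nat :=
  if (n < q)%N then
    if x then (T1m (b (mell n)), rho n) else ((T1m (b (rho n)) + Qm n)%MM, mell n)
  else if x then (Qm q.+1, q) else (T1m 1, q.+2).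

Hypotheses (u_gt0 : (0 < u)%N) (u_lt : (2 * u < d)%N) (ud_coprime : coprime u d).

Lemma size_F2 : size (F2_basis d u) = q.*2.
Proof.
rewrite /F2_basis size_cat size_flatten_pairs size_iota /=.
by have := q_gt1 u_gt0 u_lt ud_coprime; lia.
Qed.

Lemma nth_F2 n (x : bool) : (n < q)%N ->
  nth (0, 0)%N (F2_basis d u) (n.*2 + x) =
  if (n.+1 < q)%N then (n.+1, if x then mell n.+1 else rho n.+1)
  else if x then (q.+1, q.+2) else (q, q.+1).
Proof.
move=> nq; rewrite /F2_basis nth_cat size_flatten_pairs size_iota.
case: (ltnP n.+1 q) => h.
  rewrite ifT; last by case: x; lia.
  rewrite (nth_flatten_pairs _ 0%N); last by rewrite size_iota; case: x; lia.
  rewrite oddD odd_double oddb /=.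
  have -> : (n.*2 + x)./2 = n by rewrite addnC half_bit_double.
  by rewrite nth_iota //; [rewrite add1n; case: x|lia].
rewrite ifF; last by case: x; lia.
have -> : (n.*2 + x - q.-1.*2)%N = x by lia.
by case: x.
Qed.

(** This tie is the cancellation that the syzygy stands for; the order breaks it in favour of the
    smaller index, which makes A the leading term. *)
Lemma sBE n x : (0 < n)%N -> (n <= q)%N ->
  ((syzA n x).1 + Lm (syzA n x).2 = (syzB n x).1 + Lm (syzB n x).2)%MM /\
  ((syzA n x).2 < (syzB n x).2)%N.
Proof.
move=> n0 nq; have nq2 : (n < q.+2)%N by lia.
have qq2 : (q < q.+2)%N by lia.
rewrite /syzA /syzB; case: (ltnP n q) => h.
  have /andP[h1 h2] := mell_bounds u_gt0 u_lt ud_coprime n0 nq.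
  have [/andP[h3 h4] _] := rho_bounds u_gt0 u_lt ud_coprime n0 h.
  have [e1 e2] := PQm_rhombus u_gt0 u_lt ud_coprime n0 h.
  have e3 := b_rhombus u_gt0 u_lt ud_coprime n0 h.
  case: x => /=; split=> //; rewrite !Lm_lt //.
    by apply/mnmP => i; rewrite e3 /T0m !mnmDE; move: i; apply: forall_ord5; rewrite !mon5c; lia.
  by apply/mnmP => i; rewrite e1 e3 /T0m !mnmDE; move: i; apply: forall_ord5; rewrite !mon5c; lia.
have [e1 _] := sers_q1 u_gt0 u_lt ud_coprime; have [_ e2 _] := sers_q u_gt0 u_lt ud_coprime.
by case: x => /=; split=> //; rewrite ?Lm_last !Lm_lt // ?e1 ?e2 /T0m;
  apply/mnmP => i; rewrite !mnmDE; lia.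
Qed.

Lemma sCE n x : (0 < n)%N -> (n <= q)%N ->
  prec ((syzC n x).1 + Lm (syzC n x).2)%MM ((syzA n x).1 + Lm (syzA n x).2)%MM.
Proof.
move=> n0 nq; have nq2 : (n < q.+2)%N by lia.
have qq2 : (q < q.+2)%N by lia.
rewrite /syzA /syzC; case: (ltnP n q) => h.
  have /andP[h1 h2] := mell_bounds u_gt0 u_lt ud_coprime n0 nq.
  have [/andP[h3 h4] _] := rho_bounds u_gt0 u_lt ud_coprime n0 h.
  have e3 := b_rhombus u_gt0 u_lt ud_coprime n0 h.
  have b1 := @b_gt0 _ _ u_gt0 u_lt ud_coprime _ (leq_ltn_trans (leq0n _) h1) h2.
  have b2 := @b_gt0 _ _ u_gt0 u_lt ud_coprime _ (leq_ltn_trans (leq0n _) h3) h4.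
  have [p1 _ q1 _] := PQm_T d u (mell n).
  have [p2 _ q2 _] := PQm_T d u (rho n).
  have [p3 _ q3 _] := PQm_T d u n.
  by case: x => /=; rewrite !Lm_lt // prec_lE /= !mnmDE /T0m /T1m !mon5c; lia.
have [e1 _] := sers_q1 u_gt0 u_lt ud_coprime; have [_ e2 _] := sers_q u_gt0 u_lt ud_coprime.
case: x => /=; rewrite ?Lm_last !Lm_lt // ?e1 ?e2.
  (* For s_{q+1,q+2} both sides carry the same T_0, and U_{q+2} against L_{q+2} remains. *)
  have := @Um_prec_Lm d u u_gt0 u_lt ud_coprime q.+2 isT (leqnn _).
  rewrite Um_last Lm_last -(prec_add d u (T0m 1)).
  have -> : (T0m 1 + (Pm q + Qm q.+1) = Qm q.+1 + (T0m 1 + Pm q))%MM.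
    by apply/mnmP => i; rewrite !mnmDE; lia.
  have -> : (T0m 1 + (Qm q + Pm q.+1) = Qm q + (T0m 1 + Pm q.+1))%MM.
    by apply/mnmP => i; rewrite !mnmDE; lia.
  exact.
have [p1 _ q1 _] := PQm_T d u q.
have [p2 _ q2 _] := PQm_T d u q.+1.
by rewrite prec_lE /= !mnmDE /T0m /T1m !mon5c; lia.
Qed.

Lemma sB_lt n x : (0 < n)%N -> (n <= q)%N -> lt_label (syzB n x) (syzA n x).
Proof. by move=> n0 nq; right; have [-> ?] := sBE x n0 nq. Qed.

Lemma sC_lt n x : (0 < n)%N -> (n <= q)%N -> lt_label (syzC n x) (syzA n x).
Proof. by move=> n0 nq; left; apply: sCE. Qed.

Lemma sABC_idx n x : (0 < n)%N -> (n <= q)%N ->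
  [/\ (0 < (syzA n x).2 <= q.+2)%N, (0 < (syzB n x).2 <= q.+2)%N
   & (0 < (syzC n x).2 <= q.+2)%N].
Proof.
move=> n0 nq; rewrite /syzA /syzB /syzC; case: (ltnP n q) => h.
  have /andP[h1 h2] := mell_bounds u_gt0 u_lt ud_coprime n0 nq.
  have [/andP[h3 h4] _] := rho_bounds u_gt0 u_lt ud_coprime n0 h.
  by case: x => /=; split; lia.
by case: x => /=; split; lia.
Qed.

Section Field.

Variable K : fieldType.
Local Notation S := {mpoly K[5]}.
Local Notation e_ := (e_ K d u).

Definition trivec (x : K) (s t r : 'X_{1..5} * nat) : 'rV[S]_q.+2 :=
  'X_[s.1] *: e_ s.2 - 'X_[t.1] *: e_ t.2 + (x *: 'X_[r.1]) *: e_ r.2.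

(** Only s_{q,q+1} has a plus sign at its third term, T_1 e_{q+2}. *)
Definition syz_sign n (x : bool) : K := if (n < q)%N || x then -1 else 1.

Definition syz_pair n x := trivec (syz_sign n x) (syzA n x) (syzB n x) (syzC n x).

Lemma syz_sv n (x : bool) : (n < q)%N ->
  syz K d u (nth (0, 0)%N (F2_basis d u) (n.*2 + x)) = syz_pair n.+1 x.
Proof.
move=> nq; rewrite nth_F2 // /syz_pair /trivec /syz_sign /syzA /syzB /syzC.
case: (ltnP n.+1 q) => h /=.
  have ne1 : (n.+1 == q.+1) = false by apply/eqP; lia.
  have ne2 : (n.+1 == q) = false by apply/eqP; lia.
  rewrite /syz /= ne1 ne2.
  have [_ /nesym/eqP/negPf h1] := @rho_bounds d u u_gt0 u_lt ud_coprime n.+1 isT h.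
  case: x; rewrite scaleN1r scaleNr.
    by rewrite h1 (syz_mE K u_gt0 u_lt ud_coprime (ltn0Sn n) h).
  by rewrite eqxx (syz_rhoE K u_gt0 u_lt ud_coprime (ltn0Sn n) h).
rewrite /syz; case: x => /=.
  by rewrite eqxx scaleN1r scaleNr (syz_q1E K u_gt0 u_lt ud_coprime).
have -> : (q == q.+1) = false by apply/eqP; lia.
by rewrite eqxx scale1r (syz_qE K u_gt0 u_lt ud_coprime).
Qed.

Lemma calF1P g : g \in calF1 K d u <->
  exists n x, [/\ (0 < n)%N, (n <= q)%N & g = syz_pair n x].
Proof.
rewrite /calF1; split=> [/(nthP 0)[k]|[[|n] [x [// _ nq ->]]]].
  rewrite size_map => hk; rewrite (nth_map (0, 0)%N) // => <-.
  exists k./2.+1, (odd k); move: hk; rewrite size_F2 => hk.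
  have hk2 : (k./2 < q)%N by lia.
  split; [exact: ltn0Sn|exact: hk2|rewrite -(syz_sv _ hk2) addnC odd_double_half].
  exact: erefl.
rewrite -(syz_sv _ nq); apply: map_f; apply: mem_nth; rewrite size_F2.
by case: x; lia.
Qed.

End Field.
End SyzygyPairs.

(** * The kernel of Phi_1 *)

Section KernelPhi1.

Variables (K : fieldType) (d u : nat).

Local Notation q := (qsum d u).
Local Notation Lm := (leadF d u).
Local Notation Um := (tailF d u).
Local Notation mell := (mell d u).
Local Notation lt_label := (lt_label d u).
Local Notation sA := (syzA d u).
Local Notation sB := (syzB d u).
Local Notation sC := (syzC d u).
Local Notation sv := (syz_pair d u K).
Local Notation S := {mpoly K[5]}.
Local Notation T := ('X_{1..5} * 'I_q.+2)%type.
Local Notation e_ := (e_ K d u).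
Local Notation Phi1 := (Phi1_mx K d u).
Local Notation ker := (@kerPhi1 K d u).
Local Notation is_lmv := (is_lm_vec (@prec_F0 K d u)).

Definition label (t : T) : 'X_{1..5} * nat := (t.1, t.2.+1).

Lemma label_inj : injective label.
Proof.
by move=> [m i] [m' i'] [-> e]; congr (_, _); apply: val_inj.
Qed.

Lemma label_onto (s : 'X_{1..5} * nat) : (0 < s.2 <= q.+2)%N ->
  exists t, label t = s.
Proof.
case: s => m [|i] //= h; exists (m, inord i); rewrite /label /= inordK //.
Qed.

Lemma coef_trivec x s t r w : coef_vec (@trivec d u K x s t r) w =
  (s == label w)%:R - (t == label w)%:R + x * (r == label w)%:R.
Proof.
have h (c : 'X_{1..5} * nat) : ('X_[c.1] * e_ c.2 0 w.2)@_(w.1) = (c == label w)%:R :> K.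
  case: c => m i /=; rewrite mxE /label xpair_eqE [(i == _)]eq_sym.
  by case: (_.+1 == i); rewrite ?mulr1 ?mulr0 ?mcoeffX ?mcoeff0 ?andbT ?andbF.
rewrite /coef_vec /trivec; move: (h s) (h t) (h r).
move: (e_ s.2) (e_ t.2) (e_ r.2) => f1 f2 f3 h1 h2 h3.
by rewrite !mxE mcoeffD mcoeffB h1 h2 -scalerAl mcoeffZ h3.
Qed.

Lemma e_Phi1 n : (0 < n)%N -> (n <= q.+2)%N ->
  (e_ n *m Phi1) 0 0 = Fpol K d u n.
Proof.
case: n => // n _ nq; rewrite mxE (bigD1 (inord n)) //=.
rewrite big1 => [|i ne]; last first.
  rewrite mxE; case: eqP => [[e]|_]; last by rewrite mul0r.
  by case/eqP: ne; apply: val_inj; rewrite /= inordK.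
by rewrite !mxE inordK // eqxx mul1r addr0.
Qed.

Hypotheses (u_gt0 : (0 < u)%N) (u_lt : (2 * u < d)%N) (ud_coprime : coprime u d).

Lemma sv_sA n x t : (0 < n)%N -> (n <= q)%N -> label t = sA n x ->
  coef_vec (sv n x) t = 1.
Proof.
move=> n0 nq e; rewrite coef_trivec e eqxx.
have irr s : ~ lt_label s s by case=> [|[_]]; rewrite ?prec_irr ?ltnn.
have -> : (sB n x == sA n x) = false.
  by apply/eqP => h; apply: (irr (sA n x)); rewrite -{1}h; apply: sB_lt.
have -> : (sC n x == sA n x) = false.
  by apply/eqP => h; apply: (irr (sA n x)); rewrite -{1}h; apply: sC_lt.
by rewrite mulr0 subr0 addr0.
Qed.

Lemma sv_supp n x t : coef_vec (sv n x) t != 0 ->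
  [\/ label t = sA n x, label t = sB n x | label t = sC n x].
Proof.
rewrite coef_trivec; case: (sA n x =P label t) => [<- _|_]; first by constructor 1.
case: (sB n x =P label t) => [<- _|_]; first by constructor 2.
case: (sC n x =P label t) => [<- _|_]; first by constructor 3.
by rewrite mulr0 subrr addr0 eqxx.
Qed.

Lemma sv_lm n x t : (0 < n)%N -> (n <= q)%N ->
  is_lmv (sv n x) t <-> label t = sA n x.
Proof.
move=> n0 nq; have h t' : label t' = sA n x -> is_lmv (sv n x) t'.
  move=> e; split; first by rewrite (sv_sA n0 nq e) oner_eq0.
  move=> s /sv_supp hs ne; apply/prec_F0E => //; rewrite -/(label t') e.
  rewrite -/(label s); case: hs => hs.
  - by case/eqP: ne; apply: label_inj; rewrite hs e.
  - by rewrite hs; apply: sB_lt.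
  - by rewrite hs; apply: sC_lt.
split; last exact: h.
have [/label_onto [t' e] _ _] := sABC_idx u_gt0 u_lt ud_coprime x n0 nq.
move=> ht; rewrite -e; congr label; apply: is_lm_vec_uniq ht (h _ e).
  exact: prec_F0_irr.
exact: prec_F0_trans.
Qed.

Lemma sv_Phi1 x s t r : (0 < s.2 <= q.+2)%N -> (0 < t.2 <= q.+2)%N ->
  (0 < r.2 <= q.+2)%N -> (@trivec d u K x s t r *m Phi1) 0 0 =
  ('X_[s.1 + Lm s.2] - 'X_[s.1 + Um s.2]) - ('X_[t.1 + Lm t.2] - 'X_[t.1 + Um t.2])
  + x *: ('X_[r.1 + Lm r.2] - 'X_[r.1 + Um r.2]).
Proof.
move=> /andP[s0 s1] /andP[t0 t1] /andP[r0 r1].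
rewrite /trivec mulmxDl mulmxBl -!scalemxAl.
move: (e_Phi1 s0 s1) (e_Phi1 t0 t1) (e_Phi1 r0 r1).
move: (e_ s.2 *m Phi1) (e_ t.2 *m Phi1) (e_ r.2 *m Phi1) => f1 f2 f3 h1 h2 h3.
rewrite !mxE h1 h2 h3 !Fpol_binom // !mpolyXD -scalerAl.
by rewrite !mulrBr.
Qed.

(** Once the leading products at A and B cancel, the two tails have to be the two monomials of the
    third product; which is which depends on the sign of the third term. *)
Lemma sUE n x : (0 < n)%N -> (n <= q)%N ->
  ((sA n x).1 + Um (sA n x).2)%MM =
    ((sC n x).1 + (if (n < q)%N || x then Um else Lm) (sC n x).2)%MM /\
  ((sB n x).1 + Um (sB n x).2)%MM =
    ((sC n x).1 + (if (n < q)%N || x then Lm else Um) (sC n x).2)%MM.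
Proof.
move=> n0 nq; have nq2 : (n < q.+2)%N by lia.
have qq2 : (q < q.+2)%N by lia.
rewrite /syzA /syzB /syzC; case: (ltnP n q) => h.
  have /andP[h1 h2] := mell_bounds u_gt0 u_lt ud_coprime n0 nq.
  have [/andP[h3 h4] _] := rho_bounds u_gt0 u_lt ud_coprime n0 h.
  have [e1 e2] := PQm_rhombus u_gt0 u_lt ud_coprime n0 h.
  have e3 := b_rhombus u_gt0 u_lt ud_coprime n0 h.
  case: x => /=; rewrite ?Lm_lt // ?Um_lt // e3 ?e1 ?e2 /T0m /T1m;
    split; apply/mnmP => i; rewrite !mnmDE; move: i;
    by apply: forall_ord5; rewrite !mon5c; lia.
have [e1 _] := sers_q1 u_gt0 u_lt ud_coprime; have [_ e2 _] := sers_q u_gt0 u_lt ud_coprime.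
case: x => /=; rewrite ?Lm_last ?Um_last ?Lm_lt // ?Um_lt // ?e1 ?e2 /T0m /T1m;
  by split; apply/mnmP => i; rewrite !mnmDE; lia.
Qed.

Lemma sv_ker n x : (0 < n)%N -> (n <= q)%N -> ker (sv n x).
Proof.
move=> n0 nq; rewrite /kerPhi1; apply/matrixP => i j; rewrite !ord1 [RHS]mxE.
have [hA hB hC] := sABC_idx u_gt0 u_lt ud_coprime x n0 nq.
rewrite sv_Phi1 // (proj1 (sBE u_gt0 u_lt ud_coprime x n0 nq)).
have [-> ->] := sUE x n0 nq; rewrite /syz_sign; move: (sA n x) (sB n x) (sC n x) => sa sb sc.
by case: ifP => _; rewrite ?scaleN1r ?scale1r; ring.
Qed.

(** Look at the coefficient of a = M L_i in the image of v. A tail M' U_j = a would give M' L_j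
    above a, against maximality of t; so would M' L_j = a with j < i, by the tie-break. If no j > i
    contributed, the coefficient would be that of v at t, which is not 0. *)
Lemma ker_tie (v : 'rV[S]_q.+2) (t : T) : ker v -> is_lmv v t ->
  exists2 s : T, (t.2 < s.2)%N & (s.1 + Lm s.2.+1 = t.1 + Lm t.2.+1)%MM.
Proof.
move=> hv [ht hmax]; pose a := (t.1 + Lm t.2.+1)%MM.
have [/existsP[j /and3P[h1 h2 h3]]|hex] := boolP [exists j : 'I_q.+2,
  [&& (t.2 < j)%N, (Lm j.+1 <= a)%MM & (v 0 j)@_(a - Lm j.+1) != 0]].
  by exists ((a - Lm j.+1)%MM, j) => //=; rewrite submK.
have hL j : j != t.2 -> (v 0 j * 'X_[Lm j.+1])@_a = 0.
  move=> ne; rewrite mcoeffMX_le; case: ifP => // hle; apply/eqP/negPn/negP => h0.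
  have ne1 : ((a - Lm j.+1)%MM, j) != t by apply: contra ne => /eqP <-.
  have := hmax ((a - Lm j.+1)%MM, j) h0 ne1.
  move/prec_F0E => /(_ u_gt0 u_lt ud_coprime) [] /=; rewrite submK // ?prec_irr //.
  by case=> _ h; case/negP: hex; apply/existsP; exists j; rewrite hle h0 -ltnS h.
have hU j : (v 0 j * 'X_[Um j.+1])@_a = 0.
  rewrite mcoeffMX_le; case: ifP => // hle; apply/eqP/negPn/negP => h0.
  have hp := Um_prec_Lm u_gt0 u_lt ud_coprime (ltn0Sn j) (ltn_ord j).
  rewrite -(prec_add _ _ (a - Um j.+1)%MM) submK // in hp.
  have [e|ne1] := eqVneq ((a - Um j.+1)%MM, j) t.
    have ea : a = (a - Um j.+1 + Lm j.+1)%MM by rewrite {1}/a -e.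
    by rewrite -ea prec_irr in hp.
  have := hmax ((a - Um j.+1)%MM, j) h0 ne1.
  move/prec_F0E => /(_ u_gt0 u_lt ud_coprime) [] /=; rewrite -/a.
    by move=> h; have := prec_trans hp h; rewrite prec_irr.
  by case=> h; rewrite h prec_irr in hp.
have F_binom j : Phi1 j 0 = 'X_[Lm j.+1] - 'X_[Um j.+1].
  by rewrite mxE (Fpol_binom K u_gt0 u_lt ud_coprime (ltn0Sn j) (ltn_ord j)).
have hterm j : (v 0 j * Phi1 j 0)@_a = (v 0 j * 'X_[Lm j.+1])@_a.
  by rewrite F_binom mulrBr mcoeffB (hU j) subr0.
have hsum : ((v *m Phi1) 0 0)@_a = coef_vec v t.
  rewrite mxE raddf_sum.
  rewrite (bigD1 t.2) //=.
  rewrite big1; last first.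
    by move=> j ne; rewrite hterm; exact: (hL j ne).
  rewrite addr0.
  rewrite (hterm t.2).
  rewrite mcoeffMX_le.
  rewrite lem_addl.
  rewrite /a.
  rewrite addmK.
  exact: erefl.
by move: hsum; rewrite hv mxE mcoeff0 => /esym/eqP h; rewrite h in ht.
Qed.

Lemma ker_lm_dvd (v : 'rV[S]_q.+2) (t : T) : ker v -> is_lmv v t ->
  exists g t', [/\ g \in calF1 K d u, is_lmv g t' & mon_dvd t' t].
Proof.
move=> hv /(ker_tie hv) [s hs e].
have hex n x : (0 < n)%N -> (n <= q)%N -> (sA n x).2 = t.2.+1 ->
  ((sA n x).1 <= t.1)%MM -> exists g t', [/\ g \in calF1 K d u, is_lmv g t' & mon_dvd t' t].
  move=> n0 nq e2 h1; exists (sv n x), ((sA n x).1, t.2); split.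
  - by apply/calF1P => //; exists n, x.
  - by apply/sv_lm => //; rewrite /label /= -e2; case: (sA n x).
  - by split.
have [] := colon u_gt0 u_lt ud_coprime (ltn0Sn t.2) (hs : (t.2.+1 < s.2.+1)%N) (ltn_ord s.2) (esym e).
- case=> h [h1|h1]; [apply: (@hex t.2.+1 false)|apply: (@hex t.2.+1 true)];
    rewrite /syzA ?h //; exact: ltnW.
- by case=> h1 h2; apply: (@hex q false); rewrite /syzA ?ltnn //; have := q_gt1 u_gt0 u_lt ud_coprime; lia.
- by case=> h1 h2; apply: (@hex q true); rewrite /syzA ?ltnn //; have := q_gt1 u_gt0 u_lt ud_coprime; lia.
Qed.

Lemma ker_gen v : ker v <-> submod_gen (fun g => g \in calF1 K d u) v.
Proof.
split.
  apply: (division_generates (lt := @prec_F0 K d u)).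
  - exact: prec_F0_trans.
  - exact: prec_F0_total.
  - exact: prec_F0_mul.
  - exact: prec_F0_wf.
  - by move=> v1 v2; rewrite /kerPhi1 mulmxBl => -> ->; rewrite subr0.
  - by move=> a v1; rewrite /kerPhi1 -scalemxAl => ->; rewrite scaler0.
  - move=> g /calF1P => /(_ u_gt0 u_lt ud_coprime) [n [x [n0 nq ->]]]; exact: sv_ker.
  - exact: ker_lm_dvd.
apply: submod_gen_min.
- by rewrite /kerPhi1 mul0mx.
- by move=> v1 v2; rewrite /kerPhi1 mulmxDl => -> ->; rewrite addr0.
- by move=> a v1; rewrite /kerPhi1 -scalemxAl => ->; rewrite scaler0.
- move=> g /calF1P => /(_ u_gt0 u_lt ud_coprime) [n [x [n0 nq ->]]]; exact: sv_ker.
Qed.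

Lemma ker_groebner : groebner_basis (@prec_F0 K d u) ker (calF1 K d u).
Proof.
have hk g : g \in calF1 K d u -> ker g.
  by move/calF1P => /(_ u_gt0 u_lt ud_coprime) [n [x [n0 nq ->]]]; exact: sv_ker.
split=> // v; split; apply: submod_gen_trans => {v} w [v [t [hv ht ->]]].
  have [g [t' [hg hg' [e hd]]]] := ker_lm_dvd hv ht.
  have -> : mon_vec K t = 'X_[t.1 - t'.1] *: mon_vec K t'.
    by rewrite /mon_vec scalerA -mpolyXD submK // e.
  by apply/submod_genZ/submod_gen_id; exists g, t'.
by apply: submod_gen_id; exists v, t; split=> //; apply: hk.
Qed.

End KernelPhi1.

(** * Reducedness of the Groebner basis *)

Section Reduced.

Variables (d u : nat).

Local Notation q := (qsum d u).
Local Notation sg n := (st_sigma (sers d u n)).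
Local Notation Pm := (monoP d u).
Local Notation Qm := (monoQ d u).
Local Notation mell := (mell d u).
Local Notation rho := (rho d u).
Local Notation sA := (syzA d u).
Local Notation sB := (syzB d u).
Local Notation sC := (syzC d u).

Hypotheses (u_gt0 : (0 < u)%N) (u_lt : (2 * u < d)%N) (ud_coprime : coprime u d).

Lemma sg_mell n : (0 < n)%N -> (n <= q)%N -> (0 < sg (mell n)) = ~~ (0 < sg n).
Proof.
move=> n0 nq; have [_ -> _] := sers_mell u_gt0 u_lt ud_coprime n0 nq.
by have := sers_sign u_gt0 u_lt ud_coprime n0; lia.
Qed.

Lemma PQm_X_gt0 k (M : 'X_{1..5}) : (0 < k)%N ->
  M iX0 = 0%N -> M iX1 = 0%N -> M iX2 = 0%N ->
  ~~ (Pm k <= M)%MM /\ ~~ (Qm k <= M)%MM.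
Proof.
move=> k0 h0 h1 h2; have h := sers_sign u_gt0 u_lt ud_coprime k0.
rewrite !mon5_le h0 h1 h2 /monoP /monoQ.
by case: leP => h3; rewrite !mon5c; lia.
Qed.

Lemma PQm_coprime k : (0 < k)%N -> ~~ (Pm k <= Qm k)%MM /\ ~~ (Qm k <= Pm k)%MM.
Proof.
move=> k0; have h := sers_sign u_gt0 u_lt ud_coprime k0.
by rewrite !mon5_le /monoP /monoQ; case: leP => h3; rewrite !mon5c; lia.
Qed.

(** On one side the exponents grow strictly with the index, so P_k does not divide P_n, nor Q_k
    divide Q_n. The mixed pairs share no variable, and powers of T cannot help. *)
Lemma PQm_chain n k a : (0 < n)%N -> (n < k)%N -> (0 < sg k) = (0 < sg n) ->
  [/\ ~~ (Pm k <= T0m a + Pm n)%MM, ~~ (Qm k <= T0m a + Pm n)%MM,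
      ~~ (Pm k <= T1m a + Qm n)%MM & ~~ (Qm k <= T1m a + Qm n)%MM].
Proof.
move=> n0 nk e; have h := sers_sign u_gt0 u_lt ud_coprime n0.
have h1 := sers_sign u_gt0 u_lt ud_coprime (ltn_trans n0 nk).
have h2 := sers_chain u_gt0 u_lt ud_coprime n0 nk.
rewrite !mon5_le !mnmDE /monoP /monoQ /T0m /T1m.
case: (leP (sg k) 0) => h3; case: (leP (sg n) 0) => h4; rewrite !mon5c; first [lia|split; lia].
Qed.

Lemma sA_idx n (x : bool) n' (x' : bool) : (0 < n)%N -> (n <= q)%N -> (0 < n')%N -> (n' <= q)%N ->
  (n, x) != (n', x') -> (sA n' x').2 = (sA n x).2 -> n = n' /\ (n < q)%N.
Proof.
move=> n0 nq n0' nq' hne; rewrite /syzA; case: (ltnP n q) => h; case: (ltnP n' q) => h' /=.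
- by move=> ->.
- by case: x' {hne} => /=; lia.
- by case: x {hne} => /=; lia.
- have e : n = n' by lia.
  by move: hne; rewrite e xpair_eqE eqxx /=; case: x x' => -[] //= _; lia.
Qed.

(** Leading monomials are nonconstant in the X, so they divide no power of T. The terms T^a P_n and
    T^a Q_n at e_{m(n)} fall to [PQm_chain]; every other comparison is between a P and a Q of the
    same index. *)
Lemma sA_ndiv n (x : bool) n' (x' : bool) : (0 < n)%N -> (n <= q)%N -> (0 < n')%N -> (n' <= q)%N ->
  (n, x) != (n', x') ->
  [/\ (sA n' x').2 = (sA n x).2 -> ~~ ((sA n' x').1 <= (sA n x).1)%MM,
      (sA n' x').2 = (sB n x).2 -> ~~ ((sA n' x').1 <= (sB n x).1)%MM &
      (sA n' x').2 = (sC n x).2 -> ~~ ((sA n' x').1 <= (sC n x).1)%MM].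
Proof.
move=> n0 nq n0' nq' hne.
have hq0 : (0 < q)%N by have := q_gt1 u_gt0 u_lt ud_coprime; lia.
have lead j : (sA n' x').2 = j -> exists2 k, (0 < k)%N & ((sA n' x').1 = Pm k \/ (sA n' x').1 = Qm k).
  rewrite /syzA; case: (ltnP n' q) => h /= _.
    have /andP[h1 _] := mell_bounds u_gt0 u_lt ud_coprime n0' nq'.
    exists (mell n'); first by lia.
    by case: x' {hne}; [left|right].
  by case: x' {hne} => /=; [exists q => //; right|exists q.+1 => //; left].
have leadT j (M : 'X_{1..5}) : (sA n' x').2 = j -> M iX0 = 0%N -> M iX1 = 0%N -> M iX2 = 0%N ->
    ~~ ((sA n' x').1 <= M)%MM.
  move=> /lead [k k0 hk] h0 h1 h2; have [? ?] := PQm_X_gt0 k0 h0 h1 h2.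
  by case: hk => ->.
(* At e_{m(n)} leading monomials belong to index m(m(n)), or to q or q + 1 at the end: two changes
   of side lead back to the side of n. *)
have leadm : (n < q)%N -> (sA n' x').2 = mell n ->
    exists k, [/\ (n < k)%N, (0 < sg k) = (0 < sg n) &
      ((sA n' x').1 = Pm k \/ (sA n' x').1 = Qm k)].
  move=> h; have /andP[h1 h2] := mell_bounds u_gt0 u_lt ud_coprime n0 nq.
  have hs := sg_mell n0 nq; rewrite /syzA; case: (ltnP n' q) => h' /= e.
    have /andP[h3 _] := mell_bounds u_gt0 u_lt ud_coprime n0' nq'.
    exists (mell n'); split; first by lia.
      by rewrite sg_mell // e hs negbK.
    by case: x' {hne lead leadT}; [left|right].
  have [eq1 _] := sers_last u_gt0 u_lt ud_coprime.
  have sq := sers_sign u_gt0 u_lt ud_coprime hq0.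
  have sn := sers_sign u_gt0 u_lt ud_coprime n0.
  case: x' {hne lead leadT} e => /= e.
    by exists q; rewrite -e in hs; split=> //; [lia|right].
  by exists q.+1; rewrite -e in hs; split=> //; [lia|left].
have leadm2 a : (n < q)%N -> (sA n' x').2 = mell n ->
    ~~ ((sA n' x').1 <= T0m a + Pm n)%MM /\ ~~ ((sA n' x').1 <= T1m a + Qm n)%MM.
  move=> h /(leadm h) [k [h1 h2 h3]]; have [? ? ? ?] := PQm_chain a n0 h1 h2.
  by case: h3 => ->.
split.
- move=> e; have [en h] := sA_idx n0 nq n0' nq' hne e; subst n'.
  have /andP[h1 _] := mell_bounds u_gt0 u_lt ud_coprime n0 nq.
  have m0 : (0 < mell n)%N by lia.
  have [? ?] := PQm_coprime m0.
  by move: hne; rewrite /syzA h xpair_eqE eqxx /=; case: x {e} => -[]; case: (x').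
- rewrite {1 2}/syzB; case: (ltnP n q) => h.
    by case: x {hne} => /= e; [have [] := leadm2 (st_b (sers d u (rho n))) h e
      |apply: (leadT _ _ e); rewrite mon5c].
  case: x hne => /= hne e; first by apply: (leadT _ _ e); rewrite mon5c.
  move: e; rewrite /syzA; case: (ltnP n' q) => h' /=; first by lia.
  by case: (x') => /= e; [have [] := PQm_coprime hq0|lia].
- rewrite {1 2}/syzC; case: (ltnP n q) => h.
    by case: x {hne} => /= e; [apply: (leadT _ _ e); rewrite mon5c
      |have [] := leadm2 (st_b (sers d u (rho n))) h e].
  case: x hne => /= hne e; last by apply: (leadT _ _ e); rewrite mon5c.
  move: e; rewrite /syzA; case: (ltnP n' q) => h' /=; first by lia.
  by case: (x') => /= e; [lia|have [] := PQm_coprime (ltn0Sn q)].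
Qed.

End Reduced.

Section ReducedGroebner.

Variables (K : fieldType) (d u : nat).
Hypotheses (u_gt0 : (0 < u)%N) (u_lt : (2 * u < d)%N) (ud_coprime : coprime u d).

Lemma ker_reduced_groebner :
  reduced_groebner_basis (@prec_F0 K d u) (@kerPhi1 K d u) (calF1 K d u).
Proof.
split; first exact: ker_groebner.
  move=> g /calF1P => /(_ u_gt0 u_lt ud_coprime) [n [x [n0 nq ->]]].
  have [/label_onto [t e] _ _] := sABC_idx u_gt0 u_lt ud_coprime x n0 nq.
  by exists t; [apply/sv_lm|apply: sv_sA].
move=> g h s t /calF1P => /(_ u_gt0 u_lt ud_coprime) [n [x [n0 nq eg]]].
move=> /calF1P => /(_ u_gt0 u_lt ud_coprime) [n' [x' [n0' nq' eh]]] hne.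
rewrite eg => /sv_supp hs; rewrite eh => /sv_lm => /(_ u_gt0 u_lt ud_coprime n0' nq') ht.
have hne1 : (n, x) != (n', x').
  by apply: contra hne => /eqP[e1 e2]; rewrite eg eh e1 e2.
case=> e1 e2; have [h1 h2 h3] := sA_ndiv u_gt0 u_lt ud_coprime n0 nq n0' nq' hne1.
have e3 : (label t).2 = (label s).2 by rewrite /label /= e1.
rewrite -[t.1]/(label t).1 -[s.1]/(label s).1 in e2.
by case: hs => hs; move: e2 e3; rewrite ht hs => e2 e3;
  [have := h1 e3|have := h2 e3|have := h3 e3]; rewrite e2.
Qed.

End ReducedGroebner.

Lemma sum_pairs (V : nmodType) (F : nat -> V) n :
  \sum_(j < n.*2) F j = \sum_(i < n) (F (i.*2 + false)%N + F (i.*2 + true)%N).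
Proof.
elim: n => [|n IH]; first by rewrite !big_ord0.
by rewrite doubleS !big_ord_recr /= IH addn0 addn1 addrA.
Qed.

Lemma mpolyX_neq0 (n : nat) (R : nzRingType) (m : 'X_{1..n}) : 'X_[R, m] != 0.
Proof.
by apply/eqP => /mpolyP/(_ m)/eqP; rewrite mcoeffX eqxx mcoeff0 oner_eq0.
Qed.

(** Syzygies of two coprime monomials are Koszul: for a monomial m of a, Q + m occurs in b X^P, so P
    divides Q + m and, by disjoint supports, m. *)
Lemma mpolyX_cross (n : nat) (R : idomainType) (a b : {mpoly R[n]}) (P Q : 'X_{1..n}) :
  (forall i, P i = 0 \/ Q i = 0)%N -> a * 'X_[Q] + b * 'X_[P] = 0 ->
  exists h, a = h * 'X_[P] /\ b = - (h * 'X_[Q]).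
Proof.
move=> PQ e; have hP m : a@_m != 0 -> (P <= m)%MM.
  move=> ha; have : (b * 'X_[P])@_(Q + m) != 0.
    have -> : b * 'X_[P] = - (a * 'X_[Q]).
      by apply/eqP; rewrite -addr_eq0 addrC e.
    by rewrite mcoeffN oppr_eq0 mcoeffMX.
  rewrite mcoeffMX_le; case: ifP => [/mnm_lepP h _|]; last by rewrite eqxx.
  by apply/mnm_lepP => i; have := h i; rewrite mnmDE; case: (PQ i) => ->.
pose h := \sum_(m <- msupp a) a@_m *: 'X_[m - P].
have ha : a = h * 'X_[P].
  rewrite {1}[a]mpolyE /h mulr_suml big_seq [RHS]big_seq; apply: eq_bigr => m hm.
  by rewrite -scalerAl -mpolyXD submK // hP // -mcoeff_msupp.
exists h; split=> //; apply/eqP; rewrite -addr_eq0.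
have : (h * 'X_[Q] + b) * 'X_[P] = 0.
  by rewrite mulrDl -e ha -!mulrA ['X_[Q] * _]mulrC.
by move/eqP; rewrite mulf_eq0 (negPf (mpolyX_neq0 _ _)) orbF addrC.
Qed.

(** * The map Phi_3 and the kernel of Phi_2 *)

Section KoszulIdentities.

Variables (R : comNzRingType) (n : nat) (x y z : 'rV[R]_n).

(** Here x, y, z stand for e_n, e_m, e_rho; p, r for P_m, Q_m; f, g for P_n, Q_n; A, B for
    T_0^{b_m}, T_1^{b_m}; C, D for T_0^{b_rho}, T_1^{b_rho}. In [koszul_last_id] the vectors are
    e_q, e_{q+1}, e_{q+2}. *)
Lemma koszul_pair_id (p r A B C D f g : R) :
  p *: (r *: x - A *: z + (- (D * g)) *: y) - r *: (p *: x - (C * f) *: y + (- B) *: z) =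
  (C * (f * r) - D * (g * p)) *: y - (A * p - B * r) *: z.
Proof. by apply/rowP => j; rewrite !mxE; ring. Qed.

Lemma koszul_next_id (p r A B C D f g : R) :
  A *: (p *: x - (C * f) *: y + (- B) *: z) - B *: (r *: x - A *: z + (- (D * g)) *: y) =
  (A * p - B * r) *: x - (A * C * f - B * D * g) *: y.
Proof. by apply/rowP => j; rewrite !mxE; ring. Qed.

Lemma koszul_last_id (p r A B f g : R) :
  A *: (p *: x - f *: y + B *: z) + B *: (g *: y - A *: z + (- r) *: x) =
  (A * p - B * r) *: x - (A * f - B * g) *: y.
Proof. by apply/rowP => j; rewrite !mxE; ring. Qed.

End KoszulIdentities.

Section Phi2Phi3.

Variables (K : fieldType) (d u : nat).

Local Notation q := (qsum d u).
Local Notation b n := (st_b (sers d u n)).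
Local Notation Pm := (monoP d u).
Local Notation Qm := (monoQ d u).
Local Notation Lm := (leadF d u).
Local Notation Um := (tailF d u).
Local Notation mell := (mell d u).
Local Notation rho := (rho d u).
Local Notation sv := (syz_pair d u K).
Local Notation S := {mpoly K[5]}.
Local Notation e_ := (e_ K d u).
Local Notation N := (size (F2_basis d u)).
Local Notation Phi2 := (Phi2_mx K d u).
Local Notation Fb n := ('X_[Lm n] - 'X_[Um n] : S).

(* The relation P_m s_{n,rho} - Q_m s_{n,m} = F_rho e_m - F_m e_rho and the
   Koszul syzygy of F_{n'} and F_{m(n')} obtained from the pair n' = n + 1 are
   equal up to the sign - eps3 n. *)
Definition eps3 n : K := if rho n == n.+1 then 1 else -1.

(** Row i relates the pairs n = i + 1 and n + 1, so the matrix is a staircase of blocks of two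
    columns. The last row meets the pair q, whose Koszul combination has coefficients T_0 and
    T_1. *)
Definition phi3_entry (i j : nat) : S :=
  let n := i.+1 in let m' := mell n.+1 in
  if j == i.*2 then 'X_[Pm (mell n)]
  else if j == i.*2.+1 then - 'X_[Qm (mell n)]
  else if j == i.*2.+2 then
    eps3 n *: (if (n.+1 < q)%N then - 'X_[T1m (b m')] else 'X_[T0m 1])
  else if j == i.*2.+3 then
    eps3 n *: (if (n.+1 < q)%N then 'X_[T0m (b m')] else 'X_[T1m 1])
  else 0.

Definition Phi3_mx : 'M[S]_(q.-1, N) := \matrix_(i < q.-1, j < N) phi3_entry i j.

(** Zero out of range, so that coordinates can be grouped in pairs without carrying bounds. *)
Definition coord2 (w : 'rV[S]_N) (j : nat) : S :=
  if insub j is Some k then w 0 k else 0.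

Lemma coord2E w (k : 'I_N) : coord2 w k = w 0 k.
Proof. by rewrite /coord2 valK. Qed.

Hypotheses (u_gt0 : (0 < u)%N) (u_lt : (2 * u < d)%N) (ud_coprime : coprime u d).

Lemma sum_F2 (V : nmodType) (F : nat -> V) :
  \sum_(j < N) F j = \sum_(i < q) (F (i.*2 + false)%N + F (i.*2 + true)%N).
Proof. by rewrite size_F2 // sum_pairs. Qed.

Lemma mul_Phi2 w : w *m Phi2 =
  \sum_(i < q) (coord2 w (i.*2 + false) *: sv i.+1 false
              + coord2 w (i.*2 + true) *: sv i.+1 true).
Proof.
rewrite mulmx_sum_row.
rewrite (eq_bigr (fun k : 'I_N =>
  coord2 w k *: syz K d u (nth (0, 0)%N (F2_basis d u) k))); last first.
  by move=> k _; rewrite coord2E rowK.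
rewrite (sum_F2 (fun k => coord2 w k *: syz K d u (nth (0, 0)%N (F2_basis d u) k))).
apply: eq_bigr => i _; congr (_ *: _ + _ *: _); exact: syz_sv.
Qed.

Lemma koszul_pair n : (0 < n)%N -> (n < q)%N ->
  'X_[Pm (mell n)] *: sv n false - 'X_[Qm (mell n)] *: sv n true =
  Fb (rho n) *: e_ (mell n) - Fb (mell n) *: e_ (rho n).
Proof.
move=> n0 nq; have /andP[_ h2] := mell_bounds u_gt0 u_lt ud_coprime n0 (ltnW nq).
have [/andP[_ h4] _] := rho_bounds u_gt0 u_lt ud_coprime n0 nq.
have [e1 e2] := PQm_rhombus u_gt0 u_lt ud_coprime n0 nq.
rewrite /syz_pair /trivec /syz_sign /syzA /syzB /syzC nq /=.
rewrite (Lm_lt h2) (Um_lt h2) (Lm_lt h4) (Um_lt h4) e1 e2 !mpolyXD.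
rewrite !scaleN1r; exact: koszul_pair_id.
Qed.

Lemma koszul_next n : (0 < n)%N -> (n <= q)%N ->
  (if (n < q)%N then 'X_[T0m (b (mell n))] *: sv n true - 'X_[T1m (b (mell n))] *: sv n false
   else 'X_[T0m 1] *: sv n false + 'X_[T1m 1] *: sv n true) =
  Fb (mell n) *: e_ n - Fb n *: e_ (mell n).
Proof.
move=> n0 nq; have /andP[_ h2] := mell_bounds u_gt0 u_lt ud_coprime n0 nq.
have nq2 : (n < q.+2)%N by lia.
rewrite (Lm_lt h2) (Um_lt h2) (Lm_lt nq2) (Um_lt nq2).
case: (ltnP n q) => h.
  have e3 := b_rhombus u_gt0 u_lt ud_coprime n0 h.
  rewrite e3.
  have -> : T0m (b (mell n) + b (rho n)) = (T0m (b (mell n)) + T0m (b (rho n)))%MM by rewrite mon5D.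
  have -> : T1m (b (mell n) + b (rho n)) = (T1m (b (mell n)) + T1m (b (rho n)))%MM by rewrite mon5D.
  rewrite /syz_pair /trivec /syz_sign /syzA /syzB /syzC h /= !mpolyXD.
  rewrite !scaleN1r; exact: koszul_next_id.
have {h nq2} -> : n = q by lia.
have [-> -> _] := sers_q u_gt0 u_lt ud_coprime; have [-> _] := sers_q1 u_gt0 u_lt ud_coprime.
rewrite /syz_pair /trivec /syz_sign /syzA /syzB /syzC ltnn /= !mpolyXD.
rewrite scaleN1r scale1r; exact: koszul_last_id.
Qed.

End Phi2Phi3.

Lemma scale_pair0 (R : pzRingType) (V : lmodType R) (a b : R) (x y : V) :
  a = 0 -> b = 0 -> a *: x + b *: y = 0.
Proof. by move=> -> ->; rewrite !scale0r addr0. Qed.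

Lemma scale_pair_if (R : pzRingType) (V : lmodType R) (f : bool) (c x y z t : R)
  (v w : V) : (c * (if f then - x else y)) *: v + (c * (if f then z else t)) *: w =
  c *: (if f then z *: w - x *: v else y *: v + t *: w).
Proof. by case: f; rewrite -!scalerA -scalerDr // scaleNr addrC. Qed.

Lemma addrBB (V : zmodType) (x y : V) : (x - y) + (y - x) = 0.
Proof. by rewrite -(opprB y x) addNr. Qed.

Lemma sum_two (V : nmodType) n (G : 'I_n -> V) i j : j != i ->
  (forall k, k != i -> k != j -> G k = 0) -> \sum_k G k = G i + G j.
Proof.
move=> ij h; rewrite (bigD1 i) //= (bigD1 j) //= big1 ?addr0 // => k /andP[h1 h2].
exact: h.
Qed.

Section ExactPhi2.

Variables (K : fieldType) (d u : nat).

Local Notation q := (qsum d u).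
Local Notation b n := (st_b (sers d u n)).
Local Notation Pm := (monoP d u).
Local Notation Qm := (monoQ d u).
Local Notation mell := (mell d u).
Local Notation rho := (rho d u).
Local Notation e_ := (e_ K d u).
Local Notation N := (size (F2_basis d u)).
Local Notation Phi2 := (Phi2_mx K d u).
Local Notation Phi3 := (Phi3_mx K d u).
Local Notation phi3 := (phi3_entry K d u).

Lemma phi3_lt i j : (j < i.*2)%N -> phi3 i j = 0.
Proof. by move=> h; rewrite /phi3_entry !ifF //; apply/eqP; lia. Qed.

Lemma phi3_gt i j : (i.*2.+3 < j)%N -> phi3 i j = 0.
Proof. by move=> h; rewrite /phi3_entry !ifF //; apply/eqP; lia. Qed.

Lemma phi3_0 i : phi3 i (i.*2 + false) = 'X_[Pm (mell i.+1)].
Proof. by rewrite addn0 /phi3_entry eqxx. Qed.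

Lemma phi3_1 i : phi3 i (i.*2 + true) = - 'X_[Qm (mell i.+1)].
Proof. by rewrite addn1 /phi3_entry eqxx -[_.+1 == _]negbK neq_ltn ltnSn orbT. Qed.

Lemma phi3_2 i : phi3 i (i.+1.*2 + false) = eps3 K d u i.+1 *:
  (if (i.+2 < q)%N then - 'X_[T1m (b (mell i.+2))] else 'X_[T0m 1]).
Proof.
rewrite addn0 doubleS /phi3_entry.
have -> : (i.*2.+2 == i.*2) = false by apply/eqP; lia.
have -> : (i.*2.+2 == i.*2.+1) = false by apply/eqP; lia.
by rewrite eqxx.
Qed.

Lemma phi3_3 i : phi3 i (i.+1.*2 + true) = eps3 K d u i.+1 *:
  (if (i.+2 < q)%N then 'X_[T0m (b (mell i.+2))] else 'X_[T1m 1]).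
Proof.
rewrite addn1 doubleS /phi3_entry.
have -> : (i.*2.+3 == i.*2) = false by apply/eqP; lia.
have -> : (i.*2.+3 == i.*2.+1) = false by apply/eqP; lia.
have -> : (i.*2.+3 == i.*2.+2) = false by apply/eqP; lia.
by rewrite eqxx.
Qed.

Hypotheses (u_gt0 : (0 < u)%N) (u_lt : (2 * u < d)%N) (ud_coprime : coprime u d).

Lemma row_Phi3_Phi2 (i : 'I_q.-1) : row i Phi3 *m Phi2 = 0.
Proof.
have i1q : (i.+1 < q)%N by have := ltn_ord i; lia.
have iq : (i < q)%N by lia.
have hc j : (j < q.*2)%N -> coord2 (row i Phi3) j = phi3 i j.
  rewrite -size_F2 // => h; have := coord2E (row i Phi3) (Ordinal h).
  by rewrite /= => ->; rewrite !mxE.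
rewrite mul_Phi2 // (@sum_two _ _ _ (Ordinal iq) (Ordinal i1q)); first last.
- move=> j /eqP h1 /eqP h2.
  have h3 : nat_of_ord j <> i by move=> e; apply: h1; apply: val_inj.
  have h4 : nat_of_ord j <> i.+1 by move=> e; apply: h2; apply: val_inj.
  have hj := ltn_ord j.
  have h8 : (j.*2 + false < q.*2)%N by lia.
  have h9 : (j.*2 + true < q.*2)%N by lia.
  apply: scale_pair0; [rewrite (hc _ h8)|rewrite (hc _ h9)]; rewrite {h8 h9}.
    have [h5|h5] : (j < i)%N \/ (i.+1 < j)%N by lia.
      by apply: phi3_lt; lia.
    by apply: phi3_gt; lia.
  have [h5|h5] : (j < i)%N \/ (i.+1 < j)%N by lia.
    by apply: phi3_lt; lia.
  by apply: phi3_gt; lia.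
- by apply/eqP => /(congr1 val) /=; lia.
have c0 : coord2 (row i Phi3) (i.*2 + false) = 'X_[Pm (mell i.+1)].
  by rewrite hc; [exact: phi3_0|lia].
have c1 : coord2 (row i Phi3) (i.*2 + true) = - 'X_[Qm (mell i.+1)].
  by rewrite hc; [exact: phi3_1|lia].
have c2 : coord2 (row i Phi3) (i.+1.*2 + false) = phi3 i (i.+1.*2 + false).
  by rewrite hc //; lia.
have c3 : coord2 (row i Phi3) (i.+1.*2 + true) = phi3 i (i.+1.*2 + true).
  by rewrite hc //; lia.
rewrite /= c0 c1 c2 c3 phi3_2 phi3_3 scaleNr.
have hk := koszul_pair K u_gt0 u_lt ud_coprime (ltn0Sn i) i1q.
have := koszul_next K u_gt0 u_lt ud_coprime (ltn0Sn i.+1) i1q.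
move=> hn; have hn2 := congr1 (fun v => (eps3 K d u i.+1)%:MP *: v) hn.
have h2 := etrans (scale_pair_if _ _ _ _ _ _ _ _) hn2.
rewrite !mul_mpolyC in h2.
apply: etrans (congr2 +%R hk h2) _; rewrite /eps3.
(* Within a division (rho, m) is (n + 1, m(n + 1)); across an exchange it is (m(n + 1), n + 1),
   which flips the sign of the Koszul syzygy and accounts for [eps3]. *)
have [[-> [-> _]]|[e1 e2]] := mell_rho_next u_gt0 u_lt ud_coprime (ltn0Sn i) i1q.
  rewrite eqxx mpolyC1 scale1r.
  exact: addrBB.
have [_ /nesym] := rho_bounds u_gt0 u_lt ud_coprime (ltn0Sn i) i1q.
rewrite e1 => /eqP h; rewrite eq_sym (negPf h) e2 mpolyCN mpolyC1 scaleN1r.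
exact: subrr.
Qed.

End ExactPhi2.

Lemma sum_only (V : nmodType) n (G : 'I_n -> V) i :
  (forall k, k != i -> G k = 0) -> \sum_k G k = G i.
Proof. by move=> h; rewrite (bigD1 i) //= big1 ?addr0. Qed.

Lemma mul_pair0l (R : pzRingType) (a b x y : R) : a = 0 -> b = 0 -> a * x + b * y = 0.
Proof. by move=> -> ->; rewrite !mul0r addr0. Qed.

Lemma mul_pair0r (R : pzRingType) (a b x y : R) : x = 0 -> y = 0 -> a * x + b * y = 0.
Proof. by move=> -> ->; rewrite !mulr0 addr0. Qed.

Lemma mul_pair_eq (R : pzRingType) (a b x y x' y' : R) : x = x' -> y = y' ->
  a * x + b * y = 0 -> a * x' + b * y' = 0.
Proof. by move=> -> ->. Qed.

Lemma trinomial_fst (R : pzRingType) (a b c : R) :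
  a * true%:R - b * false%:R + c * false%:R = a.
Proof. by rewrite !mulr0 mulr1 subr0 addr0. Qed.

Lemma trinomial_snd (R : pzRingType) (a b c : R) :
  a * false%:R - b * true%:R + c * false%:R = - b.
Proof. by rewrite !mulr0 mulr1 sub0r addr0. Qed.

Lemma trinomial_trd (R : pzRingType) (a b c : R) :
  a * false%:R - b * false%:R + c * true%:R = c.
Proof. by rewrite !mulr0 mulr1 subr0 add0r. Qed.

Lemma sub_mul0 (R : pzRingType) (a x y : R) : a = 0 -> y = 0 -> a - x * y = 0.
Proof. by move=> -> ->; rewrite mulr0 subr0. Qed.

Lemma mpolyX_sub_neq0 (n : nat) (R : nzRingType) (m m' : 'X_{1..n}) : m != m' ->
  'X_[R, m] - 'X_[m'] != 0.
Proof.
move=> ne; apply/eqP => /mpolyP/(_ m)/eqP; rewrite mcoeffB !mcoeffX eqxx mcoeff0.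
by rewrite [m' == m]eq_sym (negPf ne) subr0 oner_eq0.
Qed.

Lemma scale_pair_entry (R : pzRingType) n (v w : 'rV[R]_n) (x y : R) j :
  (x *: v + y *: w) 0 j = x * v 0 j + y * w 0 j.
Proof. by rewrite !mxE. Qed.
Lemma cramer2 (R : idomainType) (x y T0 T1 P Q : R) :
  x * T1 - y * T0 = 0 -> x * P - y * Q = 0 -> T0 * P - T1 * Q != 0 ->
  x = 0 /\ y = 0.
Proof.
move=> h1 h2 h3.
have hx : x * (T0 * P - T1 * Q) = 0.
  transitivity (T0 * (x * P - y * Q) - Q * (x * T1 - y * T0)); first by ring.
  by rewrite h1 h2 !mulr0 subr0.
have hy : y * (T0 * P - T1 * Q) = 0.
  transitivity (T1 * (x * P - y * Q) - P * (x * T1 - y * T0)); first by ring.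
  by rewrite h1 h2 !mulr0 subr0.
by move/eqP: hx; move/eqP: hy; rewrite !mulf_eq0 (negPf h3) !orbF => /eqP -> /eqP ->.
Qed.

(** * Elimination in ker Phi_2 and injectivity of Phi_3 *)

Section ExactPhi3.

Variables (K : fieldType) (d u : nat).

Local Notation q := (qsum d u).
Local Notation Pm := (monoP d u).
Local Notation Qm := (monoQ d u).
Local Notation mell := (mell d u).
Local Notation rho := (rho d u).
Local Notation sA := (syzA d u).
Local Notation sB := (syzB d u).
Local Notation sC := (syzC d u).
Local Notation sv := (syz_pair d u K).
Local Notation S := {mpoly K[5]}.
Local Notation e_ := (e_ K d u).
Local Notation N := (size (F2_basis d u)).
Local Notation Phi2 := (Phi2_mx K d u).
Local Notation Phi3 := (Phi3_mx K d u).
Local Notation phi3 := (phi3_entry K d u).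

Hypotheses (u_gt0 : (0 < u)%N) (u_lt : (2 * u < d)%N) (ud_coprime : coprime u d).

Lemma coord2B (v w : 'rV[S]_N) j : coord2 (v - w) j = coord2 v j - coord2 w j.
Proof. by rewrite /coord2; case: insub => [k|]; rewrite ?mxE // subr0. Qed.

Lemma coord2Z (c : S) (w : 'rV[S]_N) j : coord2 (c *: w) j = c * coord2 w j.
Proof. by rewrite /coord2; case: insub => [k|]; rewrite ?mxE // mulr0. Qed.

Lemma coord2_row (i : 'I_q.-1) j : (j < q.*2)%N -> coord2 (row i Phi3) j = phi3 i j.
Proof.
rewrite -size_F2 // => h; have := coord2E (row i Phi3) (Ordinal h).
by rewrite /= => ->; rewrite !mxE.
Qed.

Lemma trivec_entry x s t r (j : 'I_q.+2) : @trivec d u K x s t r 0 j =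
  'X_[s.1] * (j.+1 == s.2)%:R - 'X_[t.1] * (j.+1 == t.2)%:R
  + x *: 'X_[r.1] * (j.+1 == r.2)%:R.
Proof. by rewrite !mxE. Qed.

Lemma sABC_ge n x : (0 < n)%N -> (n <= q)%N ->
  [/\ (n <= (sA n x).2)%N, (n <= (sB n x).2)%N & (n <= (sC n x).2)%N].
Proof.
move=> n0 nq; rewrite /syzA /syzB /syzC; case: (ltnP n q) => h.
  have /andP[h1 h2] := mell_bounds u_gt0 u_lt ud_coprime n0 nq.
  have [/andP[h3 h4] _] := rho_bounds u_gt0 u_lt ud_coprime n0 h.
  by case: x => /=; split; lia.
by case: x => /=; split; lia.
Qed.

Lemma sv_entry_lt n x (j : 'I_q.+2) : (0 < n)%N -> (n <= q)%N -> (j.+1 < n)%N ->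
  sv n x 0 j = 0.
Proof.
move=> n0 nq h; have [h1 h2 h3] := sABC_ge x n0 nq; rewrite trivec_entry.
have -> : (j.+1 == (sA n x).2) = false by apply/eqP; lia.
have -> : (j.+1 == (sB n x).2) = false by apply/eqP; lia.
have -> : (j.+1 == (sC n x).2) = false by apply/eqP; lia.
by rewrite !mulr0 subr0 addr0.
Qed.

Lemma sv_entry_diag n x (j : 'I_q.+2) : (0 < n)%N -> (n < q)%N -> j.+1 = n ->
  sv n x 0 j = 'X_[if x then Pm (mell n) else Qm (mell n)].
Proof.
move=> n0 nq e; rewrite trivec_entry.
have /andP[h1 h2] := mell_bounds u_gt0 u_lt ud_coprime n0 (ltnW nq).
have [/andP[h3 h4] _] := rho_bounds u_gt0 u_lt ud_coprime n0 nq.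
have hm : (j.+1 == mell n) = false by apply/eqP; lia.
have hr : (j.+1 == rho n) = false by apply/eqP; lia.
rewrite /syzA /syzB /syzC nq.
by case: x => /=; rewrite hm hr e eqxx !mulr0 subr0 addr0 mulr1.
Qed.

Lemma mul_Phi2_entry w k (j : 'I_q.+2) : (k < q)%N ->
  (forall i, (i < k.*2)%N -> coord2 w i = 0) -> 
  (forall n x, (k.+1 < n)%N -> (n <= q)%N -> sv n x 0 j = 0) ->
  (w *m Phi2) 0 j = coord2 w (k.*2 + false) * sv k.+1 false 0 j
    + coord2 w (k.*2 + true) * sv k.+1 true 0 j.
Proof.
move=> kq h0 h1; rewrite mul_Phi2 // summxE.
rewrite (sum_only (i := Ordinal kq)); first exact: scale_pair_entry.
move=> i ik; rewrite scale_pair_entry.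
have [hi|hi] : (i < k)%N \/ (k < i)%N.
  by apply/orP; rewrite -neq_ltn; apply: contra ik => /eqP e; apply/eqP/val_inj.
  have h2 : (i.*2 + false < k.*2)%N by lia.
  have h3 : (i.*2 + true < k.*2)%N by lia.
  by apply: mul_pair0l; exact: h0.
have h2 : (k.+1 < i.+1)%N by lia.
by apply: mul_pair0r; apply: (h1 _ _ h2 (ltn_ord i)).
Qed.

Lemma PQm_disjoint n i : Pm n i = 0%N \/ Qm n i = 0%N.
Proof.
rewrite /monoP /monoQ; case: ifP => _; move: i; apply: forall_ord5;
  rewrite !mon5c; lia.
Qed.

(** At e_{i+1} only the pair i + 1 contributes: later pairs involve larger indices, and earlier
    coefficients are zero. So the two coefficients form a syzygy of the coprime monomials Q_m and
    P_m, a multiple of the first block of row i of Phi_3. *)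
Lemma elim_step (w : 'rV[S]_N) (i : 'I_q.-1) : w *m Phi2 = 0 ->
  (forall j, (j < i.*2)%N -> coord2 w j = 0) ->
  exists h : S, forall j, (j < i.+1.*2)%N -> coord2 (w - h *: row i Phi3) j = 0.
Proof.
move=> hw h0; have i1q : (i.+1 < q)%N by have := ltn_ord i; lia.
have iq : (i < q)%N by lia.
have iq2 : (i < q.+2)%N by lia.
have none n x : (i.+1 < n)%N -> (n <= q)%N -> sv n x 0 (Ordinal iq2) = 0.
  by move=> h1 h2; apply: sv_entry_lt => //; lia.
have e := mul_Phi2_entry iq h0 none.
rewrite hw mxE in e.
have d0 := sv_entry_diag false (ltn0Sn i) i1q (erefl : (Ordinal iq2).+1 = i.+1).
have d1 := sv_entry_diag true (ltn0Sn i) i1q (erefl : (Ordinal iq2).+1 = i.+1).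
have {}e := mul_pair_eq d0 d1 (esym e).
have [h [e0 e1]] := mpolyX_cross (@PQm_disjoint (mell i.+1)) e.
exists h => j hj; rewrite coord2B coord2Z coord2_row; last by lia.
have [h1|h1] : (j < i.*2)%N \/ (j = i.*2 + false \/ j = i.*2 + true)%N by lia.
  by apply: sub_mul0; [exact: h0|exact: phi3_lt].
case: h1 => ->; first by rewrite phi3_0 e0 subrr.
by rewrite phi3_1 e1 mulrN opprK addNr.
Qed.

Lemma sv_q_entries (j1 j2 : 'I_q.+2) : j1.+1 = q -> j2 = q.+1 :> nat ->
  [/\ sv q false 0 j1 = 'X_[Pm q.+1], sv q true 0 j1 = - 'X_[Qm q.+1],
      sv q false 0 j2 = 'X_[T1m 1] & sv q true 0 j2 = - 'X_[T0m 1]].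
Proof.
move=> e1 e2.
have t1 : (q.+2 == q) = false by apply/eqP; lia.
have t2 : (q.+2 == q.+1) = false by apply/eqP; lia.
have t3 : (q == q.+1) = false by apply/eqP; lia.
have t4 : (q == q.+2) = false by apply/eqP; lia.
rewrite /syz_pair; split; rewrite trivec_entry ?e1 ?e2 /syz_sign /syzA /syzB /syzC ltnn /=
  ?t1 ?t2 ?t3 ?t4 eqxx.
- exact: trinomial_fst.
- by apply: etrans (trinomial_trd _ _ _) _; rewrite scaleN1r.
- by apply: etrans (trinomial_trd _ _ _) _; rewrite scale1r.
- exact: trinomial_snd.
Qed.

Lemma elim_all (w : 'rV[S]_N) k : w *m Phi2 = 0 -> (k <= q.-1)%N ->
  exists x : 'rV[S]_q.-1, forall j, (j < k.*2)%N -> coord2 (w - x *m Phi3) j = 0.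
Proof.
move=> hw; elim: k => [|k IH] hk; first by exists 0.
have [x hx] := IH (ltnW hk).
have hw' : (w - x *m Phi3) *m Phi2 = 0.
  rewrite mulmxBl hw -mulmxA.
  have -> : Phi3 *m Phi2 = 0; last by rewrite mulmx0 subr0.
  by apply/row_matrixP => i; rewrite row_mul row_Phi3_Phi2 // row0.
have [h hh] := @elim_step _ (Ordinal hk) hw' hx.
exists (x + h *: delta_mx 0 (Ordinal hk)) => j hj.
by rewrite mulmxDl -scalemxAl -rowE opprD addrA; apply: hh.
Qed.

(** Only the last pair is left. Its entries at e_{q+2} and e_q give a 2 by 2 system of determinant
    T_0 P_{q+1} - T_1 Q_{q+1} = F_{q+1}, which is not zero. *)
Lemma elim_last (w : 'rV[S]_N) : w *m Phi2 = 0 ->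
  (forall j, (j < q.-1.*2)%N -> coord2 w j = 0) -> w = 0.
Proof.
move=> hw h0; have q1 := q_gt1 u_gt0 u_lt ud_coprime.
have qq : (q.-1 < q)%N by lia.
have hj1 : (q.-1 < q.+2)%N by lia.
have hj2 : (q.+1 < q.+2)%N by lia.
have none j n x : (q.-1.+1 < n)%N -> (n <= q)%N -> sv n x 0 j = 0 by move=> *; lia.
have h1 := mul_Phi2_entry qq h0 (none (Ordinal hj1)).
have h2 := mul_Phi2_entry qq h0 (none (Ordinal hj2)).
have e : q.-1.+1 = q by lia.
have [e1 e2 e3 e4] := @sv_q_entries (Ordinal hj1) (Ordinal hj2) e (erefl _).
rewrite hw mxE e in h1; rewrite hw mxE e in h2.
have {}h1 := mul_pair_eq e1 e2 (esym h1); have {}h2 := mul_pair_eq e3 e4 (esym h2).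
rewrite mulrN in h1; rewrite mulrN in h2.
have ne : (T0m 1 + Pm q.+1 != T1m 1 + Qm q.+1)%MM.
  apply/eqP => /mnmP/(_ iT0); rewrite !mnmDE /T0m /T1m !mon5c.
  by have [-> _ -> _] := PQm_T d u q.+1.
have := @mpolyX_sub_neq0 _ K _ _ ne; rewrite !mpolyXD.
case/(cramer2 h2 h1) => c0 c1.
apply/rowP => k; rewrite [RHS]mxE -coord2E.
have := ltn_ord k; move: (nat_of_ord k) => j; rewrite size_F2 // => hj.
have [h|h] : (j < q.-1.*2)%N \/ (j = q.-1.*2 + false \/ j = q.-1.*2 + true)%N by lia.
  exact: h0.
by case: h => ->.
Qed.

Lemma exact_Phi3 (w : 'rV[S]_N) : w *m Phi2 = 0 <-> exists x : 'rV[S]_q.-1, w = x *m Phi3.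
Proof.
have h0 : Phi3 *m Phi2 = 0.
  by apply/row_matrixP => i; rewrite row_mul row_Phi3_Phi2 // row0.
split=> [hw|[x ->]]; last by rewrite -mulmxA h0 mulmx0.
have [x hx] := elim_all hw (leqnn _); exists x.
apply/eqP; rewrite -subr_eq0; apply/eqP; apply: elim_last hx.
by rewrite mulmxBl hw -mulmxA h0 mulmx0 subr0.
Qed.

(** Staircase induction: column 2i meets no later row, and row i has the monomial P_m there. *)
Lemma Phi3_inj (x : 'rV[S]_q.-1) : x *m Phi3 = 0 -> x = 0.
Proof.
move=> hx; apply/rowP => i; rewrite [RHS]mxE.
have [n hn] := ubnP (i : nat); elim: n => // n IH in i hn *.
have hi : (i.*2 + false < N)%N by rewrite size_F2 //; have := ltn_ord i; lia.
have : (x *m Phi3) 0 (Ordinal hi) = x 0 i * 'X_[Pm (mell i.+1)].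
  rewrite mxE (sum_only (i := i)); first by rewrite mxE /= phi3_0.
  move=> k /eqP ki; have kI : (k < i)%N \/ (i < k)%N.
    by apply/orP; rewrite -neq_ltn; apply/eqP => e; apply: ki; apply: val_inj.
  rewrite [Phi3 _ _]mxE; case: kI => h.
    by rewrite IH ?mul0r //; apply: leq_trans h _.
  rewrite phi3_lt ?mulr0 //=; lia.
rewrite hx mxE => /esym/eqP; rewrite mulf_eq0 (negPf (mpolyX_neq0 _ _)) orbF.
by move/eqP.
Qed.

End ExactPhi3.

(** * Bidegrees and minimality *)

Section Bihomogeneous.

Variable K : fieldType.
Local Notation S := {mpoly K[5]}.
Implicit Types (f g : S) (D : int * int).

Lemma pair_eq (D E : int * int) : D.1 = E.1 -> D.2 = E.2 -> D = E.
Proof. by case: D E => [? ?] [? ?] /= -> ->. Qed.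

Lemma bideg_monD m m' : bideg_mon (m + m') = bideg_mon m + bideg_mon m'.
Proof. by apply: pair_eq; rewrite /bideg_mon /= !mnmDE; lia. Qed.

Lemma bihomogP D f : bihomog D f <-> forall m, f@_m != 0 -> bideg_mon m = D.
Proof. by split=> h m hm; apply: h; move: hm; rewrite mcoeff_msupp. Qed.

Lemma bihomog0 D : bihomog D (0 : S).
Proof. by apply/bihomogP => m; rewrite mcoeff0 eqxx. Qed.

Lemma bihomogD D f g : bihomog D f -> bihomog D g -> bihomog D (f + g).
Proof.
move=> /bihomogP hf /bihomogP hg; apply/bihomogP => m; rewrite mcoeffD => h.
have [e|ne] := eqVneq f@_m 0; last exact: hf.
by apply: hg; rewrite e add0r in h.
Qed.

Lemma bihomogZ D (c : K) f : bihomog D f -> bihomog D (c *: f).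
Proof.
move=> /bihomogP hf; apply/bihomogP => m; rewrite mcoeffZ mulf_eq0 => /norP[_].
exact: hf.
Qed.

Lemma bihomogN D f : bihomog D f -> bihomog D (- f).
Proof. by rewrite -scaleN1r; apply: bihomogZ. Qed.

Lemma bihomogX m : bihomog (bideg_mon m) ('X_[m] : S).
Proof. by move=> m'; rewrite msuppX inE => /eqP ->. Qed.

Lemma bihomogM D E f g : bihomog D f -> bihomog E g -> bihomog (D + E) (f * g).
Proof.
move=> hf hg m /msuppM_le /allpairsP[[m1 m2] /= [h1 h2 ->]].
by rewrite bideg_monD (hf _ h1) (hg _ h2).
Qed.

Lemma bihomog_sum D n (F : 'I_n -> S) : (forall i, bihomog D (F i)) ->
  bihomog D (\sum_i F i).
Proof. by move=> h; apply: big_ind => //; [exact: bihomog0|exact: bihomogD]. Qed.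

Lemma bigraded_entries m n (delta : 'I_m -> int * int) (epsilon : 'I_n -> int * int)
  (A : 'M[S]_(m, n)) : (forall i j, bihomog (delta i - epsilon j) (A i j)) ->
  bigraded_mx delta epsilon A.
Proof.
move=> h D v hv j; rewrite mxE; apply: bihomog_sum => i.
have -> : D - epsilon j = (D - delta i) + (delta i - epsilon j) by rewrite subrKA.
exact: bihomogM.
Qed.

End Bihomogeneous.

Section Bigrading.

Variables (K : fieldType) (d u : nat).

Local Notation q := (qsum d u).
Local Notation b n := (st_b (sers d u n)).
Local Notation sg n := (st_sigma (sers d u n)).
Local Notation ta n := (st_tau (sers d u n)).
Local Notation Pm := (monoP d u).
Local Notation Qm := (monoQ d u).
Local Notation Lm := (leadF d u).
Local Notation Um := (tailF d u).
Local Notation mell := (mell d u).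
Local Notation rho := (rho d u).
Local Notation sA := (syzA d u).
Local Notation sB := (syzB d u).
Local Notation sC := (syzC d u).
Local Notation sv := (syz_pair d u K).
Local Notation S := {mpoly K[5]}.
Local Notation e_ := (e_ K d u).
Local Notation N := (size (F2_basis d u)).
Local Notation Phi1 := (Phi1_mx K d u).
Local Notation Phi2 := (Phi2_mx K d u).
Local Notation Phi3 := (Phi3_mx K d u).

Hypotheses (u_gt0 : (0 < u)%N) (u_lt : (2 * u < d)%N) (ud_coprime : coprime u d).

Lemma bideg_mon5 a a' x y z : bideg_mon (mon5 a a' x y z) = ((a + a')%N%:Z, (x + y + z)%N%:Z).
Proof. by rewrite /bideg_mon !mon5c. Qed.

Lemma bideg_PQm n : (0 < n)%N ->
  bideg_mon (Pm n) = (0, `|sg n - ta n|) /\ bideg_mon (Qm n) = (0, `|sg n - ta n|).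
Proof.
move=> n0; have h := sers_sign u_gt0 u_lt ud_coprime n0.
by rewrite /monoP /monoQ; case: leP => h1; rewrite !bideg_mon5;
  split; apply: pair_eq => //=; lia.
Qed.

Lemma bidegF_last : bidegF d u q.+2 = (0, d%:Z).
Proof. by rewrite /bidegF /b_ /sigma /tau eqxx /=; congr (_, _); lia. Qed.

Lemma bideg_LUm n : (0 < n)%N -> (n <= q.+2)%N ->
  bideg_mon (Lm n) = bidegF d u n /\ bideg_mon (Um n) = bidegF d u n.
Proof.
move=> n0; rewrite leq_eqVlt => /orP[/eqP->|nq].
  rewrite bidegF_last; have [-> ->] := PQm_end u_gt0 u_lt ud_coprime.
  by case: ifP => _; rewrite !bideg_mon5; split; congr (_, _); lia.
rewrite (Lm_lt nq) (Um_lt nq) !bideg_monD /T0m /T1m !bideg_mon5.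
have [-> ->] := bideg_PQm n0; rewrite /bidegF; have [-> -> ->] := sersE nq.
by split; apply: pair_eq => /=; lia.
Qed.

(* The bidegree of the basis element of F_2 whose image is the syzygy (n, x). *)
Definition bidegS n x : int * int := bideg_mon ((sA n x).1 + Lm (sA n x).2)%MM.

Lemma bideg_e2E n (x : bool) : (n < q)%N ->
  bideg_e2 d u (nth (0, 0)%N (F2_basis d u) (n.*2 + x)) = bidegS n.+1 x.
Proof.
move=> nq; rewrite nth_F2 // /bidegS /syzA.
have q0 : (0 < q)%N by lia.
case: (ltnP n.+1 q) => h /=; rewrite /bideg_e2 /=.
  rewrite h bideg_monD (proj1 (@bideg_LUm n.+1 isT _)); last by lia.
  have /andP[h1 h2] := mell_bounds u_gt0 u_lt ud_coprime (ltn0Sn n) (ltnW h).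
  have [/andP[h3 h4] _] := rho_bounds u_gt0 u_lt ud_coprime (ltn0Sn n) h.
  have m0 : (0 < mell n.+1)%N by lia.
  have r0 : (0 < rho n.+1)%N by lia.
  have [p1 p2] := bideg_PQm m0; have [p3 _] := bideg_PQm r0.
  have [p4 _] := @bideg_PQm n.+1 isT.
  have [e1 _] := PQm_rhombus u_gt0 u_lt ud_coprime (ltn0Sn n) h.
  have [_ -> ->] := sersE h4; rewrite e1 bideg_monD p4 p2 in p3.
  have {}p3 := congr1 snd p3; rewrite /= in p3; have hn : (n.+1 <= q.+1)%N by lia.
  rewrite /bidegF; have [-> -> ->] := sersE hn.
  by case: x; rewrite ?p1 ?p2; apply: pair_eq; rewrite /= -?p3; lia.
have [e1 e2] : n.+1 = q /\ (q < q.+2)%N by lia.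
have [_ hb _] := sers_q u_gt0 u_lt ud_coprime; have [hb1 _] := sers_q1 u_gt0 u_lt ud_coprime.
have hl := bideg_LUm (ltn0Sn q.+1) (leqnn _); rewrite bidegF_last Lm_last in hl.
case: x => /=; rewrite ?ltnn ?(ltnNge q.+1) ?leqnSn /= Lm_lt // ?hb ?hb1.
  have -> : (Qm q + (T0m 1 + Pm q.+1) = T0m 1 + (Qm q + Pm q.+1))%MM.
    by apply/mnmP => i; rewrite !mnmDE; lia.
  by rewrite bideg_monD (proj1 hl) /T0m bideg_mon5; apply: pair_eq => /=; lia.
have -> : (Pm q.+1 + (T0m 1 + Pm q) = T0m 1 + (Pm q + Pm q.+1))%MM.
  by apply/mnmP => i; rewrite !mnmDE; lia.
have [h1 h2] := bideg_PQm q0; move: (proj1 hl).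
rewrite !bideg_monD h1 h2 => ->; rewrite /T0m bideg_mon5.
by apply: pair_eq => /=; lia.
Qed.

(** Only n = q is not literal: its twist is (1, d) because b_q = 1 and rho(q) = q + 2 is the index
    of bidegree (0, d). *)
Lemma bideg_e2_twists :
  perm_eq [seq bideg_e2 d u nk | nk <- F2_basis d u] (F2_twists d u).
Proof.
suff -> : [seq bideg_e2 d u nk | nk <- F2_basis d u] = F2_twists d u by exact: perm_refl.
rewrite /F2_basis /F2_twists map_cat map_flatten -map_comp.
have e : q = (q.-1 + 1)%N by have := q_gt1 u_gt0 u_lt ud_coprime; lia.
rewrite [in RHS]e iotaD map_cat flatten_cat; congr (_ ++ _).
  congr flatten; apply/eq_in_map => n; rewrite mem_iota => /andP[n0 n1].
  by rewrite /= /bideg_e2 /=; have -> : (n < q)%N by lia.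
have e1 : (1 + q.-1)%N = q by lia.
rewrite e1 /= /bideg_e2 /= ltnn (ltnNge q.+1) leqnSn /= (rho_q u_gt0 u_lt ud_coprime).
have [_ hb _] := sers_q u_gt0 u_lt ud_coprime; have [-> _ _] := @sersE d u q (leqnSn q).
by have := congr1 snd bidegF_last; rewrite /= hb => ->.
Qed.

Lemma bihomog_bool D (f : S) (x : bool) : (x -> bihomog D f) -> bihomog D (f * x%:R).
Proof.
by case: x => h; rewrite ?mulr1 ?mulr0; [exact: h|exact: bihomog0].
Qed.

Lemma bihomogX_eq D m : bideg_mon m = D -> bihomog D ('X_[m] : S).
Proof. by move=> <-; exact: bihomogX. Qed.

Lemma Phi2_entry (k : 'I_N) (l : 'I_q.+2) : Phi2 k l = sv k./2.+1 (odd k) 0 l.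
Proof.
have hk : (k./2 < q)%N by have := ltn_ord k; rewrite [X in (_ < X)%N]size_F2 //; lia.
rewrite mxE -(@syz_sv d u u_gt0 u_lt ud_coprime K _ (odd k) hk) addnC odd_double_half.
exact: erefl.
Qed.

Lemma shift2E (k : 'I_N) : shift2 k = bidegS k./2.+1 (odd k).
Proof.
have hk : (k./2 < q)%N by have := ltn_ord k; rewrite [X in (_ < X)%N]size_F2 //; lia.
rewrite /shift2 -(bideg_e2E (odd k) hk) addnC odd_double_half; exact: erefl.
Qed.

(** Both monomials of each F_n have the same bidegree; A and B share a leading product, while A and
    C share a product through [sUE]. *)
Lemma bidegSE n x : (0 < n)%N -> (n <= q)%N ->
  [/\ bidegS n x = bideg_mon (sA n x).1 + bidegF d u (sA n x).2,
      bidegS n x = bideg_mon (sB n x).1 + bidegF d u (sB n x).2 &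
      bidegS n x = bideg_mon (sC n x).1 + bidegF d u (sC n x).2].
Proof.
move=> n0 nq.
have [/andP[a1 a2] /andP[b1 b2] /andP[c1 c2]] := sABC_idx u_gt0 u_lt ud_coprime x n0 nq.
have [la ua] := bideg_LUm a1 a2; have [lb ub] := bideg_LUm b1 b2.
have [lc uc] := bideg_LUm c1 c2.
have [e1 _] := sBE u_gt0 u_lt ud_coprime x n0 nq.
have [e2 _] := sUE u_gt0 u_lt ud_coprime x n0 nq.
split; first by rewrite /bidegS bideg_monD la.
  by rewrite /bidegS e1 bideg_monD lb.
rewrite /bidegS bideg_monD la -ua -bideg_monD e2 bideg_monD.
by case: ifP; rewrite ?lc ?uc.
Qed.

Lemma Phi1_bigraded : bigraded_mx (@shift1 d u) (fun=> (0, 0)) Phi1.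
Proof.
apply: bigraded_entries => i j.
rewrite mxE (Fpol_binom K u_gt0 u_lt ud_coprime (ltn0Sn i) (ltn_ord i)).
have [h1 h2] := bideg_LUm (ltn0Sn i) (ltn_ord i).
have -> : shift1 i - (0, 0) = bidegF d u i.+1 by rewrite subr0.
apply: bihomogD; first exact: bihomogX_eq.
by apply/bihomogN/bihomogX_eq.
Qed.

Lemma Phi2_bigraded : bigraded_mx (@shift2 d u) (@shift1 d u) Phi2.
Proof.
apply: bigraded_entries => k l; rewrite Phi2_entry shift2E.
have hk : (k./2 < q)%N by have := ltn_ord k; rewrite [X in (_ < X)%N]size_F2 //; lia.
rewrite /syz_pair trivec_entry /shift1.
have [h1 h2 h3] := bidegSE (odd k) (ltn0Sn k./2) hk.
apply: bihomogD; first apply: bihomogD.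
- by apply: bihomog_bool => /eqP e; apply: bihomogX_eq; rewrite h1 e addrK.
- by apply/bihomogN/bihomog_bool => /eqP e; apply: bihomogX_eq; rewrite h2 e addrK.
- by apply: bihomog_bool => /eqP e; apply/bihomogZ/bihomogX_eq; rewrite h3 e addrK.
Qed.

Lemma bideg_T0P n : (0 < n)%N -> (n <= q.+1)%N ->
  bideg_mon (T0m (b n)) + bideg_mon (Pm n) = bidegF d u n /\
  bideg_mon (T1m (b n)) + bideg_mon (Qm n) = bidegF d u n.
Proof.
move=> n0 nq; rewrite -!bideg_monD -(Lm_lt (n := n)) // -(Um_lt (n := n)) //.
exact: (bideg_LUm n0 (leqW nq)).
Qed.

Lemma bideg_next n (x : bool) : (0 < n)%N -> (n <= q)%N ->
  bideg_mon (if (n < q)%N then if x then T0m (b (mell n)) else T1m (b (mell n))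
             else if x then T1m 1 else T0m 1) + bidegS n x =
  bidegF d u (mell n) + bidegF d u n.
Proof.
move=> n0 nq; have [-> _ _] := bidegSE x n0 nq; rewrite /syzA.
have /andP[h1 h2] := mell_bounds u_gt0 u_lt ud_coprime n0 nq.
have m0 : (0 < mell n)%N by lia.
case: (ltnP n q) => h.
  have [p1 p2] := bideg_T0P m0 h2.
  by case: x => /=; rewrite addrA ?p1 ?p2.
have {h h1 h2 m0} -> : n = q by lia.
have [-> hb _] := sers_q u_gt0 u_lt ud_coprime; have [hb1 _] := sers_q1 u_gt0 u_lt ud_coprime.
have [p1 p2] := bideg_T0P (ltn0Sn q) (leqnn _).
have [p3 p4] := bideg_T0P (leq_trans n0 nq) (leqnSn q).
rewrite hb1 in p1 p2; rewrite hb in p3 p4.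
by case: x => /=; rewrite addrA ?p4 ?p1 // addrC.
Qed.

Lemma bideg_pair n : (0 < n)%N -> (n < q)%N ->
  bideg_mon (Pm (mell n)) + bidegS n false = bidegF d u (mell n) + bidegF d u (rho n) /\
  bideg_mon (Qm (mell n)) + bidegS n true = bidegF d u (mell n) + bidegF d u (rho n).
Proof.
move=> n0 nq; have [-> _ _] := bidegSE false n0 (ltnW nq); have [-> _ _] := bidegSE true n0 (ltnW nq).
rewrite /syzA nq /=.
have /andP[h1 h2] := mell_bounds u_gt0 u_lt ud_coprime n0 (ltnW nq).
have [/andP[h3 h4] _] := rho_bounds u_gt0 u_lt ud_coprime n0 nq.
have m0 : (0 < mell n)%N by lia.
have r0 : (0 < rho n)%N by lia.
have [f1 _] := bideg_T0P m0 h2; have [f2 _] := bideg_T0P r0 h4.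
have [f3 _] := bideg_T0P n0 (leqW (ltnW nq)).
have [e1 _] := PQm_rhombus u_gt0 u_lt ud_coprime n0 nq.
have [p1 p2] := bideg_PQm m0.
rewrite -f1 -f2 -f3 e1 (b_rhombus u_gt0 u_lt ud_coprime n0 nq) bideg_monD p1 p2.
by rewrite /T0m !bideg_mon5; split; apply: pair_eq => /=; lia.
Qed.

(** The bidegree of F_{m(n)} F_{rho(n)} for n = i + 1, as this row of Phi_3 comes from the Koszul
    syzygy of the two binomials. *)
Definition shift3 (i : 'I_q.-1) : int * int :=
  bidegF d u (mell i.+1) + bidegF d u (rho i.+1).

(** One case analysis for two uses: an entry is zero or a scalar times a nonconstant monomial of the
    right bidegree, which yields both the bigrading and the minimality of Phi_3. *)
Lemma phi3_cases (f : S -> int * int -> Prop) (i : 'I_q.-1) (j : 'I_N) :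
  (forall D, f 0 D) ->
  (forall m D, bideg_mon m + D = shift3 i -> m != 0%MM -> f 'X_[m] D /\
    forall c : K, f (c *: 'X_[m]) D) -> f (Phi3 i j) (shift2 j).
Proof.
move=> f0 fX; have i1q : (i.+1 < q)%N by have := ltn_ord i; lia.
rewrite mxE shift2E; move: (nat_of_ord j) => k.
have m_neq0 n : (0 < n)%N -> Pm n != 0%MM /\ Qm n != 0%MM.
  move=> n0; have [|||h1 h2] := @PQm_X_gt0 d u u_gt0 u_lt ud_coprime n 0%MM n0; rewrite ?mnm0E //.
  by split; [apply: contra h1|apply: contra h2] => /eqP ->; exact: lepm_refl.
have T_neq0 n : (0 < n)%N -> T0m n != 0%MM /\ T1m n != 0%MM.
  by move=> n0; split; apply/eqP => /mnmP h; [have := h iT0|have := h iT1];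
    rewrite mnm0E /T0m /T1m mon5c; lia.
have /andP[h1 h2] := mell_bounds u_gt0 u_lt ud_coprime (ltn0Sn i) (ltnW i1q).
have /andP[h3 h4] := mell_bounds u_gt0 u_lt ud_coprime (ltn0Sn i.+1) i1q.
have m0 : (0 < mell i.+1)%N by lia.
have m1 : (0 < mell i.+2)%N by lia.
have bm := b_gt0 u_gt0 u_lt ud_coprime m1 h4.
have e : (k = k./2.*2 + odd k)%N by rewrite addnC odd_double_half.
rewrite {1}e; move: (k./2) (odd k) => n x {e k}.
have [hn|hn] : ((n < i) \/ (i.+1 < n) \/ (n = i :> nat \/ n = i.+1))%N by lia.
  rewrite phi3_lt; [exact: f0|lia].
case: hn => [hn|[->|->]].
- rewrite phi3_gt; [exact: f0|lia].
- have [p1 p2] := bideg_pair (ltn0Sn i) i1q; have [n1 n2] := m_neq0 _ m0.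
  case: x; last by rewrite phi3_0; exact: (fX _ _ p1 n1).1.
  by rewrite phi3_1 -scaleN1r; exact: (fX _ _ p2 n2).2.
have hs : bidegF d u (mell i.+2) + bidegF d u i.+2 = shift3 i.
  rewrite /shift3; have [[-> [-> _]]|[-> ->]] := mell_rho_next u_gt0 u_lt ud_coprime (ltn0Sn i) i1q => //.
  by rewrite addrC.
have [t1 t2] := T_neq0 _ bm; have [t3 t4] := T_neq0 1%N isT.
have := bideg_next x (ltn0Sn i.+1) i1q; rewrite hs.
case: x; rewrite ?phi3_2 ?phi3_3; case: (i.+2 < q)%N => hD.
- exact: (fX _ _ hD t1).2.
- exact: (fX _ _ hD t4).2.
- by rewrite scalerN -scaleNr; exact: (fX _ _ hD t2).2.
- exact: (fX _ _ hD t3).2.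
Qed.

Lemma Phi3_bigraded : bigraded_mx shift3 (@shift2 d u) Phi3.
Proof.
apply: bigraded_entries => i j.
apply: (phi3_cases (f := fun p D => bihomog (shift3 i - D) p)).
  by move=> D; exact: bihomog0.
move=> m D e _; have h : bideg_mon m = shift3 i - D by rewrite -e addrK.
by split=> [|c]; [|apply: bihomogZ]; exact: bihomogX_eq.
Qed.

Lemma Phi3_minimal : minimal_mx Phi3.
Proof.
move=> i j; apply: (phi3_cases (f := fun p _ => p@_0%MM = 0)).
  by move=> _; rewrite mcoeff0.
move=> m _ _ /negPf h; split=> [|c]; rewrite ?mcoeffZ mcoeffX h //.
by rewrite mulr0.
Qed.

End Bigrading.

Section MinimalPhi.

Variables (K : fieldType) (d u : nat).
Local Notation q := (qsum d u).
Hypotheses (u_gt0 : (0 < u)%N) (u_lt : (2 * u < d)%N) (ud_coprime : coprime u d).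

Lemma bidegF_neq0 n : (0 < n)%N -> (n <= q.+2)%N -> bidegF d u n != 0.
Proof.
move=> n0; rewrite leq_eqVlt => /orP[/eqP->|nq].
  by rewrite (bidegF_last u_gt0 u_lt ud_coprime); apply/eqP => /(congr1 snd) /=; lia.
rewrite /bidegF; have [-> _ _] := sersE nq.
by apply/eqP => /(congr1 fst) /=; have := b_gt0 u_gt0 u_lt ud_coprime n0 nq; lia.
Qed.

Lemma Phi1_minimal : minimal_mx (Phi1_mx K d u).
Proof.
move=> i j; rewrite mxE (Fpol_binom K u_gt0 u_lt ud_coprime (ltn0Sn i) (ltn_ord i)).
have [h1 h2] := bideg_LUm u_gt0 u_lt ud_coprime (ltn0Sn i) (ltn_ord i).
have h := bidegF_neq0 (ltn0Sn i) (ltn_ord i).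
have b0 : bideg_mon 0 = 0 by rewrite /bideg_mon !mnm0E.
have -> : 'X_[leadF d u i.+1] - 'X_[tailF d u i.+1] = 'X_[leadF d u i.+1] + (- 1) *: 'X_[tailF d u i.+1] :> {mpoly K[5]}.
  by rewrite scaleN1r.
rewrite mcoeffD mcoeffZ !mcoeffX.
have -> : (leadF d u i.+1 == 0%MM) = false.
  by apply/eqP => e; rewrite -h1 e b0 eqxx in h.
have -> : (tailF d u i.+1 == 0%MM) = false.
  by apply/eqP => e; rewrite -h2 e b0 eqxx in h.
by rewrite mulr0 addr0.
Qed.

Lemma sABC_neq0 n x : (0 < n)%N -> (n <= q)%N ->
  [/\ (syzA d u n x).1 != 0%MM, (syzB d u n x).1 != 0%MM & (syzC d u n x).1 != 0%MM].
Proof.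
move=> n0 nq; have P_neq0 k : (0 < k)%N -> monoP d u k != 0%MM /\ monoQ d u k != 0%MM.
  move=> k0; have [|||h1 h2] := @PQm_X_gt0 d u u_gt0 u_lt ud_coprime k 0%MM k0; rewrite ?mnm0E //.
  by split; [apply: contra h1|apply: contra h2] => /eqP ->; exact: lepm_refl.
have T_neq0 k (m : 'X_{1..5}) : (0 < k)%N -> (T0m k + m)%MM != 0%MM /\ (T1m k + m)%MM != 0%MM.
  by move=> k0; split; apply/eqP => /mnmP h; [have := h iT0|have := h iT1];
    rewrite mnm0E mnmDE /T0m /T1m mon5c; lia.
have T_neq0' k : (0 < k)%N -> T0m k != 0%MM /\ T1m k != 0%MM.
  by move=> /(T_neq0 k 0%MM); rewrite !addm0.
rewrite /syzA /syzB /syzC; case: (ltnP n q) => h; last first.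
  have [p1 p2] := P_neq0 q (leq_trans n0 nq); have [p3 p4] := P_neq0 q.+1 isT.
  have [t1 t2] := T_neq0' 1%N isT.
  by case: x.
have /andP[h1 h2] := mell_bounds u_gt0 u_lt ud_coprime n0 nq.
have [/andP[h3 h4] _] := rho_bounds u_gt0 u_lt ud_coprime n0 h.
have m0 : (0 < mell d u n)%N by lia.
have r0 : (0 < rho d u n)%N by lia.
have [p1 p2] := P_neq0 _ m0.
have bm := b_gt0 u_gt0 u_lt ud_coprime m0 h2; have br := b_gt0 u_gt0 u_lt ud_coprime r0 h4.
have [t1 t2] := T_neq0' _ bm; have [t3 _] := T_neq0 _ (monoP d u n) br.
have [_ t4] := T_neq0 _ (monoQ d u n) br.
by case: x.
Qed.

Lemma Phi2_minimal : minimal_mx (Phi2_mx K d u).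
Proof.
move=> k l; rewrite Phi2_entry //.
have hk : (k./2 < q)%N by have := ltn_ord k; rewrite [X in (_ < X)%N]size_F2 //; lia.
have [h1 h2 h3] := sABC_neq0 (odd k) (ltn0Sn k./2) hk.
apply/eqP/negPn/negP => h.
have := @sv_supp K d u k./2.+1 (odd k) (0%MM, l) h.
by case=> e; [move: h1|move: h2|move: h3]; rewrite -e eqxx.
Qed.

End MinimalPhi.

(** * The kernel and the image of Phi_0 *)

Section Toric.

Variables (d u : nat).
Local Notation q := (qsum d u).
Local Notation b n := (st_b (sers d u n)).
Local Notation sg n := (st_sigma (sers d u n)).
Local Notation ta n := (st_tau (sers d u n)).

Definition mon2 (x y : nat) : 'X_{1..2} := [multinom tnth [tuple x; y] i | i < 2].

(* The image under Phi_0 of the monomial m is T^(toric_exp m) Z^(toricZ m). *)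
Definition toric_exp (m : 'X_{1..5}) : 'X_{1..2} :=
  mon2 (m iT0 + d * m iX0 + (d - u) * m iX1) (m iT1 + u * m iX1 + d * m iX2).

Definition toricZ (m : 'X_{1..5}) : nat := (m iX0 + m iX1 + m iX2)%N.

Lemma mon2_inj x y x' y' : mon2 x y = mon2 x' y' -> x = x' /\ y = y'.
Proof.
move=> /mnmP h; have := h (@Ordinal 2 0 isT); have := h (@Ordinal 2 1 isT).
by rewrite !mnmE !(tnth_nth 0%N).
Qed.

Hypotheses (u_gt0 : (0 < u)%N) (u_lt : (2 * u < d)%N) (ud_coprime : coprime u d).

(** For n <= q + 1 both exponents of T balance by the single identity of [sers_lin], rewritten with
    absolute values to stay in natural numbers. *)
Lemma toric_LUm n : (0 < n)%N -> (n <= q.+2)%N ->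
  toric_exp (leadF d u n) = toric_exp (tailF d u n) /\ toricZ (leadF d u n) = toricZ (tailF d u n).
Proof.
move=> n0; rewrite leq_eqVlt => /orP[/eqP->|nq].
  have [-> ->] := PQm_end u_gt0 u_lt ud_coprime; rewrite /toric_exp /toricZ.
  have [k ek] : exists k, d = (u + k)%N by exists (d - u)%N; lia.
  by case: ifP => _; rewrite !mon5c; split; try (by lia); rewrite ek addKn; congr mon2; ring.
have [h _] := sers_lin u_gt0 u_lt ud_coprime n0 nq.
have hs := sers_sign u_gt0 u_lt ud_coprime n0.
rewrite (Lm_lt nq) (Um_lt nq) /T0m /T1m /toric_exp /toricZ /monoP /monoQ.
have [k ek] : exists k, d = (u + k)%N by exists (d - u)%N; lia.
have ekk : (d - u)%N = k by lia.
case: leP => h1; rewrite !mnmDE !mon5c ekk.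
  have [s [es [t [et ets]]]] : exists s, `|sg n|%N = s /\ exists t, `|ta n|%N = t /\
      `|(sg n - ta n)%R|%N = (s + t)%N by exists `|sg n|%N; split=> //; exists `|ta n|%N; lia.
  have hb : (b n + u * s = k * t)%N.
    have e1 : sg n = - s%:Z by lia.
    have e2 : ta n = t%:Z by lia.
    by move: h; rewrite e1 e2 ek => h; nia.
  by rewrite es et ets; move: (b n) hb => B hb; rewrite ek; split; [congr mon2; lia|lia].
have [s [es [t [et ets]]]] : exists s, `|sg n|%N = s /\ exists t, `|ta n|%N = t /\
    `|(sg n - ta n)%R|%N = (s + t)%N by exists `|sg n|%N; split=> //; exists `|ta n|%N; lia.
have hb : (b n + k * t = u * s)%N.
  have e1 : sg n = s%:Z by lia.
  have e2 : ta n = - t%:Z by lia.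
  by move: h; rewrite e1 e2 ek => h; nia.
by rewrite es et ets; move: (b n) hb => B hb; rewrite ek; split; [congr mon2; lia|lia].
Qed.

(** Monomials with equal image differ by exponents -s, s - t, t at X_0, X_1, X_2 and by the value u
    s + (d - u) t at T_0, its negative at T_1. The order makes this value nonnegative. If it is
    positive, some L_n with n <= q + 1 works; if it is zero, L_{q+2} does. *)
Lemma toric_Lm_dvd (m m' : 'X_{1..5}) : toric_exp m = toric_exp m' -> toricZ m = toricZ m' ->
  prec_l d u m' m -> exists n, [/\ (0 < n)%N, (n <= q.+2)%N & (leadF d u n <= m)%MM].
Proof.
move=> /mon2_inj [h0 h1] hz hp; rewrite /toricZ in hz.
have ud : (u <= d)%N by lia.
pose s : int := (m' iX0)%:Z - (m iX0)%:Z; pose t : int := (m iX2)%:Z - (m' iX2)%:Z.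
have ex1 : (m iX1)%:Z - (m' iX1)%:Z = s - t by rewrite /s /t; lia.
have e0 : (m iT0)%:Z - (m' iT0)%:Z = u%:Z * s + (d%:Z - u%:Z) * t.
  transitivity (d%:Z * s - (d%:Z - u%:Z) * (s - t)); last by ring.
  rewrite -ex1 /s; have := congr1 Posz h0; rewrite !PoszD !PoszM -!subzn // => h; lia.
have e1 : (m iT1)%:Z - (m' iT1)%:Z = - (u%:Z * s + (d%:Z - u%:Z) * t).
  transitivity (- (u%:Z * (s - t) + d%:Z * t)); last by ring.
  rewrite -ex1 /t; have := congr1 Posz h1; rewrite !PoszD !PoszM => h; lia.
have hT0 : (m' iT0 <= m iT0)%N by move: hp; rewrite prec_lE /=; lia.
have div0 j : (j <= q.+1)%N -> (b j)%:Z <= u%:Z * s + (d%:Z - u%:Z) * t -> (0 < j)%N ->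
    (sg j <= 0 /\ s <= sg j /\ ta j <= t) \/ (0 < sg j /\ sg j <= s /\ t <= ta j) ->
    (leadF d u j <= m)%MM.
  move=> jq hb j0 hst; have hj := sers_sign u_gt0 u_lt ud_coprime j0.
  rewrite (Lm_lt (jq : (j < q.+2)%N)) mon5_le !mnmDE /T0m /monoP.
  by case: leP => h2; rewrite !mon5c; rewrite /s /t in hst ex1 e0 hb; lia.
have [hb|hb] : 0 < u%:Z * s + (d%:Z - u%:Z) * t \/ u%:Z * s + (d%:Z - u%:Z) * t = 0 by lia.
  have e2 : u%:Z * s + (d%:Z - u%:Z) * t = t * (d - u)%N%:Z + s * u%:Z.
    by rewrite -subzn //; ring.
  have [hst|[[s0 t0]|[s0 t0]]] : ((0 < t /\ s <= 0) \/ (t <= 0 /\ 0 < s)) \/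
      (0 < s /\ 0 < t \/ s <= 0 /\ t <= 0) by lia.
  (* The first two vectors are (0, 1) and (1, 0), with values d - u and u, so (s, t) has
     coefficients t and s in them. *)
  - have := @sers_approx d u u_gt0 u_lt ud_coprime t s 1 isT isT; rewrite sers1 /= !mulr0 !mulr1 addr0 add0r -e2.
    case=> // j [j0 jq hbj hj]; exists j; split=> //; first exact: leqW.
    by apply: div0 => //; lia.
  - exists 1%N; split=> //; rewrite Lm_lt // mon5_le !mnmDE /T0m /monoP sers1 /= !mon5c.
    have h3 : 0 <= u%:Z * s by apply: mulr_ge0; lia.
    have h4 : d%:Z - u%:Z <= (d%:Z - u%:Z) * t by rewrite ler_peMr; lia.
    by rewrite /t in t0 h4 e0; lia.
  - have h3 : u%:Z * s <= 0 by apply: mulr_ge0_le0; lia.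
    have h4 : (d%:Z - u%:Z) * t <= 0 by apply: mulr_ge0_le0; lia.
    by lia.
exists q.+2; split=> //; have [-> _] := PQm_end u_gt0 u_lt ud_coprime.
(* A zero value and coprimality of u and d - u make (s, t) an integer multiple -k of (d - u, -u). *)
have hdiv : (u%:Z %| t)%Z.
  have hcop : coprimez u%:Z (d%:Z - u%:Z).
    rewrite subzn // /coprimez /gcdz !absz_nat eqz_nat.
    by move: ud_coprime; rewrite /coprime -{1}(subnK ud) gcdnDr.
  rewrite -(Gauss_dvdzr t hcop); apply/dvdzP; exists (- s).
  by rewrite mulNr mulrC; lia.
case/dvdzP: hdiv => k ek.
have es : s = - ((d%:Z - u%:Z) * k).
  have : u%:Z * (s + (d%:Z - u%:Z) * k) = 0 by rewrite mulrDr -hb ek; ring.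
  by move/eqP; rewrite mulf_eq0 => /orP[/eqP|/eqP]; lia.
rewrite hb oppr0 in e0 e1.
have ek1 : s - t = - (d%:Z * k) by rewrite es ek; ring.
(* The T-exponents agree, so X_0 decides the order if sigma_q > 0, and X_1 otherwise. This fixes the
   sign of k, and L_{q+2} divides m. *)
rewrite mon5_le; move: hp; rewrite prec_lE /=; have [_ -> _] := sersE (leqnSn q).
rewrite /s in es; rewrite /t in ek; rewrite ek1 in ex1.
case: ifP => h2 hp; rewrite !mon5c.
  have k0 : 0 < k by nia.
  by apply/and5P; split; nia.
have k0 : k < 0 by nia.
by apply/and5P; split; nia.
Qed.

End Toric.

Lemma prod5 (R : pzSemiRingType) (F : 'I_5 -> R) :
  \prod_i F i = F iT0 * F iT1 * F iX0 * F iX1 * F iX2.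
Proof.
rewrite !big_ord_recl big_ord0 mulr1 !mulrA.
have e0 : ord0 = iT0 by apply/val_inj.
have e1 : lift ord0 ord0 = iT1 by apply/val_inj.
have e2 : lift ord0 (lift ord0 ord0) = iX0 by apply/val_inj.
have e3 : lift ord0 (lift ord0 (lift ord0 ord0)) = iX1 by apply/val_inj.
have e4 : lift ord0 (lift ord0 (lift ord0 (lift ord0 ord0))) = iX2 by apply/val_inj.
by rewrite e4 e3 e2 e1 e0.
Qed.

Lemma toric_monomial (R : comNzRingType) (x y : R) (a b i j k d e u : nat) :
  x%:P ^+ a * y%:P ^+ b * ('X * (x ^+ d)%:P) ^+ i * ('X * (x ^+ e * y ^+ u)%:P) ^+ j
    * ('X * (y ^+ d)%:P) ^+ k =
  (x ^+ (a + d * i + e * j) * y ^+ (b + u * j + d * k))%:P * 'X^(i + j + k).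
Proof.
rewrite !polyCM !polyC_exp !exprD !exprM !exprMn -!exprM.
rewrite ![(_ * i)%N]mulnC ![(_ * j)%N]mulnC ![(_ * k)%N]mulnC !exprM.
by ring.
Qed.

Lemma polyC_mulXnD (R : nzRingType) (x y : R) n :
  x%:P * 'X^n + y%:P * 'X^n = (x + y)%:P * 'X^n.
Proof. by rewrite polyCD mulrDl. Qed.

Lemma polyC_mulXnM (R : comNzRingType) (x y : R) n :
  x%:P * (y%:P * 'X^n) = (x * y)%:P * 'X^n.
Proof. by rewrite polyCM mulrA. Qed.

Lemma polyC_mulXnS (R : comNzRingType) (x y : R) n :
  (x%:P * 'X^n) * ('X * y%:P) = (x * y)%:P * 'X^(n.+1).
Proof. by rewrite polyCM exprS; ring. Qed.

(** * The image of Phi_0 is the Rees algebra *)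

Section ReesAlgebra.

Variables (K : fieldType) (d u : nat).
Local Notation S := {mpoly K[5]}.
Local Notation R := {mpoly K[2]}.
Local Notation Phi0 := (@Phi0 K d u).
Local Notation toricT := (toric_exp d u).
Local Notation rT0 := (rT0 K).
Local Notation rT1 := (rT1 K).
Local Notation I := (@idealI K d u).

Lemma mpolyX_mon2 x y : 'X_[mon2 x y] = rT0 ^+ x * rT1 ^+ y :> R.
Proof.
rewrite mpolyXE_id !big_ord_recl big_ord0 mulr1 !mnmE !(tnth_nth 0%N) /=.
have -> : lift ord0 ord0 = @Ordinal 2 1 isT by apply/val_inj.
by have -> : ord0 = @Ordinal 2 0 isT by apply/val_inj.
Qed.

Lemma Phi0D f g : Phi0 (f + g) = Phi0 f + Phi0 g.
Proof. exact: raddfD. Qed.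

Lemma Phi0B f g : Phi0 (f - g) = Phi0 f - Phi0 g.
Proof. exact: raddfB. Qed.

Lemma Phi00 : Phi0 0 = 0.
Proof. exact: raddf0. Qed.

Lemma Phi0_sum (J : Type) (r : seq J) (F : J -> S) :
  Phi0 (\sum_(j <- r) F j) = \sum_(j <- r) Phi0 (F j).
Proof. exact: raddf_sum. Qed.

Lemma Phi0Z c f : Phi0 (c *: f) = (c%:MP)%:P * Phi0 f.
Proof. exact: mmapZ. Qed.

Lemma Phi0M f g : Phi0 (f * g) = Phi0 f * Phi0 g.
Proof. by rewrite /Defs.Phi0 rmorphM. Qed.

Lemma Phi0X m : Phi0 'X_[m] = ('X_[toricT m])%:P * 'X^(toricZ m).
Proof.
apply: etrans (mmapX _ _ _) _; apply: etrans (prod5 _) _.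
rewrite /toricZ /toric_exp mpolyX_mon2 -toric_monomial.
by rewrite /Phi0_var !(tnth_nth 0).
Qed.

Lemma Phi0_coef f k M : ((Phi0 f)`_k)@_M =
  \sum_(m <- msupp f | (toricZ m == k) && (toricT m == M)) f@_m.
Proof.
rewrite {1}[f]mpolyE Phi0_sum coef_sum raddf_sum /= [RHS]big_mkcond /=.
apply: eq_bigr => m _; rewrite Phi0Z Phi0X mulrA -polyCM coefCM coefXn.
rewrite eq_sym mul_mpolyC; case: eqP => _ /=; last by rewrite mulr0 mcoeff0.
by rewrite mulr1 mcoeffZ mcoeffX; case: eqP => _; rewrite ?mulr1 ?mulr0.
Qed.

Lemma Phi0_bigraded D (p : S) : (u <= d)%N -> bihomog D p -> bihomog_RZ d D (Phi0 p).
Proof.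
move=> ud hp n M; rewrite mcoeff_msupp Phi0_coef => h.
have [m hm] : exists2 m, m \in msupp p & (toricZ m == n) && (toricT m == M).
  apply/hasP; apply: contraNT h => /hasPn h; rewrite big_seq_cond big_pred0 // => m.
  by apply/negbTE/negP => /andP[/h/negP].
case/andP=> /eqP <- /eqP <-; rewrite -(hp _ hm) /bideg_mon /toricZ.
congr (_, _); rewrite mdegE !big_ord_recl big_ord0 !mnmE !(tnth_nth 0%N) /=.
have [k ->] : exists k, d = (u + k)%N by exists (d - u)%N; lia.
by rewrite addKn; lia.
Qed.

Lemma ideal_pow_gen n x : ideal_pow I n.+1 x ->
  @submod_gen R R^o (fun x => exists y z, [/\ ideal_pow I n y, I z & x = y * z]) x.
Proof. by []. Qed.

Lemma ideal_pow0 n : ideal_pow I n 0.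
Proof. by case: n => // n; exact: submod_gen0. Qed.

Lemma ideal_powD n x y : ideal_pow I n x -> ideal_pow I n y -> ideal_pow I n (x + y).
Proof. by case: n => // n; exact: submod_genD. Qed.

Lemma ideal_powZ n (c x : R) : ideal_pow I n x -> ideal_pow I n (c * x).
Proof. by case: n => // n h; apply: (submod_genZ (V := R^o) c h). Qed.

Lemma ideal_pow_exp n x g j : I g -> ideal_pow I n x -> ideal_pow I (n + j) (x * g ^+ j).
Proof.
move=> hg hx; elim: j => [|j IH]; first by rewrite addn0 mulr1.
rewrite addnS exprSr mulrA; apply: (@submod_gen_id R R^o).
by exists (x * g ^+ j), g.
Qed.

Lemma idealI_gens : [/\ I (rT0 ^+ d), I (rT0 ^+ (d - u) * rT1 ^+ u) & I (rT1 ^+ d)].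
Proof. by split; apply: (@submod_gen_id R R^o); [exact: Or31|exact: Or32|exact: Or33]. Qed.

Lemma toric_ideal_pow m : ideal_pow I (toricZ m) ('X_[toricT m] : R).
Proof.
have [h0 h1 h2] := idealI_gens.
have h : ideal_pow I 0 (rT0 ^+ m iT0 * rT1 ^+ m iT1) by [].
have := ideal_pow_exp (m iX2) h2 (ideal_pow_exp (m iX1) h1 (ideal_pow_exp (m iX0) h0 h)).
rewrite add0n -/(toricZ m) => h3.
have -> : 'X_[toricT m] = rT0 ^+ m iT0 * rT1 ^+ m iT1 * (rT0 ^+ d) ^+ m iX0 *
   (rT0 ^+ (d - u) * rT1 ^+ u) ^+ m iX1 * (rT1 ^+ d) ^+ m iX2 :> R; last exact: h3.
rewrite /toric_exp mpolyX_mon2 !exprD !exprM exprMn.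
by ring.
Qed.

Lemma Phi0_in_rees p : in_rees d u (Phi0 p).
Proof.
move=> n; rewrite [p]mpolyE Phi0_sum coef_sum.
apply: (big_ind (ideal_pow I n)); [exact: ideal_pow0|exact: ideal_powD|] => m _.
rewrite Phi0Z Phi0X mulrA -polyCM coefCM coefXn; case: eqP => [->|_].
  by rewrite mulr1; apply: ideal_powZ; exact: toric_ideal_pow.
by rewrite mulr0; exact: ideal_pow0.
Qed.

Definition liftR (r : R) : S :=
  \sum_(M <- msupp r) r@_M *: 'X_[mon5 (M (@Ordinal 2 0 isT)) (M (@Ordinal 2 1 isT)) 0 0 0].

Lemma Phi0_liftR r : Phi0 (liftR r) = r%:P.
Proof.
rewrite /liftR Phi0_sum [in RHS](mpolyE r) raddf_sum /=; apply: eq_bigr => M _.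
rewrite Phi0Z Phi0X /toricZ /toric_exp !mon5c expr0 mulr1 !muln0 !addn0 -polyCM mul_mpolyC.
congr (_ *: 'X_[_])%:P; apply/mnmP => -[[|[|i]] hi] //; rewrite !mnmE (tnth_nth 0%N) /=;
  by congr (M _); apply: val_inj.
Qed.

(** The y for which y Z^n lifts form an R-submodule, by [liftR], so products y' z suffice. For fixed
    y' the same holds in z, leaving the three generators, whose multiples by Z are the images of
    X_0, X_1, X_2. *)
Lemma ideal_pow_Phi0 n y : ideal_pow I n y -> exists p, Phi0 p = y%:P * 'X^n.
Proof.
elim: n y => [|n IH] y; first by exists (liftR y); rewrite Phi0_liftR mulr1.
pose good k (y : R^o) := exists p, Phi0 p = (y : R)%:P * 'X^k.
have good0 k : good k 0 by exists 0; rewrite Phi00 mul0r.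
have goodD k v w : good k v -> good k w -> good k (v + w).
  by move=> [p hp] [p' hp']; exists (p + p'); rewrite Phi0D hp hp'; exact: polyC_mulXnD.
have goodZ k (c : R) v : good k v -> good k (c *: v).
  by move=> [p hp]; exists (liftR c * p); rewrite Phi0M Phi0_liftR hp; exact: polyC_mulXnM.
move/ideal_pow_gen; apply: (submod_gen_min (V := R^o) (N := good n.+1) (good0 _)
  (@goodD _) (@goodZ _)).
move=> _ [y' [z [hy' hz ->]]]; have [p hp] := IH _ hy'.
have goodE k (v w : R) : v = w -> good k v -> good k w by move=> ->.
have key (j : 'I_5) (g : R) : Phi0 'X_j = 'X * g%:P -> good n.+1 (y' * g).
  by move=> hj; exists (p * 'X_j); rewrite Phi0M hp hj; exact: polyC_mulXnS.
pose good' (z : R^o) := good n.+1 (y' * z).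
apply: (submod_gen_min (V := R^o) (N := good')) hz.
- exact: (goodE _ _ _ (esym (mulr0 y')) (good0 _)).
- by move=> v w hv hw; exact: (goodE _ _ _ (esym (mulrDr y' v w)) (goodD _ _ _ hv hw)).
- by move=> c v hv; exact: (goodE _ _ _ (mulrCA c y' v) (goodZ _ c _ hv)).
have hvar j : Phi0 'X_j = Phi0_var K d u j by exact: etrans (mmapX _ _ _) (mmap1U _ _).
by move=> v [->|->|->]; [apply: (key iX0)|apply: (key iX1)|apply: (key iX2)];
  rewrite hvar /Phi0_var (tnth_nth 0).
Qed.

Lemma in_reesP f : in_rees d u f <-> exists p, f = Phi0 p.
Proof.
split=> [h|[p ->]]; last exact: Phi0_in_rees.
rewrite -[f]coefK poly_def.
apply: (big_ind (fun g => exists p, g = Phi0 p)).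
- by exists 0; rewrite Phi00.
- by move=> _ _ [p ->] [p' ->]; exists (p + p'); rewrite Phi0D.
- by move=> i _; have [p hp] := ideal_pow_Phi0 (h i); exists p; rewrite hp mul_polyC.
Qed.

End ReesAlgebra.

Section ExactPhi0.

Variables (K : fieldType) (d u : nat).
Local Notation S := {mpoly K[5]}.
Local Notation q := (qsum d u).
Local Notation Phi0 := (@Phi0 K d u).
Local Notation Phi1 := (Phi1_mx K d u).
Hypotheses (u_gt0 : (0 < u)%N) (u_lt : (2 * u < d)%N) (ud_coprime : coprime u d).

Lemma Phi0_Fpol n : (0 < n)%N -> (n <= q.+2)%N -> Phi0 (Fpol K d u n) = 0.
Proof.
move=> n0 nq; rewrite (Fpol_binom K u_gt0 u_lt ud_coprime n0 nq) Phi0B !Phi0X.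
have [-> ->] := toric_LUm u_gt0 u_lt ud_coprime n0 nq.
exact: subrr.
Qed.

Lemma Phi0_mul_Phi1 (v : 'rV[S]_q.+2) : Phi0 ((v *m Phi1) 0 0) = 0.
Proof.
rewrite mxE Phi0_sum big1 // => i _.
by rewrite Phi0M mxE (Phi0_Fpol (ltn0Sn i) (ltn_ord i)) mulr0.
Qed.

(** Phi_0 sends monomials to monomials, so its vanishing means a zero coefficient sum over each
    fibre; the fibre of m needs a second term. *)
Lemma Phi0_tie (f : S) m : Phi0 f = 0 -> f@_m != 0 ->
  exists2 m', m' != m & [/\ f@_m' != 0, toric_exp d u m' = toric_exp d u m & toricZ m' = toricZ m].
Proof.
move=> hf hm; have := Phi0_coef d u f (toricZ m) (toric_exp d u m).
rewrite hf coef0 mcoeff0 big_mkcond (bigD1_seq m) /=; last exact: msupp_uniq; last first.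
  by rewrite mcoeff_msupp.
have [/hasP[m' h1 /andP[/andP[/eqP h2 /eqP h3] h4]]|hn] := boolP (has (fun m' =>
  ((toricZ m' == toricZ m) && (toric_exp d u m' == toric_exp d u m)) && (m' != m)) (msupp f)).
  by move=> _; exists m' => //; split=> //; rewrite -mcoeff_msupp.
rewrite !eqxx /= big1_seq => [|m' /andP[h1 h2]].
  by rewrite addr0 => /esym/eqP; rewrite (negPf hm).
by move/hasPn: hn => /(_ _ h2); rewrite h1 andbT; case: ifP.
Qed.

Definition lt_monomial (t t' : 'X_{1..5} * 'I_1) : Prop := prec_l d u t.1 t'.1.

Lemma exact_Phi0 (p : S) : Phi0 p = 0 <-> exists v : 'rV[S]_q.+2, p = (v *m Phi1) 0 0.
Proof.
split=> [hp|[v ->]]; last exact: Phi0_mul_Phi1.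
(* The kernel is viewed as a submodule of S^1 in order to apply [division_generates]. *)
pose N (v : 'rV[S]_1) := Phi0 (v 0 0) = 0.
pose A (v : 'rV[S]_1) := exists n, [/\ (0 < n)%N, (n <= q.+2)%N & v = const_mx (Fpol K d u n)].
have lmF n : (0 < n)%N -> (n <= q.+2)%N ->
    is_lm_vec lt_monomial (const_mx (Fpol K d u n)) (leadF d u n, 0).
  move=> n0 nq; have h : (0 + leadF d u n = leadF d u n)%MM by rewrite add0m.
  have := (is_lmE u_gt0 u_lt ud_coprime K 0%MM (leadF d u n) n0 nq).2 (esym h).
  rewrite mpolyX0 mul1r => -[h1 h2]; split; first by rewrite /coef_vec mxE -mcoeff_msupp.
  move=> [m i]; rewrite /coef_vec mxE /= => h3 ne; apply: h2.
    by rewrite mcoeff_msupp.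
  by apply: contra ne => /eqP /= e; rewrite e [i]ord1.
suff : submod_gen A (const_mx p : 'rV[S]_1).
  pose im (v : 'rV[S]_1) := exists w : 'rV[S]_q.+2, v 0 0 = (w *m Phi1) 0 0.
  move/(submod_gen_min (N := im)) => /(_ _ _ _ _) [||||w].
  - by exists 0; rewrite mul0mx !mxE.
  - by move=> v w [v' hv] [w' hw]; exists (v' + w'); rewrite mulmxDl mxE hv hw [RHS]mxE.
  - by move=> c v [v' hv]; exists (c *: v'); rewrite -scalemxAl mxE hv [RHS]mxE.
  - move=> _ [n [n0 nq ->]]; exists (e_ K d u n).
    by rewrite mxE; apply/esym; exact: e_Phi1.
  by rewrite mxE => ->; exists w.
apply: (@division_generates K 1 lt_monomial _ _ _ _ N A).
- by move=> t1 t2 t3; exact: prec_trans.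
- move=> [m i] [m' i'] ne; apply/orP; apply: prec_total; apply: contra ne => /eqP /= e.
  by rewrite e [i]ord1 [i']ord1.
- by move=> m t t'; rewrite /lt_monomial /= prec_add.
- move=> [m i]; elim: (prec_wf d u m) i => {}m _ IH i; constructor=> -[m' i'] h.
  exact: IH.
- by move=> v w; rewrite /N mxE [(- w) 0 0]mxE Phi0B => -> ->; rewrite subr0.
- by move=> a v; rewrite /N mxE Phi0M => ->; rewrite mulr0.
- by move=> _ [n [n0 nq ->]]; rewrite /N mxE; exact: Phi0_Fpol.
- move=> v [m i] hv [h1 h2]; rewrite /coef_vec /= [i]ord1 in h1.
  have [m' ne [h3 h4 h5]] := Phi0_tie hv h1.
  have := h2 (m', i); rewrite /coef_vec /= [i]ord1 => /(_ h3).
  have ne' : (m', 0 : 'I_1) != (m, 0) by rewrite xpair_eqE negb_and ne.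
  move=> /(_ ne') hlt.
  have [n [n0 nq hn]] := toric_Lm_dvd u_gt0 u_lt ud_coprime (esym h4) (esym h5) hlt.
  exists (const_mx (Fpol K d u n)), (leadF d u n, 0); split; [by exists n|exact: lmF|].
  by split; rewrite // [i]ord1.
- by rewrite /N mxE.
Qed.

Lemma exact_Phi1 (v : 'rV[S]_q.+2) :
  v *m Phi1 = 0 <-> exists w : 'rV[S]_(size (F2_basis d u)), v = w *m Phi2_mx K d u.
Proof.
split=> [/(ker_gen u_gt0 u_lt ud_coprime)|[w ->]].
  apply: (submod_gen_min (N := fun v => exists w : 'rV[S]_(size (F2_basis d u)),
    v = w *m Phi2_mx K d u)).
  - by exists 0; rewrite mul0mx.
  - by move=> _ _ [w ->] [w' ->]; exists (w + w'); rewrite mulmxDl.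
  - by move=> c _ [w ->]; exists (c *: w); rewrite scalemxAl.
  move=> g /(nthP 0)[k]; rewrite size_map => hk <-.
  exists (delta_mx 0 (Ordinal hk)); rewrite -rowE rowK /= (nth_map (0, 0)%N) //.
have h i : row i (Phi2_mx K d u) *m Phi1 = 0.
  by rewrite rowK; apply/(ker_gen u_gt0 u_lt ud_coprime)/submod_gen_id/map_f/mem_nth.
rewrite -mulmxA; have -> : Phi2_mx K d u *m Phi1 = 0; last by rewrite mulmx0.
by apply/row_matrixP => i; rewrite row_mul h row0.
Qed.

End ExactPhi0.

(* A generating row that is a combination of the other rows would give a
   relation among the rows with a coefficient 1, whereas minimality puts all
   coefficients of all relations in the irrelevant ideal. *)
Lemma minimal_generators_rows (K : fieldType) (m n r : nat)
  (A : 'M[{mpoly K[5]}]_(n, m)) (B : 'M[{mpoly K[5]}]_(r, n))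
  (N : 'rV[{mpoly K[5]}]_m -> Prop) (G : seq 'rV[{mpoly K[5]}]_m) :
  (forall v, N v <-> submod_gen (fun g => g \in G) v) ->
  (forall g, g \in G -> exists k, g = row k A) ->
  (forall w : 'rV_n, w *m A = 0 -> exists x : 'rV_r, w = x *m B) -> minimal_mx B ->
  minimal_generators N (fun g => g \in G).
Proof.
move=> NG rowG exA minB; split=> // H HG NH g hg.
have [s [c [a [Ha eg]]]] := (NH g).1 ((NG g).2 (submod_gen_id hg)).
have [/existsP[i /eqP <-]|hne] := boolP [exists i, a i == g]; first exact: Ha.
have [k0 e0] := rowG g hg.
have hk i : exists k, (k != k0) && (a i == row k A).
  have [k ek] := rowG _ (HG _ (Ha i)); exists k; rewrite ek eqxx andbT.
  by apply: contraNneq hne => e; apply/existsP; exists i; rewrite ek e e0.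
pose k i := xchoose (hk i).
have k_neq i : k i != k0 by have /andP[] := xchooseP (hk i).
have ka i : a i = row (k i) A by have /andP[_ /eqP] := xchooseP (hk i).
pose w : 'rV_n := delta_mx 0 k0 - \sum_(i < s) c i *: delta_mx 0 (k i).
have [x hx] : exists x : 'rV_r, w = x *m B.
  apply: exA; rewrite /w mulmxBl -rowE -e0 mulmx_suml eg.
  apply/eqP; rewrite subr_eq0; apply/eqP/eq_bigr => i _.
  by rewrite -scalemxAl -rowE ka.
have w1 : w 0 k0 = 1.
  rewrite mxE [in X in _ + X]mxE mxE !eqxx summxE big1 ?subr0 // => i _.
  by rewrite !mxE eq_sym (negPf (k_neq i)) andbF mulr0.
have : (w 0 k0)@_0%MM = 0.
  rewrite hx mxE raddf_sum big1 // => j _.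
  by apply: etrans (rmorphM (mcoeff 0%MM) _ _) _; rewrite /= minB mulr0.
by rewrite w1 mcoeff1 eqxx => /eqP; rewrite oner_eq0.
Qed.

Theorem theorem2p3 (K : fieldType) (d u : nat)
    (u_gt0 : (0 < u)%N) (d_gt0 : (0 < d)%N)
    (u_lt : (2 * u < d)%N) (ud_coprime : coprime u d) :
  [/\ exists (r3 : nat) (shift3 : 'I_r3 -> int * int)
             (Phi3_mx : 'M[{mpoly K[5]}]_(r3, size (F2_basis d u))),
        min_bigraded_resolution d u (@shift1 d u) (@shift2 d u) shift3
          (Phi1_mx K d u) (Phi2_mx K d u) Phi3_mx,
      perm_eq [seq bideg_e2 d u nk | nk <- F2_basis d u] (F2_twists d u),
      reduced_groebner_basis (@prec_F0 K d u) (@kerPhi1 K d u) (calF1 K d u) &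
      minimal_generators (@kerPhi1 K d u) (fun s => s \in calF1 K d u)].
Proof.
split; last 1 first.
- apply: (minimal_generators_rows (A := Phi2_mx K d u) (B := Phi3_mx K d u)).
  + exact: ker_gen.
  + move=> g /(nthP 0)[k]; rewrite size_map => hk <-; exists (Ordinal hk).
    by rewrite rowK (nth_map (0, 0)%N).
  + by move=> w /(exact_Phi3 u_gt0 u_lt ud_coprime).
  + exact: Phi3_minimal.
(* With rank q - 1 for F_3 the alternating sum 1 - (q + 2) + 2q - (q - 1) of the ranks vanishes. *)
- exists (qsum d u).-1, (@shift3 d u), (Phi3_mx K d u); split.
  + exact: in_reesP.
  + exact: exact_Phi0.
  + exact: exact_Phi1.
  + exact: exact_Phi3.
  + exact: Phi3_inj.
  + by move=> D p; apply: Phi0_bigraded; lia.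
  + exact: Phi1_bigraded.
  + exact: Phi2_bigraded.
  + exact: Phi3_bigraded.
  + exact: Phi1_minimal.
  + exact: Phi2_minimal.
  + exact: Phi3_minimal.
- exact: bideg_e2_twists.
- exact: ker_reduced_groebner.
Qed.
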